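(* Let $\alpha\in(0,2]$ and let $X$ be an $(N,d)$-linear multifractional stable sheet in the broad sense whose Hurst functional index $H=(h_1,\ldots,h_N)$ satisfies the standing assumptions $\mathcal H_1$, $\mathcal H_2$ below. Let $I=[\epsilon,T]^N$ with $0<\epsilon<T$. If $d<\inf_{v\in I}\sum_{l=1}^N 1/h_l(v)$, then $X$ has a jointly continuous local time on $I$, i.e. the local time $L(x,[(\epsilon,\ldots,\epsilon),t])$ (has a version that) is almost surely continuous as a function of $(x,t)\in\mathbb R^d\times I$.
   Context: Let $\alpha\in(0,2]$. For $\alpha<2$, $M_\alpha$ denotes a rotationally invariant (symmetric) $\alpha$-stable random measure on $\mathbb R^N$ with Lebesgue control measure; for $\alpha=2$, $M_\alpha$ is the standard Gaussian white noise on $\mathbb R^N$. Let $H(u)=(h_1(u),\ldots,h_N(u))$, $u\in\mathbb R_+^N=[0,\infty)^N$, be a deterministic function with values in $(0,1)^N$. For $u\in\mathbb R_+^N$, $v\in\mathbb R^N$ put $g^{H(u)}(u,v)=c_{H(1)}\prod_{l=1}^N\big[(u_l-v_l)_+^{h_l(u)-1/\alpha}-(-v_l)_+^{h_l(u)-1/\alpha}\big]$, where $a_+=\max\{a,0\}$ and $c_{H(1)}>0$ is a normalizing constant. The real-valued LMSS is $X_0(u)=\int_{\mathbb R^N}g^{H(u)}(u,v)M_\alpha(\mathrm dv)$; for $a_j\in\mathbb R$, $u^j\in\mathbb R_+^N$ one sets $\|\sum_j a_jX_0(u^j)\|_\alpha^\alpha=\int_{\mathbb R^N}|\sum_j a_j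 g^{H(u^j)}(u^j,v)|^\alpha\mathrm dv$, and $\mathbb E e^{i\sum_j a_jX_0(u^j)}=e^{-\|\sum_ja_jX_0(u^j)\|_\alpha^\alpha}$; $c_{H(1)}$ is chosen so that $\|X_0(1,\ldots,1)\|_\alpha=1$. An $(N,d)$-LMSS is $X(u)=(X_1(u),\ldots,X_d(u))$ with $X_1,\ldots,X_d$ independent copies of $X_0$. Standing assumptions: ($\mathcal H_1$) there are constants $0<m_l<M_l<1$ with $m_l\le h_l(u)\le M_l$ for all $u\in\mathbb R_+^N$; ($\mathcal H_2$) for each compact $I\subseteq\mathbb R_+^N$ there is $c=c(I)>0$ such that $|h_l(u)-h_l(v)|\le c\,\rho(u,v)$ for all $u,v\in I$, all $l$, where $\rho(u,v)=\sum_{l=1}^N\min\{|u_l-v_l|^{m_l},|u_l-v_l|^{M_l}\}$. Local time: for a Borel set $J$, the occupation measure is $\mu_J(B)=\lambda_N\{t\in J:X(t)\in B\}$; if $\mu_J\ll\lambda_d$, the local time is $L(x,J)=\frac{\mathrm d\mu_J}{\mathrm d\lambda_d}(x)$. For a rectangle $[a,b]$, $X$ has a jointly continuous local time on $[a,b]$ if $L(x,[a,t])$ is a.s. continuous in $(x,t)\in\mathbb R^d\times[a,b]$. *)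

(* Defs.v *)
From HB Require Import structures.
From mathcomp Require Import all_boot all_order all_algebra.
From mathcomp Require Import all_classical all_reals all_analysis.
Set Implicit Arguments. Unset Strict Implicit. Unset Printing Implicit Defensive.
Import Order.TTheory GRing.Theory Num.Theory.
Import numFieldNormedType.Exports.
Local Open Scope classical_set_scope.
Local Open Scope ring_scope.

(* Points of R^n are n-tuples of reals; n.-tuple R carries the product
   (Borel) sigma-algebra of mathcomp-analysis. *)

(* Lebesgue integral over R^n of a function with values in \bar R,
   computed as an iterated integral against the 1-d Lebesgue measure
   (for nonnegative measurable functions this is the integral with
   respect to the n-dimensional Lebesgue measure, by Tonelli). *)
Fixpoint lebN (R : realType) (n : nat) : (n.-tuple R -> \bar R) -> \bar R :=
  match n return (n.-tuple R -> \bar R) -> \bar R with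
  | 0 => fun f => f [tuple]
  | n'.+1 => fun f =>
      (\int[@lebesgue_measure R]_(x in [set: R]) lebN (fun t => f (cons_tuple x t)))%E
  end.

Definition lebN_set (R : realType) (n : nat) (A : set (n.-tuple R)) : \bar R :=
  lebN (fun t => (\1_A t)%:E).

(* a_+^b with the convention a_+^b = 0 when a <= 0 (so that a_+^0 = 1_{a>0}) *)
Definition ppow (R : realType) (a b : R) : R :=
  if 0 < a then powR a b else 0.

(* The LMSS kernel without the normalizing constant:
   prod_l [ (u_l - v_l)_+^{h_l(u) - 1/alpha} - (-v_l)_+^{h_l(u) - 1/alpha} ] *)
Definition lmss_kernel (R : realType) (N : nat) (alpha : R)
    (h : 'I_N -> N.-tuple R -> R) (u v : N.-tuple R) : R :=
  \prod_(l < N)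
    (ppow (tnth u l - tnth v l) (h l u - alpha^-1)
     - ppow (- tnth v l) (h l u - alpha^-1)).

Definition nonneg_pt (R : realType) (N : nat) (u : N.-tuple R) : Prop :=
  forall l, 0 <= tnth u l.

Definition cst_pt (R : realType) (N : nat) (c : R) : N.-tuple R :=
  [tuple of nseq N c].

Definition rect (R : realType) (N : nat) (a b : N.-tuple R) : set (N.-tuple R) :=
  [set s | forall l, tnth a l <= tnth s l <= tnth b l].

Definition rho (R : realType) (N : nat) (m M : 'I_N -> R) (u v : N.-tuple R) : R :=
  \sum_(l < N) Num.min (powR `|tnth u l - tnth v l| (m l))
                       (powR `|tnth u l - tnth v l| (M l)).

(* identification of N-tuples with row vectors, used to transport the
   (Euclidean product) topology of 'rV[R]_N *)
Definition tup2row (R : realType) (N : nat) (t : N.-tuple R) : 'rV[R]_N :=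
  \row_(i < N) tnth t i.

Definition hurst_assumptions (R : realType) (N : nat)
    (h : 'I_N -> N.-tuple R -> R) : Prop :=
  exists m M : 'I_N -> R,
    (forall l, 0 < m l /\ m l < M l /\ M l < 1) /\
    (forall u, nonneg_pt u -> forall l, m l <= h l u <= M l) /\
    (forall I : set (N.-tuple R), I `<=` (@nonneg_pt R N) ->
       compact (@tup2row R N @` I) ->
       exists c : R, 0 < c /\
         forall u v, I u -> I v -> forall l,
           `|h l u - h l v| <= c * rho m M u v).

(* X = (X_1, ..., X_d) : Omega -> R_+^N -> R^d is an (N,d)-LMSS with
   index alpha, Hurst functional h and normalizing constant c:
   its finite dimensional distributions are given by
   E exp(i sum_j <a_j, X(u^j)>)
     = prod_{k<d} exp(- int_{R^N} |sum_j a_{j,k} c g^{H(u^j)}(u^j,v)|^alpha dv),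
   (components independent copies of X_0); written with cos and sin. *)
Definition is_LMSS (R : realType) (dO : measure_display) (Omega : measurableType dO)
    (P : probability Omega R) (N d : nat) (alpha : R)
    (h : 'I_N -> N.-tuple R -> R) (c : R)
    (X : 'I_d -> Omega -> N.-tuple R -> R) : Prop :=
  forall (n : nat) (u : 'I_n -> N.-tuple R) (a : 'I_n -> 'I_d -> R),
    (forall j, nonneg_pt (u j)) ->
    let S := fun w => \sum_(j < n) \sum_(k < d) a j k * X k w (u j) in
    let nrm := fun k : 'I_d =>
      lebN (fun v => (powR `|\sum_(j < n) a j k * (c * lmss_kernel alpha h (u j) v)| alpha)%:E) in
    (\int[P]_w (cos (S w))%:E = expeR (- \sum_(k < d) nrm k))%E /\
    (\int[P]_w (sin (S w))%:E = 0)%E.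

(* Main.v *)
(* Write the local time as the limit of the Cauchy-kernel averages
   L_k(x, t) = \int_[eps, t] p_q(X(s) - x) ds with q = 2^k, and bound the even
   moments of the differences L_(k+1) - L_k, whose integrand is p_(2q) - p_q.
   The Fourier transform of p_(2q) - p_q is small both for frequencies much
   smaller and much larger than q.  In the expectation of a product over
   s_1, ..., s_m this smallness meets the characteristic function of X: a point
   s_j carrying a large frequency and isolated in one coordinate forces the
   stable norm of the linear combination to be large, because the kernel has a
   singularity at s_j which finite differences do not annihilate.  This gains a
   factor (q^(-1/6) / isolation)^be per point.  The remaining half of the
   characteristic function is integrated out frequency by frequency, from the
   largest l-th coordinate downwards, since on the slab above all the other
   points only one kernel is nonzero; this gives prod (gap_l)^(- d H_l) for every
   coordinate l.  A geometric mean over l with weights proportional to 1 / H_l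
   has all exponents < 1, exactly because d < \sum 1 / H_l, hence is integrable.
   The polynomial decay of high moments in q and the Lipschitz bound O(q^(d+1))
   of L_k give, by comparison with a grid, almost sure locally uniform
   convergence of L_k; the limit is identified by integrating L_k over boxes. *)
Require Import Defs.
From HB Require Import structures.
From mathcomp Require Import all_boot all_order all_algebra.
From mathcomp Require Import all_classical all_reals all_analysis.
From mathcomp Require Import measurable_realfun ring lra zify.
Set Implicit Arguments. Unset Strict Implicit. Unset Printing Implicit Defensive.
Import Order.TTheory GRing.Theory Num.Theory.
Import numFieldNormedType.Exports.
Local Open Scope classical_set_scope.
Local Open Scope ring_scope.

(** * Lebesgue measure on tuples *)

(** No moment of an increment in x or t is estimated: joint continuity comes from the decay in the
    scale q alone, which high moments make faster than any given power of q, hence faster than the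
    growth of the grids. The decay must come from the characteristic function, yet spending all of
    it on decay would leave nothing to integrate the frequencies against; hence the two halves. The
    scale Y = q^(1/6) places q = Y^6 between the thresholds Y^5 and Y^7, outside of which the
    Fourier weights alone gain a factor 1/Y. For alpha < 1 the stable norm obeys no triangle
    inequality and for alpha < 2 there is no Gaussian conditioning; the only substitute is |x -
    y|^alpha <= 4 (|x|^alpha + |y|^alpha), valid for all alpha in (0, 2] at once. The Cauchy kernel
    is convenient because its integrals over boxes and its Fourier transform are elementary, and
    because the latter increases with q, so that the Fourier weight of a difference is
    nonnegative. *)

Lemma ge0_le_integralT d (T : measurableType d) (R : realType)
    (mu : {measure set T -> \bar R}) (D : set T) (f g : T -> \bar R) :
  (forall x, D x -> 0 <= f x)%E -> (forall x, D x -> f x <= g x)%E ->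
  (\int[mu]_(x in D) f x <= \int[mu]_(x in D) g x)%E.
Proof.
move=> f0 fg; have g0 x : D x -> (0 <= g x)%E.
  by move=> Dx; exact: (le_trans (f0 _ Dx) (fg _ Dx)).
(* Both sides are suprema over simple functions below the integrand, so no measurability is
   required. *)
rewrite !ge0_integralE//; apply: ge_ereal_sup => _ [h hf <-].
apply: ereal_sup_ubound; exists h => // x.
by apply: (le_trans (hf x)); apply: lee_restrict.
Qed.

Section lebN_measure.
Variable R : realType.
Local Notation leb := (@lebesgue_measure R).

Definition cons_pair n (p : R * n.-tuple R) : n.+1.-tuple R :=
  cons_tuple p.1 p.2.

Lemma measurable_cons_pair n : measurable_fun setT (@cons_pair n).
Proof.
by apply: measurable_cons; [exact: measurable_fst|exact: measurable_snd].
Qed.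

Section step.
Variables (n : nat) (m : {sigma_finite_measure set (n.-tuple R) -> \bar R}).

(** Tuples carry the sigma-algebra generated by their coordinates, not that of a binary product, so
    the product measure is transported along [cons_pair]. *)
Definition cons_measure : set (n.+1.-tuple R) -> \bar R :=
  pushforward (leb \x m)%E (@cons_pair n).

Let cm0 : cons_measure set0 = 0%E.
Proof. by rewrite /cons_measure /pushforward preimage_set0 measure0. Qed.

Let measurable_preimage_cons (A : set (n.+1.-tuple R)) : measurable A ->
  measurable (@cons_pair n @^-1` A).
Proof.
by move=> mA; rewrite -[X in measurable X]setTI; exact: measurable_cons_pair.
Qed.

Let cm_ge0 A : (0 <= cons_measure A)%E.
Proof. by rewrite /cons_measure /pushforward; apply: measure_ge0. Qed.

Let cm_sigma_additive : semi_sigma_additive cons_measure.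
Proof.
move=> F mF tF mUF; rewrite /cons_measure /pushforward preimage_bigcup.
apply: measure_semi_sigma_additive.
- by move=> k; exact: measurable_preimage_cons.
- apply/trivIsetP => /= i j _ _ ij; rewrite -preimage_setI.
  by move/trivIsetP : tF => /(_ _ _ _ _ ij) ->//; rewrite preimage_set0.
- by rewrite -preimage_bigcup; exact: measurable_preimage_cons.
Qed.

HB.instance Definition _ := isMeasure.Build _ _ _
  cons_measure cm0 cm_ge0 cm_sigma_additive.

Let cm_sigma_finite : sigma_finite setT cons_measure.
Proof.
have [F [FT ndF mF]] := (sigma_finiteP _ m).1 (sigma_finiteT m).
(* Finite-measure exhaustion: the head in [-k, k], the tail in the k-th set of an exhaustion for
   [m]. *)
pose A k : set (n.+1.-tuple R) :=
  [set t | `[- k%:R, k%:R]%classic (thead t) /\ F k [tuple of behead t]].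
exists A.
  apply/esym; rewrite -subTset => t _.
  have [k _ Fk] : (\bigcup_i F i) [tuple of behead t] by rewrite -FT.
  have /archi_boundP := normr_ge0 (thead t).
  set j := Num.bound _ => tj.
  exists (maxn j k) => //; split; last first.
    by move/subsetPset: (ndF _ _ (leq_maxr j k)); exact.
  rewrite /= in_itv/= -ler_norml (le_trans (ltW tj))// ler_nat leq_maxl.
  by [].
move=> k; have [mFk Fkoo] := mF k.
have -> : A k = (fun t : n.+1.-tuple R => thead t) @^-1` `[- k%:R, k%:R]%classic
    `&` (fun t : n.+1.-tuple R => [tuple of behead t]) @^-1` F k by [].
split.
  apply: measurableI; rewrite -[X in measurable X]setTI.
    exact: (measurable_tnth ord0).
  exact: measurable_behead.
rewrite [X in (X < _)%E](_ : _ = (leb \x m)%E (`[- k%:R, k%:R]%classic `*` F k)).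
  rewrite product_measure1E//= lebesgue_measure_itv/=.
  by case: ifP => _; rewrite ?mul0e// lte_mul_pinfty// ?EFinN ?fin_numD//
     ?lee_fin ?opprK ?addr_ge0.
apply: (congr1 (leb \x m)%E); apply/seteqP.
have bK (x : R) (t : n.-tuple R) : [tuple of behead (cons_tuple x t)] = t.
  exact/val_inj.
by split => -[x t] /=; rewrite theadE bK.
Qed.

HB.instance Definition _ := Measure_isSigmaFinite.Build _ _ _
  cons_measure cm_sigma_finite.

End step.
End lebN_measure.

Section lebT.
Variable R : realType.
Local Notation leb := (@lebesgue_measure R).

(** [lebN] is only an iterated integral, whereas Fubini and the convergence theorems need a
    sigma-finite measure. [lebN_integral] passes from one to the other for nonnegative measurable
    functions. *)
Fixpoint lebT n : {sigma_finite_measure set (n.-tuple R) -> \bar R} :=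
  match n with
  | 0 => dirac ([tuple] : 0.-tuple R)
  | n'.+1 => cons_measure (lebT n')
  end.

Lemma measurable_fun_cons n d (T : measurableType d) (f : n.+1.-tuple R -> T) x :
  measurable_fun setT f -> measurable_fun setT (fun t => f (cons_tuple x t)).
Proof.
move=> mf; apply: (measurableT_comp mf).
by apply: measurable_cons => //; exact: measurable_cst.
Qed.

Lemma integral_lebTS n (f : n.+1.-tuple R -> \bar R) : measurable_fun [set: n.+1.-tuple R] f ->
  (forall t, 0 <= f t)%E ->
  (\int[lebT n.+1]_t f t = \int[leb]_x \int[lebT n]_t f (cons_tuple x t))%E.
Proof.
move=> mf f0.
have mc : measurable_fun [set: measurableTypeR R * n.-tuple R] (@cons_pair R n).
  exact: measurable_cons_pair.
transitivity (\int[leb \x lebT n]_p (f \o @cons_pair R n) p)%E.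
  have := ge0_integral_pushforward mc (leb \x lebT n)%E measurableT mf (fun t _ => f0 t).
  by rewrite preimage_setT.
rewrite fubini_tonelli1//.
  exact: (measurableT_comp mf mc).
by move=> p; exact: f0.
Qed.

Lemma lebN_integral n (f : n.-tuple R -> \bar R) : measurable_fun [set: n.-tuple R] f ->
  (forall t, 0 <= f t)%E -> lebN f = (\int[lebT n]_t f t)%E.
Proof.
elim: n f => [|n IH] f mf f0.
  by rewrite /= integral_dirac// diracT mul1e.
rewrite integral_lebTS//=; apply: eq_integral => x _; apply: IH => //.
exact: measurable_fun_cons.
Qed.

Lemma integral_leb_shift (f : R -> \bar R) (a : R) : measurable_fun setT f ->
  (forall x, 0 <= f x)%E -> (\int[leb]_x f (x + a)%R = \int[leb]_x f x)%E.
Proof.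
move=> mf f0.
have mt : measurable_fun [set: measurableTypeR R]
   ((fun x : R => (x + a)%R : R) : _ -> measurableTypeR R).
  by apply: measurable_funD => //; exact: measurable_cst.
have := ge0_integral_pushforward mt leb measurableT mf (fun t _ => f0 t).
rewrite preimage_setT => <-.
(* The translated measure gives each half-open interval its length, so it is Lebesgue measure by
   uniqueness. *)
apply: eq_measure_integral => A mA _; apply/esym.
apply: lebesgue_measure_unique => // _ [[b c]] _ <-.
transitivity (leb `]b - a, c - a]%classic); last first.
  apply: (congr1 leb); apply/seteqP.
  by split => x /=; rewrite !in_itv/= ltrBlDr lerBrDr.
rewrite /= !lebesgue_measure_itv/= !lte_fin ltrD2r; case: ifP => // _.
by rewrite -!EFinB; congr (_%:E); ring.
Qed.

Definition addT n (v w : n.-tuple R) : n.-tuple R :=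
  [tuple tnth v i + tnth w i | i < n].

Lemma measurable_addT n d (T : measurableType d) (f g : T -> n.-tuple R) :
  measurable_fun setT f -> measurable_fun setT g ->
  measurable_fun setT (fun x => addT (f x) (g x)).
Proof.
move=> /measurable_fun_tnthP mf /measurable_fun_tnthP mg.
apply/measurable_fun_tnthP => i; rewrite (_ : _ \o _ =
   (fun x => tnth (f x) i + tnth (g x) i)); last first.
  by apply/funext => x /=; rewrite tnth_mktuple.
by apply: measurable_funD; [exact: mf|exact: mg].
Qed.

Lemma integral_lebT_shift n (w : n.-tuple R) (f : n.-tuple R -> \bar R) :
  measurable_fun [set: n.-tuple R] f -> (forall t, 0 <= f t)%E ->
  (\int[lebT n]_t f (addT t w) = \int[lebT n]_t f t)%E.
Proof.
elim: n w f => [|n IH] w f mf f0.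
  by apply: eq_integral => t _; rewrite [addT _ _]tuple0 [t]tuple0.
rewrite integral_lebTS//; last first.
  by apply: (measurableT_comp mf); apply: measurable_addT => //; exact: measurable_cst.
rewrite integral_lebTS//.
have E x (t : n.-tuple R) : addT (cons_tuple x t) w =
    cons_tuple (x + thead w) (addT t [tuple of behead w]).
  apply/eq_from_tnth => i; rewrite tnth_mktuple; case: (unliftP ord0 i) => [j ->|->].
    by rewrite !tnthS tnth_mktuple; congr (_ + _); rewrite [in LHS](tuple_eta w) tnthS.
  by rewrite !tnth0 /thead.
under eq_integral => x _.
  under eq_integral do rewrite E.
  rewrite (IH _ (fun t => f (cons_tuple (x + thead w) t)))//; first over.
  exact: measurable_fun_cons.
rewrite (integral_leb_shift (f := fun x => (\int[lebT n]_t f (cons_tuple x t))%E))//.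
  apply: (@measurable_fun_fubini_tonelli_F _ _ R _ _ (lebT n) (f \o @cons_pair R n)) => //.
  exact: (measurableT_comp mf (@measurable_cons_pair R n)).
  by move=> x; exact: f0.
by move=> x; apply: integral_ge0.
Qed.

Local Notation "\prode_ ( i < n ) F" := (\big[*%E/1%E]_(i < n) F)
  (at level 36, i, n at level 50).

Lemma measurable_prode n d (T : measurableType d) (f : 'I_n -> T -> \bar R) :
  (forall i, measurable_fun setT (f i)) ->
  measurable_fun setT (fun t => \prode_(i < n) f i t)%E.
Proof.
elim: n f => [|n IH] f mf.
  by under eq_fun do rewrite big_ord0; exact: measurable_cst.
under eq_fun do rewrite big_ord_recl.
by apply: emeasurable_funM => //; exact: (IH (fun i => f (lift ord0 i))).
Qed.

Lemma integral_lebT_prod n (f : 'I_n -> R -> \bar R) :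
  (forall i, measurable_fun setT (f i)) -> (forall i x, 0 <= f i x)%E ->
  (\int[lebT n]_t \prode_(i < n) f i (tnth t i) =
   \prode_(i < n) \int[leb]_x f i x)%E.
Proof.
elim: n f => [|n IH] f mf f0.
  rewrite big_ord0; under eq_integral do rewrite big_ord0.
  by rewrite integral_cst//= mul1e; rewrite /dirac indicT.
rewrite integral_lebTS//; last 2 first.
- apply: measurable_prode => i; apply: (measurableT_comp (mf i)).
  exact: measurable_tnth.
- by move=> t; apply: prode_ge0 => i _; exact: f0.
rewrite big_ord_recl -ge0_integralZr//; last 2 first.
- exact: mf.
- by apply: prode_ge0 => i _; exact: integral_ge0.
apply: eq_integral => x _.
rewrite -(IH (fun i => f (lift ord0 i)))//.
rewrite -ge0_integralZl//; last 2 first.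
- apply: measurable_prode => i; apply: (measurableT_comp (mf _)).
  exact: measurable_tnth.
- by move=> t _; apply: prode_ge0 => i _; exact: f0.
apply: eq_integral => t _; rewrite big_ord_recl tnth0; congr (_ * _)%E.
by apply: eq_bigr => i _; rewrite tnthS.
Qed.

End lebT.

(** * Calculus of the Cauchy kernel *)

Section calculus.
Variable R : realType.
Local Notation leb := (@lebesgue_measure R).
Implicit Types f g F : R -> R.

Lemma isd_val f (x a b : R) : is_derive x 1 f a -> a = b -> is_derive x 1 f b.
Proof. by move=> ? <-. Qed.

Lemma isd_cst (x c : R) : is_derive x 1 (fun _ : R => c) 0.
Proof. exact: is_derive_cst. Qed.

Lemma isd_id (x : R) : is_derive x 1 (fun y : R => y) 1.
Proof. exact: is_derive_id. Qed.

Lemma isdD f g (x a b : R) : is_derive x 1 f a -> is_derive x 1 g b ->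
  is_derive x 1 (fun y => f y + g y) (a + b).
Proof. by move=> ? ?; exact: is_deriveD. Qed.

Lemma isdN f (x a : R) : is_derive x 1 f a -> is_derive x 1 (fun y => - f y) (- a).
Proof. by move=> ?; exact: is_deriveN. Qed.

Lemma isdB f g (x a b : R) : is_derive x 1 f a -> is_derive x 1 g b ->
  is_derive x 1 (fun y => f y - g y) (a - b).
Proof. by move=> ? ?; exact: is_deriveB. Qed.

Lemma isdM f g (x a b : R) : is_derive x 1 f a -> is_derive x 1 g b ->
  is_derive x 1 (fun y => f y * g y) (f x * b + g x * a).
Proof. by move=> ? ?; exact: is_deriveM. Qed.

Lemma isdZ f (x c a : R) : is_derive x 1 f a ->
  is_derive x 1 (fun y => c * f y) (c * a).
Proof. by move=> ?; exact: is_deriveZ. Qed.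

Lemma isd_comp f g (x a b : R) : is_derive x 1 f a -> is_derive (f x) 1 g b ->
  is_derive x 1 (fun y => g (f y)) (a * b).
Proof. by move=> fa gb; apply: isd_val (is_derive1_comp gb fa) _; rewrite mulrC. Qed.

Lemma isdV f (x a : R) : f x != 0 -> is_derive x 1 f a ->
  is_derive x 1 (fun y => (f y)^-1) (- a / (f x) ^+ 2).
Proof.
move=> fx fa; apply: isd_val (is_deriveV fx fa) _.
by rewrite /GRing.scale/= mulNr mulrC mulNr.
Qed.

Lemma deriv_continuous f (f' : R -> R) :
  (forall x : R, is_derive x 1 f (f' x)) -> continuous f.
Proof.
move=> df x; apply: differentiable_continuous; apply/derivable1_diffP.
exact: ex_derive.
Qed.

Lemma ftc_segment F f (a b : R) : a < b ->
  (forall x : R, is_derive x 1 F (f x)) -> continuous f ->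
  (\int[leb]_(x in `[a, b]) (f x)%:E = (F b - F a)%:E)%E.
Proof.
move=> ab dF cf; rewrite (@continuous_FTC2 _ f F)//.
- exact: continuous_subspaceT.
- split.
  + by move=> x _; exact: ex_derive.
  + by apply: cvg_at_right_filter; exact: (deriv_continuous dF).
  + by apply: cvg_at_left_filter; exact: (deriv_continuous dF).
- by move=> x _; rewrite derive1E; exact: derive_val.
Qed.

Lemma ftc_infty F f (a l : R) : (forall x, 0 <= f x) ->
  (forall x : R, is_derive x 1 F (f x)) -> continuous f ->
  F x @[x --> +oo%R] --> l ->
  (\int[leb]_(x in `[a, +oo[) (f x)%:E = (l - F a)%:E)%E.
Proof.
move=> f0 dF cf Fl; rewrite (@ge0_continuous_FTC2y _ f F a l)//.
- exact: continuous_subspaceT.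
- by apply: cvg_at_right_filter; exact: (deriv_continuous dF).
- by move=> x _; rewrite derive1E; exact: derive_val.
Qed.

Lemma integral_leb_opp (f : R -> \bar R) : measurable_fun setT f ->
  (forall x, 0 <= f x)%E -> (\int[leb]_x f (- x)%R = \int[leb]_x f x)%E.
Proof.
move=> mf f0.
have mt : measurable_fun [set: measurableTypeR R]
   ((-%R : R -> R) : _ -> measurableTypeR R) by exact: oppr_measurable.
have := ge0_integral_pushforward mt leb measurableT mf (fun t _ => f0 t).
rewrite preimage_setT => <-.
by apply: eq_measure_integral => A mA _; exact: lebesgue_measureN.
Qed.

Lemma integral_leb_split (f : R -> \bar R) : measurable_fun setT f ->
  (forall x, 0 <= f x)%E ->
  (\int[leb]_x f x = \int[leb]_(x in `[0%R, +oo[) f x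
                   + \int[leb]_(x in `[0%R, +oo[) f (- x)%R)%E.
Proof.
move=> mf f0.
rewrite -(setUv `[0%R : R, +oo[%classic) ge0_integral_setU//=; last 3 first.
- exact: measurableC.
- by rewrite setUv.
- exact/disj_setPCl.
congr (_ + _)%E.
rewrite -[RHS](integral_itv_obnd_cbnd (b := +oo%O)); last first.
  by apply: measurable_funTS; apply: (measurableT_comp mf); exact: oppr_measurable.
rewrite integral_mkcond [RHS]integral_mkcond.
rewrite -[LHS]integral_leb_opp.
- apply: eq_integral => x _; rewrite !patchE; congr (if _ then _ else _).
  rewrite !mem_setE; apply/idP/idP => /=; rewrite in_itv/= ?andbT ?in_setE/= ?in_itv/= ?andbT.
    by move=> /negP; rewrite -ltNge oppr_lt0.
  by move=> x0; apply/negP; rewrite -ltNge oppr_lt0.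
- by apply/(measurable_restrictT _ _).1 => //; [exact: measurableC|exact: measurable_funTS].
- by move=> x; apply: erestrict_ge0.
Qed.

Lemma integral_cauchy (r a : R) : 0 < r ->
  (\int[leb]_x ((1 + (r * (x - a)) ^+ 2)^-1)%:E = (pi / r)%:E)%E.
Proof.
move=> r0.
pose f x := (1 + (r * x) ^+ 2)^-1.
have f0 x : 0 <= f x by rewrite invr_ge0 addr_ge0// sqr_ge0.
have den (x : R) : 1 + (r * x) ^+ 2 != 0 by rewrite gt_eqF// ltr_pwDl// sqr_ge0.
have dl (x : R) : is_derive x 1 (fun y => r * y) r.
  by apply: isd_val (isdZ r (isd_id x)) _; rewrite mulr1.
have cf : continuous f.
  apply: (@deriv_continuous _ (fun x => - (r * x * r + r * x * r) / (1 + (r * x) ^+ 2) ^+ 2)) => x.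
  apply: isdV => //.
  apply: isd_val (isdD (isd_cst x 1) (isdM (dl x) (dl x))) _.
  by rewrite add0r.
have mf : measurable_fun [set: R] (fun x => (f x)%:E).
  by apply/measurable_EFinP; exact: continuous_measurable_fun.
rewrite (integral_leb_shift (f := fun x => (f x)%:E))//.
rewrite integral_leb_split//.
have -> : (\int[leb]_(x in `[0%R, +oo[) (f (- x))%:E =
   \int[leb]_(x in `[0%R, +oo[) (f x)%:E)%E.
  by apply: eq_integral => x _; rewrite /f mulrN sqrrN.
pose F x := atan (r * x) / r.
have -> : (\int[leb]_(x in `[0%R, +oo[) (f x)%:E = (pi / 2 / r - F 0)%:E)%E.
  apply: ftc_infty => //.
    move=> x; rewrite (_ : F = (fun y => r^-1 * atan (r * y))); last first.
      by apply/funext => y; rewrite mulrC.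
    apply: isd_val (isdZ r^-1 (isd_comp (dl x) (is_derive1_atan (r * x)))) _.
    by rewrite mulrA mulVf ?mul1r// gt_eqF.
  apply: cvgMr_tmp => //.
  apply: (@cvg_comp _ _ _ (fun x => r * x) atan _ _ _ _ (@cvgy_atan R)).
  exact: gt0_cvgMry.
by rewrite /F mulr0 atan0 mul0r subr0 -EFinD -mulrDl -splitr.
Qed.

End calculus.

(** * Cauchy kernel and its one-dimensional Fourier transform *)

Section poisson_kernel.
Variable R : realType.
Local Notation leb := (@lebesgue_measure R).

(** For X > 0, the density of the Cauchy law of scale 1/X, with Fourier transform exp(-|xi| / X). *)
Definition pk (X y : R) : R := X / (pi * (1 + (X * y) ^+ 2)).

Lemma oneDsqr_gt0 (u : R) : 0 < 1 + u ^+ 2.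
Proof. by rewrite ltr_pwDl// sqr_ge0. Qed.

Lemma pk_ge0 X y : 0 <= X -> 0 <= pk X y.
Proof. by move=> X0; rewrite divr_ge0// mulr_ge0 ?pi_ge0// ltW// oneDsqr_gt0. Qed.

Lemma pk_inv X y : pk X y = X / pi * (1 + (X * y) ^+ 2)^-1.
Proof. by rewrite /pk invfM mulrA. Qed.

Lemma pi_ge1 : 1 <= pi :> R.
Proof. by apply: le_trans (pi_ge2 R); rewrite ler1n. Qed.

Lemma pk_le X y : 0 <= X -> pk X y <= X.
Proof.
move=> X0; rewrite /pk ler_pdivrMr ?mulr_gt0 ?pi_gt0 ?oneDsqr_gt0//.
rewrite ler_peMr// -[leLHS]mulr1; apply: ler_pM => //; first exact: pi_ge1.
by rewrite lerDl sqr_ge0.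
Qed.

Lemma pk_lipschitz X y z : 0 <= X -> `|pk X y - pk X z| <= X ^+ 2 * `|y - z|.
Proof.
move=> X0.
(* The difference is (v - u)(u + v) over the product of the denominators, and |u + v| <= 1 + u^2 +
   v^2 is at most that product. *)
have H (u v : R) : `|(1 + u ^+ 2)^-1 - (1 + v ^+ 2)^-1| <= `|u - v|.
  have ud := oneDsqr_gt0 u; have vd := oneDsqr_gt0 v.
  have -> : (1 + u ^+ 2)^-1 - (1 + v ^+ 2)^-1 =
     (v - u) * ((u + v) / ((1 + u ^+ 2) * (1 + v ^+ 2))).
    by field; rewrite !gt_eqF.
  rewrite normrM distrC ler_piMr// normrM normfV.
  rewrite [X in _ / X]gtr0_norm ?mulr_gt0// ler_pdivrMr ?mulr_gt0// mul1r.
  apply: (@le_trans _ _ (1 + u ^+ 2 + v ^+ 2)); last first.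
    rewrite mulrDl mul1r mulrDr mulr1 addrACA [1 + _ + _]addrAC -addrA addrC -subr_ge0.
    by rewrite (_ : _ - _ = (u * v) ^+ 2) ?sqr_ge0//; ring.
  have hu := sqr_ge0 (u - 1); have hv := sqr_ge0 (v - 1).
  have hu' := sqr_ge0 (u + 1); have hv' := sqr_ge0 (v + 1).
  by rewrite ler_norml; apply/andP; split; nra.
rewrite !pk_inv -mulrBr normrM ger0_norm ?divr_ge0 ?pi_ge0//.
apply: le_trans (ler_wpM2l _ (H _ _)) _; first by rewrite divr_ge0 ?pi_ge0.
rewrite -mulrBr normrM ger0_norm// mulrA ler_wpM2r//.
rewrite expr2 ler_wpM2r// ler_pdivrMr ?pi_gt0//.
by rewrite ler_peMr// pi_ge1.
Qed.

Lemma pk_continuous X : continuous (pk X).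
Proof.
have dl (x : R) : is_derive x 1 (fun y => X * y) X.
  by apply: isd_val (isdZ X (isd_id x)) _; rewrite mulr1.
rewrite (_ : pk X = (fun y => X / pi * (1 + (X * y) ^+ 2)^-1)); last first.
  by apply/funext => y; rewrite pk_inv.
apply: (@deriv_continuous _ _ (fun x => X / pi * (- (X * x * X + X * x * X) / (1 + (X * x) ^+ 2) ^+ 2))) => x.
apply: isdZ; apply: isdV; first by rewrite gt_eqF// oneDsqr_gt0.
apply: isd_val (isdD (isd_cst x 1) (isdM (dl x) (dl x))) _.
by rewrite add0r.
Qed.

Lemma measurable_pk X : measurable_fun [set: R] (pk X).
Proof. by apply: continuous_measurable_fun; exact: pk_continuous. Qed.

Lemma integral_pk_segment X y (a b : R) : 0 < X -> a < b ->
  (\int[leb]_(x in `[a, b]) (pk X (x - y))%:E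
   = ((atan (X * (b - y)) - atan (X * (a - y))) / pi)%:E)%E.
Proof.
move=> X0 ab.
have dl (x : R) : is_derive x 1 (fun x => X * (x - y)) X.
  apply: isd_val (isdZ X (isdB (isd_id x) (isd_cst x y))) _.
  by rewrite subr0 mulr1.
pose F x := pi^-1 * atan (X * (x - y)).
transitivity (F b - F a)%:E; [apply: ftc_segment => //|by rewrite -mulrBr mulrC].
- move=> x; apply: isd_val (isdZ pi^-1 (isd_comp (dl x) (is_derive1_atan _))) _.
  by rewrite pk_inv mulrCA mulrA.
- move=> x; apply: (@continuous_comp _ _ _ (fun x => x - y) (pk X)).
    exact: (@deriv_continuous _ _ _ (fun x => isdB (isd_id x) (isd_cst x y))).
  exact: pk_continuous.
Qed.

(** Adding 1 to the cosine makes the integrand nonnegative, so the fundamental theorem on a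
    half-line applies without an integrability proof. The free phase c is what makes the later
    induction on the dimension possible. *)
Lemma fourier_half (lam y c : R) : 0 < lam ->
  (\int[leb]_(x in `[0%R, +oo[) (expR (- (lam * x)) * (1 + cos (x * y + c)))%:E
   = (lam^-1 + (lam * cos c - y * sin c) / (lam ^+ 2 + y ^+ 2))%:E)%E.
Proof.
move=> l0.
have D0 : 0 < lam ^+ 2 + y ^+ 2 by rewrite ltr_pwDl ?sqr_ge0// exprn_gt0.
(* [expR (- (lam * x)) * G x] is a primitive; it tends to 0 at infinity because [G] is bounded. *)
pose G x := - lam^-1 + (y * sin (x * y + c) - lam * cos (x * y + c)) / (lam ^+ 2 + y ^+ 2).
have dxy (x : R) : is_derive x 1 (fun x => x * y + c) y.
  apply: isd_val (isdD (isdM (isd_id x) (isd_cst x y)) (isd_cst x c)) _.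
  by rewrite mulr0 add0r mulr1 addr0.
have dE (x : R) : is_derive x 1 (fun x => expR (- (lam * x))) (- lam * expR (- (lam * x))).
  apply: isd_val (isd_comp (isdN (isdZ lam (isd_id x))) (is_derive_expR _)) _.
  by rewrite mulr1.
have dsin (x : R) : is_derive x 1 (fun x => sin (x * y + c)) (y * cos (x * y + c)).
  exact: (isd_comp (dxy x) (is_derive_sin _)).
have dcos (x : R) : is_derive x 1 (fun x => cos (x * y + c)) (- (y * sin (x * y + c))).
  by apply: isd_val (isd_comp (dxy x) (is_derive_cos _)) _; rewrite mulrN.
pose F x := expR (- (lam * x)) * G x.
transitivity ((0 - F 0)%:E); [apply: ftc_infty|].
- by move=> x; rewrite mulr_ge0 ?expR_ge0.
- move=> x; have dG : is_derive x 1 G ((y * (y * cos (x * y + c)) - lam * (- (y * sin (x * y + c)))) / (lam ^+ 2 + y ^+ 2)).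
    apply: isd_val (isdD (isd_cst x _) (isdM (isdB (isdZ y (dsin x)) (isdZ lam (dcos x))) (isd_cst x _))) _.
    by rewrite add0r mulr0 add0r mulrC.
  apply: isd_val (isdM (dE x) dG) _; rewrite /G.
  by field; rewrite !gt_eqF.
- apply: (@deriv_continuous _ _ _ (fun x => isdM (dE x) (isdD (isd_cst x 1) (dcos x)))).
- pose K := lam^-1 + (`|y| + lam) / (lam ^+ 2 + y ^+ 2).
  have GK x : `|G x| <= K.
    apply: le_trans (ler_normD _ _) _; rewrite normrN gtr0_norm ?invr_gt0// lerD2l.
    rewrite normrM [X in _ * X]gtr0_norm ?invr_gt0// ler_wpM2r ?invr_ge0 ?(ltW D0)//.
    apply: le_trans (ler_normB _ _) _; rewrite !normrM lerD//.
      by rewrite ler_piMr// ler_norml sin_geN1 sin_le1.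
    by rewrite (gtr0_norm l0) ler_piMr ?(ltW l0)// ler_norml cos_geN1 cos_le1.
  have K0 : 0 <= K := le_trans (normr_ge0 _) (GK 0).
  have h : K * expR (- (lam * x)) @[x --> +oo%R] --> (0 : R).
    rewrite -[X in _ --> X](mulr0 K); apply: cvgMl_tmp.
    apply: (@cvg_comp _ _ _ (fun x => lam * x) (fun x => expR (- x)) _ _ _ _ (@cvgr_expR R)).
    exact: gt0_cvgMry.
  apply: (squeeze_cvgr _ _ h).
    2: by rewrite -[X in _ --> X]oppr0; exact: (cvgN h).
  near=> x; rewrite /F -ler_norml normrM ger0_norm ?expR_ge0// mulrC.
  by rewrite ler_wpM2r ?expR_ge0.
- rewrite sub0r /F /G mulr0 oppr0 expR0 mul1r mul0r add0r opprD opprK.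
  by rewrite -mulNr opprB.
Unshelve. all: by end_near. Qed.

Lemma fourier1 (lam y c : R) : 0 < lam ->
  (\int[leb]_x (expR (- (lam * `|x|)) * (1 + cos (x * y + c)))%:E
   = (2 / lam + cos c * (2 * lam / (lam ^+ 2 + y ^+ 2)))%:E)%E.
Proof.
move=> l0.
have D0 : 0 < lam ^+ 2 + y ^+ 2 by rewrite ltr_pwDl ?sqr_ge0// exprn_gt0.
rewrite integral_leb_split.
- under eq_integral => x.
    rewrite inE/= in_itv/= andbT => x0; rewrite (ger0_norm x0); over.
  rewrite /= fourier_half//.
  under eq_integral => x.
    rewrite inE/= in_itv/= andbT => x0.
    rewrite normrN (ger0_norm x0) mulNr -mulrN; over.
  rewrite /= fourier_half// sqrrN -EFinD; congr (_%:E).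
  by field; rewrite !gt_eqF.
- apply/measurable_EFinP; apply: continuous_measurable_fun => x.
  apply: cvgM.
    apply: continuous_comp; last exact: continuous_expR.
    apply: cvgN; apply: cvgMl_tmp; exact: norm_continuous.
  apply: cvgD; first exact: cvg_cst.
  apply: continuous_comp; last exact: continuous_cos.
  by apply: cvgD; [apply: cvgMr_tmp; exact: cvg_id|exact: cvg_cst].
- by move=> x; rewrite lee_fin mulr_ge0 ?expR_ge0.
Qed.

End poisson_kernel.

(** * Fourier transform of the product kernel on tuples *)

Section fourier_lebT.
Variable R : realType.
Local Notation leb := (@lebesgue_measure R).

Lemma oneDcos_ge0 (x : R) : 0 <= 1 + cos x.
Proof. by have := cos_geN1 x; lra. Qed.

Lemma measurable_cosT d (T : measurableType d) (f : T -> R) :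
  measurable_fun setT f -> measurable_fun setT (fun x => cos (f x)).
Proof.
move=> mf; apply: (measurableT_comp _ mf).
by apply: continuous_measurable_fun; exact: continuous_cos.
Qed.

Lemma measurable_expRT d (T : measurableType d) (f : T -> R) :
  measurable_fun setT f -> measurable_fun setT (fun x => expR (f x)).
Proof. by move=> mf; apply: (measurableT_comp _ mf); exact: measurable_expR. Qed.

Lemma measurable_absT d (T : measurableType d) (f : T -> R) :
  measurable_fun setT f -> measurable_fun setT (fun x => `|f x|).
Proof. by move=> mf; exact: (measurableT_comp _ mf). Qed.

Lemma measurable_tnthT n d (T : measurableType d) (f : T -> n.-tuple R) i :
  measurable_fun setT f -> measurable_fun setT (fun x => tnth (f x) i).
Proof. by move=> mf; apply: (measurableT_comp (measurable_tnth i) mf). Qed.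

Definition dotp n (xi : n.-tuple R) (y : 'I_n -> R) : R :=
  \sum_(i < n) tnth xi i * y i.

Definition expabs n (lam : R) (xi : n.-tuple R) : R :=
  \prod_(i < n) expR (- (lam * `|tnth xi i|)).

Lemma expabs_ge0 n lam (xi : n.-tuple R) : 0 <= expabs lam xi.
Proof. by apply: prodr_ge0 => i _; exact: expR_ge0. Qed.

Lemma measurable_expabs n d (T : measurableType d) lam (f : T -> n.-tuple R) :
  measurable_fun setT f -> measurable_fun setT (fun x => expabs lam (f x)).
Proof.
move=> mf; apply: measurable_prod => i _; apply: measurable_expRT.
apply: measurable_funN; apply: measurable_funM => //.
by apply: measurable_absT; exact: measurable_tnthT.
Qed.

Lemma measurable_dotp n d (T : measurableType d) (f : T -> n.-tuple R)
    (g : T -> 'I_n -> R) :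
  measurable_fun setT f -> (forall i, measurable_fun setT (fun x => g x i)) ->
  measurable_fun setT (fun x => dotp (f x) (g x)).
Proof.
move=> mf mg; apply: measurable_sum => i.
by apply: measurable_funM => //; exact: measurable_tnthT.
Qed.

Lemma dotp_cons n x (xi : n.-tuple R) (y : 'I_n.+1 -> R) :
  dotp (cons_tuple x xi) y = x * y ord0 + dotp xi (fun i => y (lift ord0 i)).
Proof.
rewrite /dotp big_ord_recl tnth0; congr (_ + _).
by apply: eq_bigr => i _; rewrite tnthS.
Qed.

Lemma expabs_cons n lam x (xi : n.-tuple R) :
  expabs lam (cons_tuple x xi) = expR (- (lam * `|x|)) * expabs lam xi.
Proof.
rewrite /expabs big_ord_recl tnth0; congr (_ * _).
by apply: eq_bigr => i _; rewrite tnthS.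
Qed.

(** By induction on n with c universally quantified: the first coordinate x is absorbed into the
    phase of the inner integral, which becomes x * y_0 + c. *)
Lemma fourierd n (lam c : R) (y : 'I_n -> R) : 0 < lam ->
  (\int[lebT R n]_xi (expabs lam xi * (1 + cos (dotp xi y + c)))%:E
   = ((2 / lam) ^+ n + cos c * \prod_(i < n) (2 * lam / (lam ^+ 2 + y i ^+ 2)))%:E)%E.
Proof.
move=> l0.
have mc (m : nat) (z : 'I_m -> R) c' : measurable_fun [set: m.-tuple R]
   (fun xi => (expabs lam xi * (1 + cos (dotp xi z + c')))%:E).
  apply/measurable_EFinP; apply: measurable_funM; first exact: measurable_expabs.
  apply: measurable_funD => //; apply: measurable_cosT; apply: measurable_funD => //.
  by apply: measurable_dotp => // i; exact: measurable_cst.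
elim: n y c => [|n IH] y c.
  rewrite -lebN_integral//=.
    by rewrite /expabs /dotp !big_ord0 add0r expr0 mul1r mulr1.
  by move=> t; rewrite lee_fin mulr_ge0 ?expabs_ge0// oneDcos_ge0.
rewrite integral_lebTS//; last first.
  by move=> t; rewrite lee_fin mulr_ge0 ?expabs_ge0// oneDcos_ge0.
pose y' i := y (lift ord0 i).
set Q := \prod_(i < n) (2 * lam / (lam ^+ 2 + y' i ^+ 2)).
have D0 (z : R) : 0 < lam ^+ 2 + z ^+ 2 by rewrite ltr_pwDl ?sqr_ge0// exprn_gt0.
have Q0 : 0 <= Q.
  by apply: prodr_ge0 => i _; rewrite divr_ge0 ?(ltW (D0 _))// mulr_ge0// ltW.
have QB : Q <= (2 / lam) ^+ n.
  have -> : (2 / lam) ^+ n = \prod_(i < n) (2 / lam) by rewrite prodr_const card_ord.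
  apply: ler_prod => i _.
  rewrite divr_ge0 ?(ltW (D0 _))/= ?mulr_ge0 ?(ltW l0)//.
  rewrite ler_pdivrMr// mulrAC ler_pdivlMr// -mulrA ler_pM2l//.
  by rewrite -expr2 lerDl sqr_ge0.
(* The inner integral (2/lam)^n + Q cos is regrouped as ((2/lam)^n - Q) + Q (1 + cos); by [QB] and
   [Q0] both parts are nonnegative and can be integrated separately. *)
transitivity (\int[leb]_x ((((2 / lam) ^+ n - Q) * expR (- (lam * `|x|)))%:E
   + (Q * (expR (- (lam * `|x|)) * (1 + cos (x * y ord0 + c))))%:E))%E.
  apply: eq_integral => x _; transitivity ((expR (- (lam * `|x|)))%:E *
     \int[lebT R n]_t (expabs lam t * (1 + cos (dotp t y' + (x * y ord0 + c))))%:E)%E.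
    rewrite -ge0_integralZl_EFin ?expR_ge0//.
      apply: eq_integral => t _; rewrite expabs_cons dotp_cons -EFinM mulrA.
      by rewrite addrCA addrA.
      by move=> t _; rewrite lee_fin mulr_ge0 ?expabs_ge0// oneDcos_ge0.
    exact: mc.
  by rewrite IH -EFinM -EFinD; congr (_%:E); rewrite -/Q; ring.
have me (a b : R) : measurable_fun [set: R]
  (fun x => (expR (- (lam * `|x|)) * (1 + cos (x * a + b)))%:E).
  apply/measurable_EFinP; apply: measurable_funM.
    by apply: measurable_expRT; apply: measurable_funN; apply: measurable_funM.
  apply: measurable_funD => //; apply: measurable_cosT; apply: measurable_funD => //.
  exact: measurable_funM.
have Iexp : (\int[leb]_x (expR (- (lam * `|x|)))%:E = (2 / lam)%:E)%E.
  have := fourier1 0 (pi / 2) l0; rewrite cos_pihalf mul0r addr0 => <-.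
  by apply: eq_integral => x _; rewrite mulr0 add0r cos_pihalf addr0 mulr1.
have mexp : measurable_fun [set: R] (fun x => expR (- (lam * `|x|))).
  by apply: measurable_expRT; apply: measurable_funN; apply: measurable_funM.
rewrite ge0_integralD//; last 4 first.
- by move=> x _; rewrite lee_fin mulr_ge0 ?subr_ge0 ?expR_ge0.
- by apply/measurable_EFinP; apply: measurable_funM.
- by move=> x _; rewrite lee_fin mulr_ge0// mulr_ge0 ?expR_ge0// oneDcos_ge0.
- apply/measurable_EFinP; apply: measurable_funM => //.
  by apply/measurable_EFinP; exact: me.
under eq_integral do rewrite EFinM.
rewrite ge0_integralZl_EFin ?subr_ge0//; last exact/measurable_EFinP.
rewrite Iexp; under eq_integral do rewrite EFinM.
rewrite ge0_integralZl_EFin//; last exact: me.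
rewrite fourier1// big_ord_recl -/Q -!EFinM -EFinD; congr (_%:E).
rewrite [(2 / lam) ^+ n.+1]exprS.
by ring.
Qed.

End fourier_lebT.

(** * The stable norm and its exponential *)

Section eneg.
Variable R : realType.

(* [eneg -oo] has the junk value 0; only nonnegative arguments occur. *)
Definition eneg (x : \bar R) : R := fine (expeR (- x)).

Lemma eneg_fin r : eneg r%:E = expR (- r).
Proof. by []. Qed.

Lemma eneg_ge0 x : 0 <= eneg x.
Proof. by rewrite fine_ge0// expeR_ge0. Qed.

Lemma eneg0 : eneg 0 = 1.
Proof. by rewrite eneg_fin oppr0 expR0. Qed.

Lemma le_eneg x y : (0 <= x)%E -> (x <= y)%E -> eneg y <= eneg x.
Proof.
case: x => [x| |]//; case: y => [y| |]//= x0 xy; last exact: expR_ge0.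
by rewrite !eneg_fin ler_expR lerN2 -lee_fin.
Qed.

Lemma eneg_le1 x : (0 <= x)%E -> eneg x <= 1.
Proof. by move=> x0; rewrite -eneg0 le_eneg. Qed.

Lemma enegD x y : (0 <= x)%E -> (0 <= y)%E -> eneg (x + y) = eneg x * eneg y.
Proof.
case: x => [x| |]//; case: y => [y| |]//= x0 y0; rewrite /eneg/=.
- by rewrite opprD expRD.
- by rewrite mulr0.
- by rewrite mul0r.
- by rewrite mul0r.
Qed.

Lemma eneg_sum n (f : 'I_n -> \bar R) : (forall i, 0 <= f i)%E ->
  eneg (\sum_(i < n) f i)%E = \prod_(i < n) eneg (f i).
Proof.
move=> f0; elim: n f f0 => [|n IH] f f0; first by rewrite !big_ord0 eneg0.
by rewrite !big_ord_recl enegD ?IH// sume_ge0.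
Qed.

Lemma eneg_half x : (0 <= x)%E -> eneg x = eneg (2^-1%:E * x) * eneg (2^-1%:E * x).
Proof.
move=> x0; have h0 : (0 <= 2^-1%:E * x)%E by rewrite mule_ge0// lee_fin invr_ge0.
rewrite -enegD// -ge0_muleDl ?lee_fin ?invr_ge0//.
by rewrite -EFinD [in RHS](_ : 2^-1 + 2^-1 = 1) ?mul1e// -mulr2n -(mulr_natl (2^-1)) divff.
Qed.

Lemma measurable_eneg d (T : measurableType d) (f : T -> \bar R) :
  measurable_fun setT f -> measurable_fun setT (fun x => eneg (f x)).
Proof.
(* [fine] sends both infinities to 0; the indicators restore the values of [eneg] there. *)
move=> mf; rewrite (_ : (fun x => _) = (fun x => expR (- fine (f x)) * (f x != +oo%E)%:R
   + 0 * (f x == -oo%E)%:R + (f x == -oo%E)%:R * (eneg -oo%E - 1))).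
  have mi (a : \bar R) : measurable_fun setT (fun x => (f x == a)%:R : R).
    rewrite (_ : (fun x => _) = \1_(f @^-1` [set a])).
      by apply: measurable_indic; rewrite -[X in measurable X]setTI; exact: mf.
    apply/funext => x; rewrite indicE; congr (_%:R); congr nat_of_bool.
    by apply/eqP/idP => [h|/set_mem//]; exact/mem_set.
  apply: measurable_funD; first apply: measurable_funD.
  - apply: measurable_funM.
      apply: measurable_expRT; apply: measurable_funN.
      exact: (measurableT_comp (fine_measurable measurableT) mf).
    rewrite (_ : (fun x => _) = (fun x => 1 - (f x == +oo%E)%:R)).
      by apply: measurable_funB.
    by apply/funext => x; case: eqP => _; rewrite ?subrr ?subr0.
  - exact: measurable_funM.
  - exact: measurable_funM.
apply/funext => x; case: (f x) => [r| |]/=; rewrite ?mulr1 ?mul0r ?addr0 ?mulr0//.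
by rewrite oppr0 expR0 mul1r addrC subrK.
Qed.

End eneg.

Section stable_exponential.
Variable R : realType.
Local Notation leb := (@lebesgue_measure R).

(** A stretched exponential is compared with a Cauchy profile, whose integral is explicit. For u > 1
    one keeps a single term of the exponential series, of an order n + 1 with (n + 1) al >= 2. *)
Lemma expR_dominates_powR (al c : R) : 0 < al -> 0 < c ->
  exists2 K, 0 < K & forall u, 0 <= u -> expR (- (c * u `^ al)) <= K / (1 + u ^+ 2).
Proof.
move=> al0 c0.
have [n nal] : exists n : nat, 2 <= n.+1%:R * al.
  have /archi_boundP := ltW (divr_gt0 (ltr0n R 2) al0).
  set n := Num.bound _ => nb; exists n.
  rewrite -ler_pdivrMr//; apply: (le_trans (ltW nb)); rewrite ler_nat //.
set B : R := (n.+1)`!%:R / c ^+ n.+1.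
have B0 : 0 < B by rewrite divr_gt0 ?exprn_gt0// ltr0n fact_gt0.
exists (2 + 2 * B); first by rewrite addr_gt0// mulr_gt0.
move=> u u0; rewrite ler_pdivlMr ?oneDsqr_gt0//.
have e1 : expR (- (c * u `^ al)) <= 1.
  by rewrite expR_le1 oppr_le0 mulr_ge0 ?powR_ge0 ?ltW.
have [u1|u1] := leP u 1.
  rewrite (@le_trans _ _ (1 * 2))//; last by rewrite mul1r lerDl mulr_ge0// ltW.
  apply: ler_pM; rewrite ?expR_ge0 ?(ltW (oneDsqr_gt0 _))//.
  have : u ^+ 2 <= 1 by rewrite expr_le1.
  lra.
have ul0 : 0 < u by apply: lt_trans u1.
have h : u ^+ 2 <= B * expR (c * u `^ al).
  have h1 : u ^+ 2 <= (u `^ al) ^+ n.+1.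
    rewrite -!powR_mulrn ?powR_ge0// -powRrM ler_powR ?(ltW u1)//.
    by rewrite mulrC.
  apply: (le_trans h1); rewrite /B mulrAC ler_pdivlMr ?exprn_gt0// -exprMn [u `^ _ * _]mulrC.
  rewrite [leRHS]mulrC -ler_pdivrMr ?ltr0n ?fact_gt0// mulrC.
  apply: le_trans (expR_ge1Dxn n _); first by rewrite lerDr.
  by rewrite mulr_ge0 ?powR_ge0 ?ltW.
have h2 : 1 + u ^+ 2 <= (2 * B) * expR (c * u `^ al).
  apply: (@le_trans _ _ (u ^+ 2 + u ^+ 2)).
    by rewrite lerD2r expr_ge1 ?ltW.
  by rewrite -mulrA mulr_natl mulr2n lerD.
rewrite mulrC (le_trans (ler_wpM2r (expR_ge0 _) h2))//.
by rewrite -[leLHS]mulrA expRxMexpNx_1 mulr1 lerDr.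
Qed.

(** From |x - y| <= 2 max(|x|, |y|) and 2^al <= 4. It replaces the triangle inequality uniformly in
    al, including al < 1. *)
Lemma powR_normB_le (al x y : R) : 0 < al -> al <= 2 ->
  `|x - y| `^ al <= 4 * (`|x| `^ al + `|y| `^ al).
Proof.
move=> al0 al2.
pose m := Num.max `|x| `|y|.
have xm : `|x| <= m by rewrite le_max lexx.
have ym : `|y| <= m by rewrite le_max lexx orbT.
have m0 : 0 <= m by apply: le_trans xm.
have h : `|x - y| <= 2 * m.
  by apply: le_trans (ler_normB _ _) _; rewrite mulr_natl mulr2n lerD.
apply: (@le_trans _ _ ((2 * m) `^ al)).
  by rewrite ge0_ler_powR ?nnegrE ?mulr_ge0// ltW.
rewrite powRM// ler_pM ?powR_ge0//.
  apply: (@le_trans _ _ (2 `^ 2)); first by rewrite ler_powR// ler1n.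
  by rewrite powR_mulrn// -natrX ler_nat.
by rewrite /m maxEge; case: ifP => _; rewrite ?lerDl ?lerDr powR_ge0.
Qed.

Section peel.
Context d (T : measurableType d) (mu : {sigma_finite_measure set T -> \bar R}).
Variable al : R.
Hypotheses (al0 : 0 < al) (al2 : al <= 2).

Definition phia (D : set T) (f g : T -> R) (a : R) : \bar R :=
  (\int[mu]_(v in D) (`|a * g v + f v| `^ al)%:E)%E.

Lemma phia_ge0 D f g a : (0 <= phia D f g a)%E.
Proof. by apply: integral_ge0 => v _; rewrite lee_fin powR_ge0. Qed.

Lemma measurable_phia D f g : measurable D ->
  measurable_fun setT f -> measurable_fun setT g ->
  measurable_fun [set: R] (phia D f g).
Proof.
move=> mD mf mg; rewrite /phia.
under eq_fun do rewrite integral_mkcond.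
pose F : R * T -> R := fun p => `|p.1 * g p.2 + f p.2| `^ al * \1_D p.2.
rewrite (_ : (fun a => _) = (fun a : R => \int[mu]_v (EFin \o F) (a, v))%E).
  apply: measurable_fun_fubini_tonelli_F.
    apply/measurable_EFinP; apply: measurable_funM.
      apply: (measurableT_comp (measurable_powR al)); apply: measurable_absT.
      apply: measurable_funD; last exact: (measurableT_comp mf).
      by apply: measurable_funM => //; exact: (measurableT_comp mg).
    by apply: (measurableT_comp (measurable_indic mD)).
  by move=> p; rewrite /= lee_fin mulr_ge0 ?powR_ge0.
apply/funext => a; apply: eq_integral => v _; rewrite patchE /F /= indicE.
by case: ifP => _; rewrite ?mulr1 ?mulr0.
Qed.

(** The bound must not depend on [f], which collects all the other points. Around a near-minimiser
    a1 of [phi], the size of (a - a1) g controls [phi a] from below, so the integrand is dominated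
    by a translate of a fixed profile in r (a - a1). *)
Lemma integral_eneg_phia : exists2 K, 0 < K & forall (D : set T) (f g : T -> R) (r : R),
  measurable D -> 0 < r -> measurable_fun setT f -> measurable_fun setT g ->
  ((r `^ al)%:E <= \int[mu]_(v in D) (`|g v| `^ al)%:E)%E ->
  (\int[leb]_a (eneg (2^-1%:E * phia D f g a))%:E <= (K / r)%:E)%E.
Proof.
(* With phi a1 <= phi a + 1, [key] gives (|a - a1| r)^al <= 8 phi a + 4; hence phi a / 2 is at least
   a sixteenth of the left side minus 1/4, which also explains the factor exp(1/4). *)
have c0 : 0 < 16^-1 :> R by rewrite invr_gt0.
have [K0 K00 HK0] := expR_dominates_powR al0 c0.
exists (expR 4^-1 * K0 * pi); first by rewrite !mulr_gt0 ?expR_gt0 ?pi_gt0.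
move=> D f g r mD r0 mf mg hr.
set phi := phia D f g; have phiD : phi = phia D f g by []; clearbody phi.
have phi0 a : (0 <= phi a)%E by rewrite phiD; exact: phia_ge0.
have phi20 a : (0 <= 2^-1%:E * phi a)%E by rewrite mule_ge0// lee_fin invr_ge0.
(* If [phi] is infinite everywhere, the integrand vanishes identically. *)
have [[a0 a0fin]|allinf] := pselect (exists a, phi a \is a fin_num); last first.
  rewrite integral0_eq ?lee_fin ?divr_ge0 ?mulr_ge0 ?expR_ge0 ?pi_ge0 ?(ltW r0) ?(ltW K00)//.
  move=> a _; have := phi0 a; case E : (phi a) => [x| |]// _.
    by exfalso; apply: allinf; exists a; rewrite E.
  by rewrite mulry/= gtr0_sg ?invr_gt0// mul1e.
pose S := [set fine (phi a) | a in [set a | phi a \is a fin_num]].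
have infS : has_inf S.
  split; first by exists (fine (phi a0)); exists a0.
  by exists 0 => _ [a _ <-]; rewrite fine_ge0.
(* The infimum need not be attained; coming within 1 of it is enough. *)
have [_ [a1 /= a1fin <-] a1inf] := inf_adherent ltr01 infS.
have a1min a : phi a \is a fin_num -> fine (phi a1) <= fine (phi a) + 1.
  move=> afin; rewrite (le_trans (ltW a1inf))// lerD2r.
  by apply: ge_inf; [exists 0 => _ [b _ <-]; rewrite fine_ge0|exists a].
have mpow (a : R) : measurable_fun setT (fun v => `|a * g v + f v| `^ al).
  apply: (measurableT_comp (measurable_powR al)); apply: measurable_absT.
  by apply: measurable_funD => //; exact: measurable_funM.
(* Subtracting the combinations at a and a1 eliminates [f] and leaves (a - a1) g. *)
have key a : phi a \is a fin_num ->
    (`|a - a1| * r) `^ al <= 4 * (fine (phi a) + fine (phi a1)).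
  move=> afin; rewrite -lee_fin powRM ?(ltW r0)// EFinM.
  apply: (@le_trans _ _ ((`|a - a1| `^ al)%:E * \int[mu]_(v in D) (`|g v| `^ al)%:E)%E).
    by rewrite lee_wpmul2l// lee_fin powR_ge0.
  rewrite -ge0_integralZl_EFin ?powR_ge0//; last first.
    apply/measurable_EFinP; apply: measurable_funTS.
    by apply: (measurableT_comp (measurable_powR al)); exact: measurable_absT.
  have -> : (4 * (fine (phi a) + fine (phi a1)))%:E = (4%:E * (phi a + phi a1))%E.
    by rewrite EFinM; congr (_ * _)%E; rewrite EFinD !fineK.
  rewrite phiD /phia -ge0_integralD//; last 2 first.
  - by apply/measurable_EFinP; apply: measurable_funTS; exact: mpow.
  - by apply/measurable_EFinP; apply: measurable_funTS; exact: mpow.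
  rewrite -ge0_integralZl_EFin//; last 2 first.
  - by move=> v _; rewrite lee_fin addr_ge0 ?powR_ge0.
  - apply: emeasurable_funD; apply/measurable_EFinP; apply: measurable_funTS; exact: mpow.
  apply: ge0_le_integralT => v _.
    by rewrite lee_fin mulr_ge0 ?powR_ge0.
  rewrite -EFinM -EFinD -EFinM lee_fin -powRM// -normrM.
  rewrite (_ : (a - a1) * g v = (a * g v + f v) - (a1 * g v + f v)); last by ring.
  exact: powR_normB_le.
have bound a : eneg (2^-1%:E * phi a) <= expR 4^-1 * K0 * (1 + (r * (a - a1)) ^+ 2)^-1.
  have := phi0 a; case E : (phi a) => [x| |]// x0; last first.
    rewrite mulry/= gtr0_sg ?invr_gt0// mul1e /eneg/=.
    by rewrite mulr_ge0 ?invr_ge0 ?ltW ?oneDsqr_gt0// mulr_gt0 ?expR_gt0.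
  have afin : phi a \is a fin_num by rewrite E.
  have k1 := key _ afin; have k2 := a1min _ afin; rewrite E/= in k1 k2.
  rewrite eneg_fin -mulrA.
  have h := HK0 (`|a - a1| * r) (mulr_ge0 (normr_ge0 _) (ltW r0)).
  rewrite exprMn real_normK ?num_real// -exprMn [(_ - _) * r]mulrC in h.
  apply: le_trans (ler_wpM2l (expR_ge0 _) h).
  rewrite -expRD ler_expR; lra.
apply: (@le_trans _ _ (\int[leb]_a ((expR 4^-1 * K0)%:E * ((1 + (r * (a - a1)) ^+ 2)^-1)%:E))%E).
  by apply: ge0_le_integralT => a _; rewrite ?lee_fin ?eneg_ge0//= bound.
rewrite ge0_integralZl_EFin//.
- by rewrite integral_cauchy// -EFinM mulrA.
- by move=> a _; rewrite lee_fin invr_ge0 ltW ?oneDsqr_gt0.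
- apply/measurable_EFinP.
  apply: (@measurable_funS _ _ _ _ setT) => //.
  rewrite (_ : (fun x => _) = (fun x => pi / r * pk r (x - a1))).
    apply: measurable_funM => //; apply: (measurableT_comp (measurable_pk r)).
    exact: measurable_funB.
  apply/funext => x; rewrite pk_inv mulrA mulrA divfK ?gt_eqF//.
  by rewrite divff ?mul1r// gt_eqF ?pi_gt0.
- by rewrite mulr_ge0 ?expR_ge0 ?ltW.
Qed.

End peel.
End stable_exponential.

(** * The kernel of the sheet *)

Section powR_bounds.
Variable R : realType.
Implicit Types (t p P B x : R).

Lemma powR_two_sided B t p P : 1 <= B -> B^-1 <= t <= B -> `|p| <= P ->
  B `^ (- P) <= t `^ p <= B `^ P.
Proof.
move=> B1 /andP[Bt tB] pP.
have B0 : 0 < B by apply: lt_le_trans B1.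
have t0 : 0 < t by apply: lt_le_trans Bt; rewrite invr_gt0.
rewrite /powR !gt_eqF// !ler_expR mulNr -ler_norml normrM.
apply: ler_pM => //; rewrite ler_norml; apply/andP; split.
  by rewrite -lnV ?posrE// ler_ln ?posrE ?invr_gt0.
by rewrite ler_ln ?posrE.
Qed.

(** Meant for p = alpha * h - 1, whose sign is not known: the power is increasing or decreasing
    accordingly, and at most a factor 2 is lost. *)
Lemma powR_half_le x t p : 0 < x -> x / 2 <= t <= x -> -1 <= p <= 1 ->
  x `^ p / 2 <= t `^ p.
Proof.
move=> x0 /andP[xt tx] /andP[p1 p2].
have t0 : 0 < t by apply: lt_le_trans xt; rewrite divr_gt0.
have [p0|p0] := leP 0 p.
  apply: (@le_trans _ _ ((x / 2) `^ p)); last first.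
    by rewrite ge0_ler_powR// nnegrE ltW// divr_gt0.
  rewrite powRM ?(ltW x0)// ?invr_ge0// ler_pM2l ?powR_gt0//.
  have -> : 2^-1 `^ p = 2 `^ (-1 * p) by rewrite powRrM powR_inv1.
  by rewrite -[leLHS]powR_inv1// mulN1r ler_powR ?ler1n// lerN2.
apply: (@le_trans _ _ (x `^ p)); first by rewrite ler_pdivrMr// ler_peMr ?powR_ge0// ler1n.
have -> : p = - - p by rewrite opprK.
rewrite powRN [leRHS]powRN lef_pV2 ?posrE ?powR_gt0//.
by rewrite ge0_ler_powR ?nnegrE ?(ltW x0) ?(ltW t0) ?oppr_ge0 ?(ltW p0).
Qed.

End powR_bounds.

Section kernel.
Variables (R : realType) (N : nat) (alpha : R) (h : 'I_N -> N.-tuple R -> R) (c : R).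
Local Notation leb := (@lebesgue_measure R).
Hypotheses (al0 : 0 < alpha) (al2 : alpha <= 2) (c0 : 0 < c).

Definition ker (u v : N.-tuple R) : R := c * lmss_kernel alpha h u v.

Lemma measurable_ppow d (T : measurableType d) (f : T -> R) b :
  measurable_fun setT f -> measurable_fun setT (fun x => ppow (f x) b).
Proof.
move=> mf; rewrite (_ : (fun x => _) =
    (fun x => powR (f x) b * \1_(`]0, +oo[%classic : set R) (f x))).
  apply: measurable_funM; first exact: (measurableT_comp (measurable_powR b) mf).
  exact: (measurableT_comp (measurable_indic (measurable_itv _)) mf).
apply/funext => x; rewrite /ppow indicE mem_setE in_itv/= andbT.
by case: ifP => _; rewrite ?mulr1 ?mulr0.
Qed.

Lemma measurable_ker u : measurable_fun [set: N.-tuple R] (ker u).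
Proof.
apply: measurable_funM => //; apply: measurable_prod => i _.
apply: measurable_funB; apply: measurable_ppow.
  by apply: measurable_funB => //; exact: measurable_tnth.
by apply: measurable_funN; exact: measurable_tnth.
Qed.

(** Coordinates other than l are confined to (0, e): positivity kills the terms (-v_i)_+, and, as
    all points have coordinates >= 2e, the remaining factors stay between positive constants. The
    kernel then behaves like a function of v_l alone. *)
Definition slab (l : 'I_N) (A : set R) (e : R) : set (N.-tuple R) :=
  [set v | A (tnth v l) /\ forall i, i != l -> 0 < tnth v i < e].

Lemma indic_slab l (A : set R) e v :
  \1_(slab l A e) v = \prod_(i < N) \1_(if i == l then A else `]0, e[%classic) (tnth v i) :> R.
Proof.
rewrite (bigD1 l)//= eqxx indicE.
case: (boolP (tnth v l \in A)) => vA; last first.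
  rewrite [X in X * _]indicE (negbTE vA) mul0r.
  case: (boolP (v \in _)) => // /set_mem[/mem_set].
  by rewrite (negbTE vA).
rewrite [X in X * _]indicE vA mul1r.
case: (boolP (v \in _)) => [/set_mem[_ H]|H].
  rewrite big1// => i il; rewrite (negbTE il) indicE mem_set//=.
  by rewrite in_itv/= H.
case: (pselect (forall i, i != l -> 0 < tnth v i < e)) => [H2|/existsNP[i]].
  by exfalso; move/negP: H; apply; apply/mem_set; split => //; exact/set_mem.
move=> /not_implyP[il /negP vi].
rewrite (bigD1 i)//= (negbTE il) indicE memNset ?mul0r//=.
by rewrite in_itv/=; exact/negP.
Qed.

Lemma measurable_slab l A e : measurable A -> measurable (slab l A e).
Proof.
move=> mA; rewrite (_ : slab l A e = (fun v => tnth v l) @^-1` A `&`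
   \bigcap_(i in [set i | i != l]) ((fun v => tnth v i) @^-1` `]0, e[%classic)).
  apply: measurableI.
    by rewrite -[X in measurable X]setTI; exact: measurable_tnth.
  apply: fin_bigcap_measurable; first exact: finite_finset.
  move=> i _.
  by rewrite -[X in measurable X]setTI; exact: measurable_tnth.
by apply/seteqP; split => v /= [vA H]; split => // i il; have := H i il; rewrite /= in_itv.
Qed.

Lemma lebT_slab l (A : set R) e : measurable A -> 0 <= e ->
  lebT R N (slab l A e) = (leb A * (e ^+ N.-1)%:E)%E.
Proof.
move=> mA e0.
transitivity (\int[lebT R N]_v (\1_(slab l A e) v)%:E)%E.
  by rewrite integral_indic ?setIT//; exact: measurable_slab.
under eq_integral => v _.
  rewrite indic_slab -prodEFin; over.
pose f (i : 'I_N) (x : R) : \bar R :=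
  (\1_(if i == l then A else `]0, e[%classic) x)%:E.
rewrite (@integral_lebT_prod _ _ f); last 2 first.
- move=> i; apply/measurable_EFinP; apply: measurable_indic.
  by case: ifP => // _; exact: measurable_itv.
- by move=> i x; rewrite lee_fin.
rewrite (bigD1 l)//= /f eqxx integral_indic// setIT; congr (_ * _)%E.
transitivity (\big[*%E/1%E]_(i < N | i != l) e%:E).
  apply: eq_bigr => i /negbTE->; rewrite integral_indic// setIT.
  by rewrite [LHS](lebesgue_measure_itv `]0, e[)/= lte_fin; case: ltgtP e0 => // [|<-]; rewrite ?sube0.
by rewrite prodEFin prodr_const cardC1 card_ord.
Qed.

Section point.
Variables (B e : R) (u : N.-tuple R).
Hypotheses (B1 : 1 <= B) (Be : B^-1 <= e).
Hypotheses (uB : forall i, 2 * e <= tnth u i <= B) (hu : forall i, 0 < h i u < 1).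

Let B0 : 0 < B. Proof. exact: lt_le_trans B1. Qed.
Let e0 : 0 < e. Proof. by apply: lt_le_trans Be; rewrite invr_gt0. Qed.

Lemma ker_pos l (A : set R) v : slab l A e v -> 0 <= tnth v l ->
  ker u v = c * \prod_(i < N) ppow (tnth u i - tnth v i) (h i u - alpha^-1).
Proof.
move=> [vA H] vl0; congr (_ * _); apply: eq_bigr => i _.
have vi : 0 <= tnth v i.
  by have [->//|il] := eqVneq i l; have /andP[/ltW] := H _ il.
by rewrite [X in _ - X]/ppow oppr_gt0 ltNge vi subr0.
Qed.

(** The factor (u_l - v_l)_+ is zero. This triangular structure along one coordinate is used twice:
    for the finite differences and for integrating out the frequencies. *)
Lemma ker_above l (A : set R) v : slab l A e v -> 0 <= tnth v l ->
  tnth u l <= tnth v l -> ker u v = 0.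
Proof.
move=> sv v0 uv; rewrite (ker_pos sv v0) (bigD1 l)//=.
by rewrite {1}/ppow subr_gt0 ltNge uv mul0r mulr0.
Qed.

Lemma ppow_other l (A : set R) v i (P : R) : slab l A e v -> i != l ->
  `|h i u - alpha^-1| <= P ->
  B `^ (- P) <= ppow (tnth u i - tnth v i) (h i u - alpha^-1) <= B `^ P.
Proof.
move=> [vA H] il hP; have /andP[v0 ve] := H _ il; have /andP[u1 u2] := uB i.
rewrite /ppow subr_gt0 (_ : tnth v i < tnth u i) ?powR_two_sided//; last by lra.
apply/andP; split; last by lra.
apply: le_trans Be _; lra.
Qed.

End point.

(** Only the lower half of ]b, u_l] is kept: there u_l - v_l is comparable to u_l - b, so the
    integrand is of order (u_l - b)^(alpha h - 1) whatever the sign of that exponent, and the length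
    supplies one more power. *)
Lemma ker_lower B e : 1 <= B -> B^-1 <= e -> exists2 c2, 0 < c2 &
  forall (u : N.-tuple R) (l : 'I_N) b,
  (forall i, 2 * e <= tnth u i <= B) -> (forall i, 0 < h i u < 1) ->
  0 <= b < tnth u l ->
  (((c2 * (tnth u l - b) `^ (h l u)) `^ alpha)%:E <=
   \int[lebT R N]_(v in slab l `]b, tnth u l] e) (`|ker u v| `^ alpha)%:E)%E.
Proof.
move=> B1 Be.
have B0 : 0 < B by apply: lt_le_trans B1.
have e0 : 0 < e by apply: lt_le_trans Be; rewrite invr_gt0.
pose P := 1 + alpha^-1.
pose k0 := (c * (B `^ (- P)) ^+ N.-1) `^ alpha.
have k00 : 0 < k0 by rewrite powR_gt0// mulr_gt0// exprn_gt0// powR_gt0.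
(* 1/4 is the half length times the factor 1/2 of [powR_half_le]; the power of e is the volume in
   the other coordinates. *)
pose k1 := k0 / 4 * e ^+ N.-1.
have k10 : 0 < k1 by rewrite mulr_gt0 ?exprn_gt0// divr_gt0.
exists (k1 `^ alpha^-1); first exact: powR_gt0.
move=> u l b uB hu /andP[b0 bu].
set y := tnth u l; set H := h l u.
have yb : 0 < y - b by rewrite subr_gt0.
rewrite powRM ?powR_ge0// -powRrM mulVf ?gt_eqF// powRr1 ?(ltW k10)//.
pose m := (b + y) / 2.
have mA : measurable `]b, m]%classic by exact: measurable_itv.
apply: (@le_trans _ _ (\int[lebT R N]_(v in slab l `]b, m] e) (k0 * ((y - b) `^ (alpha * H - 1) / 2))%:E)%E).
  rewrite integral_cst; last exact: measurable_slab.
  rewrite [X in (_ <= _ * X)%E](lebT_slab _ mA (ltW e0)) lebesgue_measure_itv/= lte_fin.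
  rewrite (_ : b < m); last by rewrite /m; move: bu; rewrite -/y; lra.
  rewrite -EFinB -!EFinM lee_fin -powRrM.
  rewrite -[in leLHS](_ : (y - b) * (y - b) `^ (alpha * H - 1) = (y - b) `^ (H * alpha)); last first.
    by rewrite mulr_powRB1 ?(ltW yb) ?mulr_gt0//; [rewrite mulrC|have /andP[] := hu l].
  rewrite (_ : m - b = (y - b) / 2); last by rewrite /m; lra.
  rewrite /k1 le_eqVlt; apply/orP; left; apply/eqP.
  by field.
have sub : slab l `]b, m] e `<=` slab l `]b, y] e.
  move=> v [vb Hv]; split=> //; move: vb; rewrite /= !in_itv/= => /andP[-> /= vm].
  by apply: (le_trans vm); rewrite /m; move: bu; rewrite -/y; lra.
apply: (@le_trans _ _ (\int[lebT R N]_(v in slab l `]b, m] e) (`|ker u v| `^ alpha)%:E)%E); last first.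
  apply: ge0_subset_integral => //; [exact: measurable_slab|exact: measurable_slab|].
  apply/measurable_EFinP; apply: measurable_funTS.
  apply: (measurableT_comp (measurable_powR alpha)); apply: measurable_absT.
  exact: measurable_ker.
have /andP[H0 H1] := hu l.
apply: ge0_le_integralT => v sv.
  by rewrite lee_fin mulr_ge0 ?(ltW k00)// divr_ge0// powR_ge0.
have [vb Hv] := sv; move: vb; rewrite /= in_itv/= => /andP[bv vm].
rewrite lee_fin (ker_pos u sv) ?(le_trans b0) ?(ltW bv)//.
rewrite (bigD1 l)//= {1}/ppow subr_gt0.
have vy : tnth v l < y by apply: (le_lt_trans vm); rewrite /m; move: bu; rewrite -/y; lra.
rewrite -/y vy [X in `|X|]mulrCA normrM powRM// [leRHS]mulrC.
have PP i : `|h i u - alpha^-1| <= P.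
  have /andP[i0 i1] := hu i; have ai : 0 < alpha^-1 by rewrite invr_gt0.
  by rewrite ler_norml /P; apply/andP; split; lra.
apply: ler_pM; rewrite ?(ltW k00) ?divr_ge0 ?powR_ge0//.
  rewrite /k0 ge0_ler_powR ?nnegrE ?(ltW al0)// ?normr_ge0 ?mulr_ge0 ?exprn_ge0 ?powR_ge0 ?(ltW c0)//.
  apply: le_trans (ler_norm _); rewrite ler_pM2l//.
  have -> : B `^ (- P) ^+ N.-1 = \prod_(i < N | i != l) B `^ (- P).
    by rewrite prodr_const cardC1 card_ord.
  apply: ler_prod => i il; rewrite powR_ge0/=.
  by have /andP[] := ppow_other B1 Be uB sv il (PP i).
rewrite ger0_norm ?powR_ge0// -powRrM mulrBl mulVf ?gt_eqF//.
rewrite [_ * alpha]mulrC; apply: powR_half_le => //.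
  rewrite /m in vm; apply/andP; split; lra.
have : 0 < alpha * H by rewrite mulr_gt0.
have : alpha * H < 2 * 1 by rewrite (le_lt_trans (ler_wpM2r (ltW H0) al2))// ltr_pM2l.
by move=> *; apply/andP; split; lra.
Qed.

End kernel.

(** * Finite differences *)

Section finite_difference.
Variable R : realType.

Section gen.
Variables (T : Type) (sh : T -> T).
Implicit Types (f g : T -> R) (x : T).

(** Forward difference of order q along an arbitrary self-map, so that [fd_ext] can compare
    differences on R^N with differences of one real variable. *)
Fixpoint fd q f x : R :=
  if q is q'.+1 then fd q' f (sh x) - fd q' f x else f x.

Lemma fd_eq0 q f x : (forall p, (p <= q)%N -> f (iter p sh x) = 0) -> fd q f x = 0.
Proof.
elim: q x => [|q IH] x f0 /=; first exact: (f0 0%N).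
rewrite IH ?sub0r; last by move=> p pq; rewrite -iterSr f0.
by rewrite IH ?oppr0// => p pq; rewrite f0// (leq_trans pq).
Qed.

(** The unshifted value enters the difference with coefficient 1 or -1, so a singularity seen only
    there survives intact. *)
Lemma norm_fd q f x : (forall p, (0 < p <= q)%N -> f (iter p sh x) = 0) ->
  `|fd q f x| = `|f x|.
Proof.
elim: q => [|q IH]//= f0; rewrite fd_eq0; last first.
  by move=> p pq; rewrite -iterSr f0.
rewrite sub0r normrN IH// => p /andP[p0 pq]; rewrite f0// p0/=.
exact: leq_trans pq _.
Qed.

Lemma fdZ q (a : R) f x : fd q (fun y => a * f y) x = a * fd q f x.
Proof. by elim: q x => //= q IH x; rewrite !IH mulrBr. Qed.

Lemma fd_sum (I : Type) (s : seq I) q (f : I -> T -> R) x :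
  fd q (fun y => \sum_(i <- s) f i y) x = \sum_(i <- s) fd q (f i) x.
Proof. by elim: q x => //= q IH x; rewrite !IH -sumrB. Qed.

(** Each order costs 4 by [powR_normB_le] and 2 for the two terms of the difference. *)
Lemma powR_fd_le (al : R) q f x : 0 < al -> al <= 2 ->
  `|fd q f x| `^ al <= 8 ^+ q * \sum_(p < q.+1) `|f (iter p sh x)| `^ al.
Proof.
move=> al0 al2; elim: q x => [|q IH] x /=.
  by rewrite big_ord_recl big_ord0 addr0 expr0 mul1r.
apply: le_trans (powR_normB_le _ _ al0 al2) _.
set S := (X in _ <= _ * X).
have S1 : \sum_(p < q.+1) `|f (iter p sh (sh x))| `^ al <= S.
  rewrite /S [leRHS]big_ord_recl -[leLHS]add0r lerD ?powR_ge0//.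
  by apply: ler_sum => p _; rewrite -iterSr.
have S2 : \sum_(p < q.+1) `|f (iter p sh x)| `^ al <= S.
  by rewrite /S [leRHS]big_ord_recr/= lerDl powR_ge0.
have q8 : 0 <= 8 ^+ q :> R by rewrite exprn_ge0.
have h1 := le_trans (IH (sh x)) (ler_wpM2l q8 S1).
have h2 := le_trans (IH x) (ler_wpM2l q8 S2).
rewrite exprS (_ : 8 * 8 ^+ q * S = 4 * (8 ^+ q * S + 8 ^+ q * S)); last by ring.
by rewrite ler_pM2l// lerD.
Qed.

End gen.

Lemma fd_ext (T T' : Type) (sh : T -> T) (sh' : T' -> T') q (f : T -> R) (g : T' -> R) x y :
  (forall p, (p <= q)%N -> f (iter p sh x) = g (iter p sh' y)) ->
  fd sh q f x = fd sh' q g y.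
Proof.
elim: q x y => [|q IH] x y fg /=; first exact: (fg 0%N).
rewrite (IH _ (sh' y)); last by move=> p pq; rewrite -!iterSr fg.
by rewrite (IH x y)// => p pq; rewrite fg// (leq_trans pq).
Qed.

Local Notation sft e := (fun y : R => y + e).

Lemma iter_shift (e x : R) p : iter p (sft e) x = x + p%:R * e.
Proof. by elim: p => [|p IH]; rewrite ?mul0r ?addr0// iterS IH -natr1 mulrDl mul1r addrA. Qed.

Lemma is_derive_fd (e : R) q (f f' : R -> R) (x : R) :
  (forall p, (p <= q)%N -> is_derive (x + p%:R * e) 1 f (f' (x + p%:R * e))) ->
  is_derive x 1 (fd (sft e) q f) (fd (sft e) q f' x).
Proof.
elim: q x => [|q IH] x df /=.
  by have := df 0%N (leqnn 0); rewrite mul0r addr0.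
apply: isdB; last by apply: IH => p pq; apply: df; rewrite (leq_trans pq).
have h : is_derive (x + e) 1 (fd (sft e) q f) (fd (sft e) q f' (x + e)).
  apply: IH => p pq; have -> : x + e + p%:R * e = x + p.+1%:R * e.
    by rewrite -natr1; ring.
  exact: df.
apply: isd_val (isd_comp (isdD (isd_id x) (isd_cst x e)) h) _.
by rewrite addr0 mul1r.
Qed.

Lemma fd_mvt (e M : R) q (F : nat -> R -> R) (x : R) : 0 < e ->
  (forall i y, (i < q)%N -> x <= y <= x + q%:R * e -> is_derive y 1 (F i) (F i.+1 y)) ->
  (forall y, x <= y <= x + q%:R * e -> `|F q y| <= M) ->
  `|fd (sft e) q (F 0%N) x| <= e ^+ q * M.
Proof.
move=> e0; elim: q F x => [|q IH] F x dF FM /=.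
  by rewrite expr0 mul1r FM// mul0r addr0 lexx.
have dG y : x <= y <= x + e -> is_derive y 1 (fd (sft e) q (F 0%N)) (fd (sft e) q (F 1%N) y).
  move=> /andP[xy ye]; apply: is_derive_fd => p pq; apply: dF => //.
  apply/andP; split; first by rewrite (le_trans xy)// lerDl mulr_ge0// ltW.
  rewrite -natr1 mulrDl mul1r [_ + e]addrC addrA lerD// ler_wpM2r ?(ltW e0)//.
  by rewrite ler_nat.
have [c cin cE] := @MVT R (fd (sft e) q (F 0%N)) (fd (sft e) q (F 1%N)) x (x + e)
   ltac:(by rewrite ltrDl)
   ltac:(by move=> y; rewrite in_itv/= => /andP[/ltW xy /ltW ye]; apply: dG; rewrite xy ye)
   ltac:(apply: derivable_within_continuous => y; rewrite in_itv/= => xy;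
         exact: (@ex_derive _ _ _ _ _ _ _ (dG _ xy))).
move: cin; rewrite in_itv/= => /andP[/ltW xc /ltW ce].
rewrite cE (_ : x + e - x = e); last by ring.
rewrite normrM (gtr0_norm e0) exprS mulrC -mulrA ler_pM2l//.
apply: (IH (fun i => F i.+1)) => [i y iq|y] /andP[cy yq].
  apply: dF => //; rewrite (le_trans xc cy)/=; apply: (le_trans yq).
  by rewrite -natr1 mulrDl mul1r [_ * e + e]addrC addrA lerD2r.
apply: FM; rewrite (le_trans xc cy)/=; apply: (le_trans yq).
by rewrite -natr1 mulrDl mul1r [_ * e + e]addrC addrA lerD2r.
Qed.

Lemma fd_powR_le (e del P tau kap : R) q (x : R) : 0 < e -> 0 < del -> del <= 1 ->
  `|kap| <= P -> del <= tau - (x + q%:R * e) -> tau - x <= del^-1 ->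
  `|fd (sft e) q (fun y => (tau - y) `^ kap) x| <=
  e ^+ q * ((\prod_(j < q) (P + j%:R)) * (del^-1) `^ (P + q%:R)).
Proof.
move=> e0 d0 d1 kP h1 h2.
pose F i y : R := (\prod_(j < i) (- (kap - j%:R))) * (tau - y) `^ (kap - i%:R).
have F0 : (fun y => (tau - y) `^ kap) = F 0%N.
  by apply/funext => y; rewrite /F big_ord0 mul1r subr0.
rewrite F0; apply: fd_mvt => // [i y iq|y] /andP[xy yq].
  have ty : 0 < tau - y by apply: (lt_le_trans d0); apply: (le_trans h1); lra.
  apply: isd_val (isdZ (\prod_(j < i) (- (kap - j%:R)))
    (isd_comp (isdB (isd_cst y tau) (isd_id y)) (is_derive1_powR (kap - i%:R) ty))) _.
  rewrite /F big_ord_recr/= sub0r mulN1r -[RHS]mulrA mulNr; congr (_ * - (_ * _ `^ _)).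
  by rewrite -natr1 opprD addrA.
rewrite /F normrM; apply: ler_pM => //.
  rewrite normr_prod; apply: ler_prod => j _; rewrite normr_ge0/= normrN.
  by apply: (le_trans (ler_normB _ _)); rewrite [X in _ + X]ger0_norm// lerD2r.
rewrite ger0_norm ?powR_ge0//.
have B1 : 1 <= del^-1 by rewrite invf_ge1.
have := @powR_two_sided R del^-1 (tau - y) (kap - q%:R) (P + q%:R) B1.
rewrite invrK => /(_ _ _)/andP[]//.
  apply/andP; split; lra.
by apply: (le_trans (ler_normB _ _)); rewrite [X in _ + X]ger0_norm// lerD2r.
Qed.

End finite_difference.

(** * Stable norm of a combination with an isolated point *)

Section isolated.
Variables (R : realType) (N d : nat) (alpha : R) (h : 'I_N -> N.-tuple R -> R) (c : R).
Hypotheses (al0 : 0 < alpha) (al2 : alpha <= 2) (c0 : 0 < c).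
Local Notation ker := (ker alpha h c).
Local Notation point := (N.-tuple R * d.-tuple R)%type.
Implicit Types (z : seq point) (u v : N.-tuple R) (k : 'I_d) (l : 'I_N).

Definition comb z k v : R := \sum_(p <- z) tnth p.2 k * ker p.1 v.

(** [z] lists points with their frequencies. For D = R^N this is the contribution of the k-th
    component to the exponent of the characteristic function. *)
Definition snrm (D : set (N.-tuple R)) z k : \bar R :=
  (\int[lebT R N]_(v in D) (`|comb z k v| `^ alpha)%:E)%E.

Lemma snrm_ge0 D z k : (0 <= snrm D z k)%E.
Proof. by apply: integral_ge0 => v _; rewrite lee_fin powR_ge0. Qed.

Lemma measurable_comb z k : measurable_fun [set: N.-tuple R] (comb z k).
Proof.
rewrite /comb; elim: z => [|p z IH].
  by under eq_fun do rewrite big_nil; exact: measurable_cst.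
under eq_fun do rewrite big_cons.
apply: measurable_funD => //; apply: measurable_funM => //.
exact: measurable_ker.
Qed.

Lemma measurable_comb_powR z k :
  measurable_fun [set: N.-tuple R] (fun v => (`|comb z k v| `^ alpha)%:E).
Proof.
apply/measurable_EFinP; apply: (measurableT_comp (measurable_powR alpha)).
by apply: measurable_absT; exact: measurable_comb.
Qed.

Definition admissible (B e : R) u :=
  (forall i, 2 * e <= tnth u i <= B) /\ (forall i, 0 < h i u < 1).

Lemma integral_iter_shift (w : N.-tuple R) p (f : N.-tuple R -> \bar R) :
  measurable_fun [set: N.-tuple R] f -> (forall v, 0 <= f v)%E ->
  (\int[lebT R N]_v f (iter p (fun v => addT v w) v) = \int[lebT R N]_v f v)%E.
Proof.
elim: p f => [//|p IH] f mf f0.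
rewrite -(integral_lebT_shift w mf f0).
rewrite -(IH (fun v => f (addT v w)))//.
apply: (measurableT_comp mf); apply: measurable_addT => //; exact: measurable_cst.
Qed.

Definition shl l (ew : R) v := addT v [tuple if i == l then ew else 0 | i < N].

Lemma tnth_iter_shl l ew p v i :
  tnth (iter p (shl l ew) v) i = tnth v i + (if i == l then p%:R * ew else 0).
Proof.
elim: p => [|p IH] /=; first by rewrite mul0r if_same addr0.
rewrite !tnth_mktuple IH; case: ifP => _; last by rewrite !addr0.
by rewrite -natr1 mulrDl mul1r addrA.
Qed.

Section smooth_part.
Variables (B e : R).
Hypotheses (B1 : 1 <= B) (Be : B^-1 <= e).
Let P := 1 + alpha^-1.

Lemma admissible_exponent u i : admissible B e u -> `|h i u - alpha^-1| <= P.
Proof.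
move=> [_ /(_ i)/andP[i0 i1]]; have ai : 0 < alpha^-1 by rewrite invr_gt0.
by rewrite ler_norml /P; apply/andP; split; lra.
Qed.

(** The shifts move only v_l, so the other factors form a constant W and the problem reduces to a
    real power, at distance at least [del] from its singularity. *)
Lemma fd_ker_le l u v q (ew del : R) : admissible B e u -> slab l setT e v ->
  0 <= tnth v l -> 0 < ew -> 0 < del -> del <= 1 -> B <= del^-1 ->
  del <= tnth u l - (tnth v l + q%:R * ew) ->
  `|fd (shl l ew) q (ker u) v| <= c * (B `^ P) ^+ N.-1 *
     (ew ^+ q * ((\prod_(j < q) (P + j%:R)) * (del^-1) `^ (P + q%:R))).
Proof.
move=> adu sv v0 ew0 d0 d1 Bd hd.
have [uB hu] := adu.
pose W := c * \prod_(i < N | i != l) ppow (tnth u i - tnth v i) (h i u - alpha^-1).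
rewrite (@fd_ext R _ _ _ (fun y : R => y + ew) q _
   (fun y => W * (tnth u l - y) `^ (h l u - alpha^-1)) v (tnth v l)); last first.
  move=> p pq; rewrite iter_shift.
  have pe : 0 <= p%:R * ew by rewrite mulr_ge0// ltW.
  have sv' : slab l setT e (iter p (shl l ew) v).
    split=> // i il; rewrite tnth_iter_shl (negbTE il) addr0; exact: sv.2.
  rewrite (ker_pos alpha h c u sv'); last by rewrite tnth_iter_shl eqxx addr_ge0.
  rewrite (bigD1 l)//= tnth_iter_shl eqxx {1}/ppow subr_gt0.
  rewrite (_ : _ < tnth u l); last first.
    have : p%:R * ew <= q%:R * ew by rewrite ler_wpM2r ?(ltW ew0)// ler_nat.
    lra.
  rewrite /W mulrA mulrAC -!mulrA; congr (_ * (_ * _)).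
  by apply: eq_bigr => i il; rewrite tnth_iter_shl (negbTE il) addr0.
rewrite fdZ normrM; apply: ler_pM => //.
  rewrite normrM gtr0_norm// ler_pM2l// normr_prod.
  have -> : B `^ P ^+ N.-1 = \prod_(i < N | i != l) B `^ P.
    by rewrite prodr_const cardC1 card_ord.
  apply: ler_prod => i il; rewrite normr_ge0/= ger0_norm.
    by have /andP[] := ppow_other B1 Be uB sv il (admissible_exponent i adu).
  have /andP[+ _] := ppow_other B1 Be uB sv il (admissible_exponent i adu).
  by apply: le_trans; exact: powR_ge0.
apply: fd_powR_le => //; first exact: admissible_exponent.
by have /andP[_ ub] := uB l; lra.
Qed.

(** Three kinds of kernels occur: that of [p0], of which only the unshifted copy is nonzero; those
    of points lower than [p0] by at least r, which vanish at all the shifts; those of points higher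
    by at least r, which are smooth there. *)
Lemma fd_comb_le l p0 z k v q (ew del r : R) :
  admissible B e p0.1 -> (forall p, p \in z -> admissible B e p.1) ->
  (forall p, p \in z -> r <= `|tnth p.1 l - tnth p0.1 l|) ->
  slab l `]tnth p0.1 l - ew, tnth p0.1 l]%classic e v -> 0 <= tnth v l ->
  0 < ew -> 0 < del -> del <= 1 -> B <= del^-1 -> ew <= r ->
  del + q%:R * ew <= r ->
  `|tnth p0.2 k| * `|ker p0.1 v| <= `|fd (shl l ew) q (comb (p0 :: z) k) v| +
    (\sum_(p <- z) `|tnth p.2 k|) * (c * (B `^ P) ^+ N.-1 *
     (ew ^+ q * ((\prod_(j < q) (P + j%:R)) * (del^-1) `^ (P + q%:R)))).
Proof.
move=> ad0 adz rz sv v0 ew0 d0 d1 Bd er dr.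
have [vl Hv] := sv; move: vl; rewrite /= in_itv/= => /andP[vl1 vl2].
have svT : slab l setT e v by [].
set M := c * _ * _.
have M0 : 0 <= M.
  rewrite /M !mulr_ge0 ?exprn_ge0 ?powR_ge0 ?(ltW c0) ?(ltW ew0)//.
  by apply: prodr_ge0 => j _; rewrite /P !addr_ge0// invr_ge0 ltW.
have svp p : slab l setT e (iter p (shl l ew) v).
  by split=> // i il; rewrite tnth_iter_shl (negbTE il) addr0; exact: Hv.
have itp p : 0 <= p%:R * ew by rewrite mulr_ge0// ltW.
have vlp p : 0 <= tnth (iter p (shl l ew) v) l by rewrite tnth_iter_shl eqxx addr_ge0.
have E : fd (shl l ew) q (comb (p0 :: z) k) v =
   tnth p0.2 k * fd (shl l ew) q (ker p0.1) v +
   \sum_(p <- z) tnth p.2 k * fd (shl l ew) q (ker p.1) v.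
  by rewrite /comb fd_sum big_cons fdZ; congr (_ + _); apply: eq_bigr => p _; rewrite fdZ.
have -> : `|tnth p0.2 k| * `|ker p0.1 v| = `|tnth p0.2 k * fd (shl l ew) q (ker p0.1) v|.
  (* As v_l lies less than [ew] below [p0], already one shift passes above it. *)
  rewrite [RHS]normrM norm_fd// => p /andP[p1 pq].
  apply: (@ker_above _ _ alpha h c e _ l setT _ (svp p)) => //; rewrite tnth_iter_shl eqxx.
  have : 1 * ew <= p%:R * ew by rewrite ler_wpM2r ?(ltW ew0)// ler1n.
  lra.
rewrite (_ : _ * fd _ _ (ker p0.1) _ = fd (shl l ew) q (comb (p0 :: z) k) v -
   \sum_(p <- z) tnth p.2 k * fd (shl l ew) q (ker p.1) v); last by rewrite E addrK.
apply: (le_trans (ler_normB _ _)); rewrite lerD2l.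
apply: (le_trans (ler_norm_sum _ _ _)); rewrite mulr_suml.
rewrite big_seq [leRHS]big_seq; apply: ler_sum => p pz; rewrite normrM ler_wpM2l//.
have adp := adz _ pz; have := rz _ pz.
have [lt_s|ge_s] := ltP (tnth p.1 l) (tnth p0.1 l).
  rewrite [X in r <= X]ltr0_norm ?subr_lt0// => rs.
  rewrite fd_eq0 ?normr0// => j jq; apply: (@ker_above _ _ alpha h c e _ l setT _ (svp j)) => //.
  rewrite tnth_iter_shl eqxx; have := itp j; lra.
rewrite [X in r <= X]ger0_norm ?subr_ge0// => rs.
apply: fd_ker_le => //; lra.
Qed.

End smooth_part.

(* Take the q-th difference with step Y^-2 in the coordinate l, on the slab of
   that width below p0.  There the shifted copies of the kernel of p0 vanish,
   while the other kernels are smooth at scale Y^-1, so that each of the q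
   steps gains a factor Y^-1, which beats the frequencies Y^7.  Shifts leave
   the stable norm invariant, so the q-th difference costs a constant only. *)
Lemma isolated_lower (B e D : R) : 1 <= B -> B^-1 <= e -> 0 < D ->
  exists c3 C3 Y0, [/\ 0 < c3, 0 <= C3, 1 <= Y0 &
  forall (Y : R) l p0 z k, Y0 <= Y -> admissible B e p0.1 ->
  (forall p, p \in z -> admissible B e p.1) ->
  (forall p, p \in z -> Y^-1 <= `|tnth p.1 l - tnth p0.1 l|) ->
  Y ^+ 5 / D <= `|tnth p0.2 k| ->
  \sum_(p <- z) `|tnth p.2 k| <= Y ^+ 7 ->
  ((c3 * Y `^ (3 * alpha) - C3)%:E <= snrm setT (p0 :: z) k)%E].
Proof.
move=> B1 Be D0.
have B0 : 0 < B by apply: lt_le_trans B1.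
have e0 : 0 < e by apply: lt_le_trans Be; rewrite invr_gt0.
pose P := 1 + alpha^-1.
have P0 : 0 < P by rewrite addr_gt0// invr_gt0.
have [c2 c20 Hlow] := ker_lower h al0 al2 c0 B1 Be.
(* Frequencies contribute Y^7, the steps Y^(-2q), the derivatives Y^(P + q): the product is bounded
   as soon as q >= 7 + P. *)
have [q qP] : exists q : nat, 7 + P <= q%:R.
  have p7 : 0 <= 7 + P by rewrite addr_ge0// ltW.
  by have /ltW := archi_boundP p7; exists (Num.bound (7 + P)).
pose Cq : R := \prod_(j < q) (P + j%:R).
have Cq0 : 0 <= Cq by apply: prodr_ge0 => j _; rewrite addr_ge0// ltW.
pose C1 := c * (B `^ P) ^+ N.-1 * (Cq * 2 `^ (P + q%:R)).
have C10 : 0 <= C1.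
  by rewrite mulr_ge0// ?mulr_ge0 ?(ltW c0) ?exprn_ge0 ?powR_ge0.
(* 4 separates the difference from the smooth remainder, 8^q comes from [powR_fd_le], and q + 1
   counts the shifted copies, each contributing at most the full norm. *)
pose A1 : R := 4 * 8 ^+ q * q.+1%:R.
have A10 : 0 < A1 by rewrite !mulr_gt0// exprn_gt0.
pose A2 := 4 * C1 `^ alpha * e ^+ N.-1.
have A20 : 0 <= A2 by rewrite !mulr_ge0 ?powR_ge0 ?exprn_ge0 ?(ltW e0).
(* The threshold ensures both Y >= 2B, keeping the slab away from 0, and Y >= 2(q + 1), so that all
   shifts fit into half of the isolation 1/Y. *)
exists ((c2 / D) `^ alpha / A1), (A2 / A1), (2 * B * q.+1%:R); split.
- by rewrite divr_gt0// powR_gt0// divr_gt0.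
- by rewrite divr_ge0// ltW.
- rewrite -[leLHS]mulr1; apply: ler_pM => //; last by rewrite ler1n.
  by rewrite (le_trans B1)// ler_peMl ?(ltW B0)// ler1n.
move=> Y l p0 z k YY adp0 adz rz a0 sz.
have q1 : 1 <= q.+1%:R :> R by rewrite ler1n.
have YB : 2 * B <= Y by apply: le_trans YY; rewrite ler_peMr// mulr_ge0// ltW.
have Yq : 2 * q.+1%:R <= Y.
  by apply: le_trans YY; rewrite mulrAC ler_peMr// mulr_ge0.
have Y1 : 1 <= Y by apply: le_trans YB; rewrite (le_trans B1)// ler_peMl ?(ltW B0)// ler1n.
have Y0 : 0 < Y by apply: lt_le_trans Y1.
set s0 := p0.1; set tau := tnth s0 l.
pose ew := Y ^- 2.
have ew0 : 0 < ew by rewrite invr_gt0 exprn_gt0.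
have ew1 : ew <= 1 by rewrite invf_le1 ?exprn_gt0// exprn_ege1.
(* Half of 1/Y is reserved for the q shifts, the other half for the distance to the remaining
   singularities. *)
pose del := (2 * Y)^-1.
have del0 : 0 < del by rewrite invr_gt0 mulr_gt0.
have qew : q.+1%:R * ew <= del.
  rewrite /ew /del ler_pdivrMr ?exprn_gt0// ler_pdivlMl ?mulr_gt0//.
  by rewrite expr2 mulrAC ler_pM2r.
have YD : Y^-1 = del + del by rewrite /del; field; rewrite gt_eqF.
have delB : B <= del^-1 by rewrite invrK; lra.
have del1 : del <= 1 by rewrite /del invf_le1 ?mulr_gt0//; lra.
have ewY : ew <= Y^-1.
  by rewrite lef_pV2 ?posrE ?exprn_gt0// expr2 ler_peMr// ltW.
have dqY : del + q%:R * ew <= Y^-1.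
  rewrite YD lerD2l (le_trans _ qew)// ler_wpM2r ?(ltW ew0)// ler_nat; exact: leqnSn.
have tau0 : 2 * e <= tau by have [/(_ l)/andP[]] := adp0.
have be : 0 <= tau - ew < tau.
  rewrite subr_ge0 ltrBlDr ltrDl ew0 andbT (le_trans ewY)//.
  have : Y^-1 <= B^-1 by rewrite lef_pV2 ?posrE//; lra.
  lra.
have [uB hu] := adp0.
have hlow := Hlow _ l (tau - ew) uB hu be.
rewrite -/s0 -/tau (_ : tau - (tau - ew) = ew) in hlow; last by ring.
set Wd := slab l _ e in hlow.
have mWd : measurable Wd by apply: measurable_slab; exact: measurable_itv.
have smooth : (\sum_(p <- z) `|tnth p.2 k|) * (c * (B `^ P) ^+ N.-1 *
     (ew ^+ q * (Cq * (del^-1) `^ (P + q%:R)))) <= C1.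
  have -> : del^-1 = 2 * Y by rewrite invrK.
  rewrite powRM ?(ltW Y0)//.
  apply: (@le_trans _ _ (Y ^+ 7 * (c * (B `^ P) ^+ N.-1 *
     (ew ^+ q * (Cq * (2 `^ (P + q%:R) * Y `^ (P + q%:R))))))).
    apply: ler_wpM2r => //; rewrite !mulr_ge0 ?exprn_ge0 ?powR_ge0 ?(ltW c0) ?(ltW ew0)//.
  rewrite (_ : Y ^+ 7 * _ = C1 * (Y ^+ 7 * ew ^+ q * Y `^ (P + q%:R))); last by rewrite /C1; ring.
  rewrite ler_piMr// /ew exprVn -exprM -!powR_mulrn ?(ltW Y0)// -powRN -!powRD ?(gt_eqF Y0) ?implybT//.
  rewrite -[leRHS](powRr0 Y) ler_powR// natrM; lra.
have ptw v : Wd v -> `|tnth p0.2 k| `^ alpha * `|ker s0 v| `^ alpha <=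
   4 * (8 ^+ q * \sum_(j < q.+1) `|comb (p0 :: z) k (iter j (shl l ew) v)| `^ alpha + C1 `^ alpha).
  move=> Wv; have v0 : 0 <= tnth v l.
    have [+ _] := Wv; rewrite /= in_itv/= => /andP[vl _]; have /andP[+ _] := be; lra.
  have := fd_comb_le B1 Be k adp0 adz rz Wv v0 ew0 del0 del1 delB ewY dqY.
  move=> /le_trans/(_ (lerD (lexx _) smooth)) h1.
  rewrite -powRM//.
  set x := fd _ _ _ _ in h1.
  apply: (@le_trans _ _ ((`|x| + C1) `^ alpha)).
    by rewrite ge0_ler_powR ?nnegrE ?(ltW al0)// ?mulr_ge0// addr_ge0.
  have := powR_normB_le `|x| (- C1) al0 al2.
  rewrite opprK normrN normr_id (ger0_norm C10) ger0_norm ?addr_ge0// => /le_trans; apply.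
  rewrite ler_pM2l// lerD2r; exact: powR_fd_le.
have mF j : measurable_fun [set: N.-tuple R]
   (fun v => (`|comb (p0 :: z) k (iter j (shl l ew) v)| `^ alpha)%:E).
  apply: (measurableT_comp (measurable_comb_powR (p0 :: z) k)).
  elim: j => [|j IH]; first exact: measurable_id.
  by apply: measurable_addT => //; exact: measurable_cst.
have step : (((`|tnth p0.2 k| * (c2 * ew `^ h l s0)) `^ alpha)%:E <=
   A1%:E * snrm setT (p0 :: z) k + A2%:E)%E.
  rewrite powRM ?mulr_ge0 ?powR_ge0 ?(ltW c20)// EFinM.
  apply: le_trans (lee_wpmul2l _ hlow) _; first by rewrite lee_fin powR_ge0.
  rewrite -ge0_integralZl_EFin ?powR_ge0//; last first.
    apply/measurable_EFinP; apply: measurable_funTS.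
    apply: (measurableT_comp (measurable_powR alpha)); apply: measurable_absT.
    exact: measurable_ker.
  apply: (@le_trans _ _ (\int[lebT R N]_(v in Wd) ((4 * 8 ^+ q)%:E *
     (\sum_(j < q.+1) (`|comb (p0 :: z) k (iter j (shl l ew) v)| `^ alpha)%:E) +
     (4 * C1 `^ alpha)%:E))%E).
    apply: ge0_le_integralT => v Wv; first by rewrite lee_fin mulr_ge0// powR_ge0.
    rewrite sumEFin -!EFinM -EFinD lee_fin; apply: (le_trans (ptw _ Wv)).
    by rewrite mulrDr mulrA.
  have S0 v : (0 <= \sum_(j < q.+1) (`|comb (p0 :: z) k (iter j (shl l ew) v)| `^ alpha)%:E)%E.
    by apply: sume_ge0 => j _; rewrite lee_fin powR_ge0.
  have mS : measurable_fun Wd (fun v => (\sum_(j < q.+1) (`|comb (p0 :: z) k (iter j (shl l ew) v)| `^ alpha)%:E)%E).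
    by apply: emeasurable_sum => j; apply: measurable_funTS; exact: mF.
  rewrite ge0_integralD//; last 3 first.
  - by move=> v _; rewrite mule_ge0// lee_fin mulr_ge0// exprn_ge0.
  - by apply: emeasurable_funM => //; exact: measurable_cst.
  - by move=> v _; rewrite lee_fin mulr_ge0// powR_ge0.
  apply: leeD; last first.
    rewrite integral_cst// [X in (_ * X <= _)%E](lebT_slab _ (measurable_itv _) (ltW e0)).
    rewrite lebesgue_measure_itv/= lte_fin (_ : tau - ew < tau); last by have /andP[] := be.
    rewrite -EFinB -!EFinM lee_fin (_ : tau - (tau - ew) = ew); last by ring.
    apply: ler_wpM2l; first by rewrite mulr_ge0// powR_ge0.
    by rewrite ler_piMl// exprn_ge0// ltW.
  have q8 : 0 <= 4 * 8 ^+ q :> R by rewrite mulr_ge0// exprn_ge0.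
  have -> : (\int[lebT R N]_(x in Wd) ((4 * 8 ^+ q)%:E *
      \sum_(j < q.+1) (`|comb (p0 :: z) k (iter j (shl l ew) x)| `^ alpha)%:E) =
      (4 * 8 ^+ q)%:E * \int[lebT R N]_(x in Wd)
      \sum_(j < q.+1) (`|comb (p0 :: z) k (iter j (shl l ew) x)| `^ alpha)%:E)%E.
    by apply: ge0_integralZl_EFin.
  rewrite /A1 [in leRHS]EFinM -muleA lee_wpmul2l// ?lee_fin ?mulr_ge0 ?exprn_ge0//.
  rewrite ge0_integral_sum//; last first.
    by move=> j; apply: measurable_funTS; exact: mF.
  apply: (@le_trans _ _ (\sum_(j < q.+1) snrm setT (p0 :: z) k)%E).
    apply: lee_sum => j _.
    apply: (@le_trans _ _ (\int[lebT R N]_v (`|comb (p0 :: z) k (iter j (shl l ew) v)| `^ alpha)%:E)%E).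
      by apply: ge0_subset_integral.
    by rewrite (integral_iter_shift _ j (measurable_comb_powR (p0 :: z) k)).
  by rewrite sumr_const card_ord mule_natl.
(* The frequency is at least Y^5 / D, and ew^h >= ew = Y^(-2) because h < 1; their product has order
   Y^3. *)
have final : (((c2 / D) `^ alpha * Y `^ (3 * alpha))%:E <=
   A1%:E * snrm setT (p0 :: z) k + A2%:E)%E.
  apply: le_trans step; rewrite lee_fin.
  rewrite mulrC powRrM -powRM ?powR_ge0 ?divr_ge0 ?(ltW c20) ?(ltW D0)//.
  rewrite ge0_ler_powR ?nnegrE ?(ltW al0)// ?mulr_ge0 ?powR_ge0 ?invr_ge0 ?(ltW c20) ?(ltW D0)//.
  apply: (@le_trans _ _ ((Y ^+ 5 / D) * (c2 * ew))).
    rewrite powR_mulrn ?(ltW Y0)// /ew le_eqVlt; apply/orP; left; apply/eqP.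
    by field; rewrite !gt_eqF.
  apply: ler_pM => //.
  - by rewrite divr_ge0 ?exprn_ge0 ?(ltW Y0) ?(ltW D0).
  - by rewrite mulr_ge0 ?(ltW c20) ?(ltW ew0).
  - rewrite ler_pM2l//; apply: ger1_powR; first by rewrite ew0.
    by have /andP[_ /ltW] := hu l.
have := snrm_ge0 setT (p0 :: z) k; move: final.
case: (snrm setT (p0 :: z) k) => [x| |]//; last by move=> *; exact: leey.
rewrite -EFinM -EFinD !lee_fin => H _.
by rewrite -mulrAC -mulrBl ler_pdivrMr// mulrC; lra.
Qed.

End isolated.

(** * Isolated points *)

Lemma powR_le1 (R : realType) (x p : R) : 0 <= x -> x <= 1 -> 0 <= p -> x `^ p <= 1.
Proof.
move=> x0 x1 p0; apply: (@le_trans _ _ (1 `^ p)); last by rewrite powR1.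
by rewrite ge0_ler_powR ?nnegrE.
Qed.

Section gap_product.
Variable R : realType.

Fixpoint gapD (be b : R) (t : seq R) : R :=
  if t is y :: t' then (y - b) `^ (- be) * gapD be y t' else 1.

Lemma gapD_ge0 be b t : 0 <= gapD be b t.
Proof. by elim: t b => //= y t IH b; rewrite mulr_ge0 ?powR_ge0. Qed.

Lemma gapDD be1 be2 b t : path <%R b t ->
  gapD be1 b t * gapD be2 b t = gapD (be1 + be2) b t.
Proof.
elim: t b => [|y t IH] b /=; first by rewrite mulr1.
move=> /andP[by_ yt]; rewrite mulrACA IH// opprD powRD//.
by rewrite (subr_eq0 y) (gt_eqF by_) implybT.
Qed.

Variables (T : eqType) (co : T -> R).

(** A point is isolated by the smaller of its two adjacent gaps. The larger gap is at most B, so its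
    power -be can be inserted at the cost of B^be; every gap is then charged by both of its end
    points, whence the exponent be + be. *)
Lemma prod_isolated (B K be : R) (f : T -> R) (z : seq T) :
  1 <= B -> 0 < K -> 0 <= be -> (forall p, 0 <= f p) ->
  path <%R 0 (map co z) -> (forall p, p \in z -> co p <= B) ->
  (forall z1 p z2 r, z = z1 ++ p :: z2 -> 0 < r -> r <= B ->
    (forall p', p' \in z1 ++ z2 -> r <= `|co p' - co p|) ->
    f p <= (K / r) `^ be) ->
  \prod_(p <- z) f p <=
  (K `^ be * B `^ be * B `^ be) ^+ size z * gapD (be + be) 0 (map co z).
Proof.
move=> B1 K0 be0 f0 sz zB H.
have B0 : 0 < B by apply: lt_le_trans B1.
have Bbe1 : 1 <= B `^ be by rewrite -(powRr0 B) ler_powR.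
set Cst := K `^ be * B `^ be.
have Cst0 : 0 <= Cst by rewrite mulr_ge0 ?powR_ge0.
have low x : 0 < x -> x <= B -> 1 <= x `^ (- be) * B `^ be.
  move=> x0 xB; rewrite powRN mulrC ler_pdivlMr ?powR_gt0// mul1r.
  by rewrite ge0_ler_powR// nnegrE ltW.
have KrE r : 0 < r -> (K / r) `^ be = K `^ be * r `^ (- be).
  move=> r0; rewrite powRM ?invr_ge0 ?(ltW K0) ?(ltW r0)//.
  by congr (_ * _); rewrite -powR_inv1 ?(ltW r0)// -powRrM mulN1r.
(* Induction on the suffix; [b] bounds the points already passed. The gap between [b] and [p] is
   charged here only once, by [p]. *)
have main z1 p z2 b : z = z1 ++ p :: z2 -> 0 <= b ->
   all (fun p' => co p' <= b) z1 -> path <%R b (map co (p :: z2)) ->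
   \prod_(q <- p :: z2) f q <= Cst ^+ (size z2).+1 *
     ((co p - b) `^ (- be) * gapD (be + be) (co p) (map co z2)).
  elim: z2 z1 p b => [|p2 z2 IH] z1 p b zE b0 zb /=.
    rewrite andbT => bp; rewrite big_cons big_nil mulr1 expr1 mulr1.
    have pB : co p <= B by apply: zB; rewrite zE mem_cat inE eqxx orbT.
    have r0 : 0 < co p - b by rewrite subr_gt0.
    apply: le_trans (H z1 p [::] (co p - b) zE r0 _ _) _.
      by rewrite lerBlDr (le_trans pB) ?lerDl.
      move=> p'; rewrite cats0 => /(allP zb) p'b; rewrite distrC ger0_norm ?lerD2l ?lerN2//.
      by rewrite subr_ge0 (le_trans p'b)// ltW.
    rewrite KrE// /Cst mulrAC ler_peMr ?mulr_ge0 ?powR_ge0//.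
  move=> /andP[bp /andP[pp2 pz2]].
  have memz q : q \in p :: p2 :: z2 -> co q <= B.
    by move=> qz; apply: zB; rewrite zE mem_cat qz orbT.
  have pB := memz p (mem_head _ _).
  have p2B : co p2 <= B by apply: memz; rewrite !inE eqxx orbT.
  have r0 : 0 < co p - b by rewrite subr_gt0.
  have r20 : 0 < co p2 - co p by rewrite subr_gt0.
  set r := Num.min (co p - b) (co p2 - co p).
  have rp : 0 < r by rewrite /r lt_min r0.
  have rB : r <= B by rewrite /r ge_min lerBlDr (le_trans pB) ?lerDl.
  have minz q : q \in p2 :: z2 -> co p2 <= co q.
    rewrite inE => /orP[/eqP->//|qz]; have /allP := order_path_min lt_trans pz2.
    by move=> /(_ (co q)); rewrite map_f// => /(_ isT)/ltW.
  have sep p' : p' \in z1 ++ p2 :: z2 -> r <= `|co p' - co p|.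
    rewrite mem_cat => /orP[/(allP zb) p'b|/minz p'2].
      rewrite distrC ger0_norm; last by rewrite subr_ge0 (le_trans p'b)// ltW.
      by rewrite /r ge_min lerD2l lerN2 p'b.
    rewrite ger0_norm; last by rewrite subr_ge0 (le_trans (ltW pp2)).
    by rewrite /r ge_min lerD2r p'2 orbT.
  have fK := H z1 p (p2 :: z2) r zE rp rB sep.
  have IHz : \prod_(q <- p2 :: z2) f q <= Cst ^+ (size z2).+1 *
     ((co p2 - co p) `^ (- be) * gapD (be + be) (co p2) (map co z2)).
    apply: (IH (rcons z1 p)).
    - by rewrite cat_rcons.
    - by rewrite (le_trans b0)// ltW.
    - rewrite all_rcons lexx/=; apply: sub_all zb => q /le_trans; apply; exact: ltW.
    - by rewrite /= pp2.
  have f1 : f p <= Cst * ((co p - b) `^ (- be) * (co p2 - co p) `^ (- be)).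
    apply: (le_trans fK).
    rewrite KrE//.
    rewrite /Cst -mulrA ler_wpM2l ?powR_ge0//.
    have -> : (co p - b) `^ (- be) * (co p2 - co p) `^ (- be) =
       r `^ (- be) * (Num.max (co p - b) (co p2 - co p)) `^ (- be).
      by rewrite /r; case: (leP (co p - b) (co p2 - co p)) => _; rewrite // mulrC.
    rewrite mulrCA ler_peMr ?powR_ge0// mulrC low//.
      by rewrite lt_max r0.
    by rewrite ge_max; apply/andP; split; lra.
  rewrite big_cons; apply: (@le_trans _ _ (Cst * ((co p - b) `^ (- be) * (co p2 - co p) `^ (- be)) *
     (Cst ^+ (size z2).+1 * ((co p2 - co p) `^ (- be) * gapD (be + be) (co p2) (map co z2))))).
    apply: ler_pM => //; exact: prodr_ge0.
  rewrite le_eqVlt; apply/orP; left; apply/eqP.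
  rewrite [_ ^+ (size z2).+2]exprS opprD powRD ?(subr_eq0 (co p2)) ?(gt_eqF pp2) ?implybT//.
  by ring.
case: z sz zB H main => [|p z] sz zB H main.
  by rewrite big_nil mulr1.
have /le_trans := main [::] p z 0 erefl (lexx _) isT sz; apply.
(* The gap from 0 to the first point was charged once; its exponent is doubled at the cost of
   another B^be. *)
rewrite /= subr0 opprD powRD; last by move: sz => /= /andP[/gt_eqF ->]; rewrite implybT.
have g0 := gapD_ge0 (be + be) (co p) (map co z).
move: sz => /= /andP[p0 _].
have l1 : 1 <= co p `^ (- be) * B `^ be by rewrite low// zB ?mem_head.
set x := co p `^ (- be) in l1 *; set g := gapD _ _ _ in g0 *.
rewrite [leRHS](_ : _ = (Cst ^+ (size z).+1 * (x * g)) * ((B `^ be) ^+ size z * (x * B `^ be))); last first.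
  by rewrite exprMn [(B `^ be) ^+ (size z).+1]exprS; ring.
rewrite ler_peMr// ?mulr_ge0 ?exprn_ge0 ?powR_ge0//.
by rewrite -[leLHS]mulr1 ler_pM// exprn_ege1.
Qed.

End gap_product.

Section weights.
Variables (R : realType) (N d : nat) (alpha : R) (h : 'I_N -> N.-tuple R -> R) (c : R).
Hypotheses (al0 : 0 < alpha) (al2 : alpha <= 2) (c0 : 0 < c).
Local Notation point := (N.-tuple R * d.-tuple R)%type.
Local Notation snrm := (snrm alpha h c).
Implicit Types (z : seq point) (Y X : R).

Definition n1 (xi : d.-tuple R) : R := \sum_(k < d) `|tnth xi k|.

Lemma n1_ge0 xi : 0 <= n1 xi.
Proof. exact: sumr_ge0. Qed.

Definition tnrm z : \bar R := (\sum_(k < d) snrm setT z k)%E.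

Lemma tnrm_ge0 z : (0 <= tnrm z)%E.
Proof. by apply: sume_ge0 => k _; exact: snrm_ge0. Qed.

Lemma snrm_perm D z z' k : perm_eq z z' -> snrm D z k = snrm D z' k.
Proof.
by move=> zz; apply: eq_integral => v _; rewrite /comb (perm_big _ zz).
Qed.

(** With t = n1 xi / (2X), this is min(1, t) exp(-t), an upper bound for exp(-t) - exp(-2t), the
    shape of the Fourier transform of p_(2X) - p_X. *)
Definition qbd X (xi : d.-tuple R) : R :=
  Num.min 1 (n1 xi / (2 * X)) * expR (- (n1 xi / (2 * X))).

Lemma expR_le_inv (x : R) : 0 < x -> expR (- x) <= x^-1.
Proof.
move=> x0; rewrite expRN lef_pV2 ?posrE ?expR_gt0//.
by apply: le_trans (expR_ge1Dx x); rewrite lerDr.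
Qed.

(** With q = Y^6: a frequency below Y^5 gains 1/Y through the minimum, a total above Y^7 through the
    exponential weight, and otherwise [isolated_lower] makes the characteristic function tiny. The
    m-th root anticipates that the global weight is shared among m points. *)
Lemma isolated_weight (B e : R) (m : nat) : 1 <= B -> B^-1 <= e -> (0 < m)%N ->
  exists2 C, 0 < C & forall Y l p0 z r, 1 <= Y ->
  (forall p, p \in p0 :: z -> admissible h B e p.1) -> 0 < r -> r <= B ->
  (forall p, p \in z -> r <= `|tnth p.1 l - tnth p0.1 l|) ->
  Num.min 1 (n1 p0.2 / (2 * Y ^+ 6)) *
  (expR (- (\sum_(p <- p0 :: z) n1 p.2) / (2 * Y ^+ 6)) *
   eneg (2^-1%:E * tnrm (p0 :: z))) `^ m%:R^-1 <= C / (Y * r).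
Proof.
move=> B1 Be m0.
have B0 : 0 < B by apply: lt_le_trans B1.
(* D = d + 1 is the pigeonhole constant for finding a large component of the frequency; unlike d it
   is always positive. *)
have [c3 [C3 [Y0 [c30 C30 Y01 Hiso]]]] := isolated_lower d h al0 al2 c0 B1 Be (ltr0Sn R d).
have m0R : 0 < m%:R :> R by rewrite ltr0n.
have c4 : 0 < c3 / (2 * m%:R) by rewrite divr_gt0// mulr_gt0.
have al3 : 0 < 3 * alpha by rewrite mulr_gt0.
have [K K0 HK] := expR_dominates_powR al3 c4.
pose E3 := expR (C3 / (2 * m%:R)).
have E30 : 0 < E3 by exact: expR_gt0.
exists (Y0 * B + 2 * m%:R * B + E3 * K * B).
  by rewrite !addr_gt0// !mulr_gt0//; apply: lt_le_trans Y01.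
move=> Y l p0 z r Y1 ad r0 rB sep.
have Yp : 0 < Y by apply: lt_le_trans Y1.
have Yr : 0 < Y * r by rewrite mulr_gt0.
set mn := Num.min _ _.
have X0 : 0 < 2 * Y ^+ 6 by rewrite mulr_gt0// exprn_gt0.
have mn0 : 0 <= mn by rewrite /mn le_min ler01 divr_ge0 ?n1_ge0// ltW.
have mn1 : mn <= 1 by rewrite /mn ge_min lexx.
set S := \sum_(p <- _) _.
have S0 : 0 <= S by apply: sumr_ge0 => p _; exact: n1_ge0.
set G := eneg _.
have G0 : 0 <= G by exact: eneg_ge0.
have tn0 : (0 <= 2^-1%:E * tnrm (p0 :: z))%E.
  by rewrite mule_ge0 ?tnrm_ge0// lee_fin invr_ge0.
have G1 : G <= 1 by exact: eneg_le1.
set A := expR _.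
have A0 : 0 <= A by exact: expR_ge0.
have A1 : A <= 1 by rewrite expR_le1 mulNr oppr_le0 divr_ge0// ltW.
have im0 : 0 <= m%:R^-1 :> R by rewrite invr_ge0 ltW.
have pw1 (x : R) : 0 <= x -> x <= 1 -> x `^ m%:R^-1 <= 1.
  by move=> x0 x1; exact: powR_le1.
have AG1 : (A * G) `^ m%:R^-1 <= 1 by rewrite pw1 ?mulr_ge0// -[leRHS]mulr1 ler_pM.
have LG : mn * (A * G) `^ m%:R^-1 <= G `^ m%:R^-1.
  rewrite powRM// mulrA ler_piMl ?powR_ge0// -[leRHS]mulr1 ler_pM ?powR_ge0//.
  exact: pw1.
have LA : mn * (A * G) `^ m%:R^-1 <= A `^ m%:R^-1.
  rewrite powRM// mulrCA ler_piMr ?powR_ge0// -[leRHS]mulr1 ler_pM ?powR_ge0//.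
  exact: pw1.
have Lm : mn * (A * G) `^ m%:R^-1 <= mn by rewrite ler_piMr.
have a1 : 0 < Y0 * B by rewrite mulr_gt0//; apply: lt_le_trans Y01.
have a2 : 0 < 2 * m%:R * B by rewrite !mulr_gt0.
have a3 : 0 < E3 * K * B by rewrite !mulr_gt0.
rewrite ler_pdivlMr//.
have YrB : Y * r <= Y * B by rewrite ler_pM2l.
(* For Y < Y0, and then for r < 1/Y, the product Y r is bounded and the claim is trivial. *)
have [YY0|YY0] := ltP Y Y0.
  have h1 : mn * (A * G) `^ m%:R^-1 * (Y * r) <= 1 * (Y0 * B).
    apply: ler_pM => //; rewrite ?mulr_ge0 ?powR_ge0 ?(ltW Yp) ?(ltW r0)//.
      exact: le_trans Lm mn1.
    by apply: ler_pM => //; exact: ltW.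
  lra.
have Y0B : 1 <= Y0 * B by rewrite -[leLHS]mulr1 ler_pM.
have [rY|rY] := ltP r Y^-1.
  have h1 : mn * (A * G) `^ m%:R^-1 * (Y * r) <= 1 * 1.
    apply: ler_pM => //; rewrite ?mulr_ge0 ?powR_ge0 ?(ltW Yp) ?(ltW r0)//.
      exact: le_trans Lm mn1.
    by rewrite mulrC -ler_pdivlMr// div1r ltW.
  lra.
have red (x : R) : mn * (A * G) `^ m%:R^-1 <= x / Y -> 0 <= x ->
   x * B <= Y0 * B + 2 * m%:R * B + E3 * K * B ->
   mn * (A * G) `^ m%:R^-1 * (Y * r) <= Y0 * B + 2 * m%:R * B + E3 * K * B.
  move=> h1 x0; apply: le_trans.
  apply: (@le_trans _ _ (x / Y * (Y * B))).
    by apply: ler_pM; rewrite ?mulr_ge0 ?powR_ge0 ?(ltW Yp) ?(ltW r0).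
  by rewrite mulrA divfK ?gt_eqF.
have [n5|n5] := leP (n1 p0.2) (Y ^+ 5).
  apply: (red 1) => //; last first.
    have : 1 * B <= Y0 * B by rewrite ler_wpM2r ?(ltW B0).
    lra.
  apply: (le_trans Lm); rewrite /mn ge_min; apply/orP; right.
  rewrite (_ : 1 / Y = 2 * Y ^+ 5 / (2 * Y ^+ 6)); last by field; rewrite gt_eqF.
  rewrite ler_pM2r ?invr_gt0//.
  by apply: (le_trans n5); rewrite ler_peMl ?exprn_ge0 ?(ltW Yp)// ler1n.
have [S7|S7] := ltP (Y ^+ 7) S.
  apply: (red (2 * m%:R)) => //; last by lra.
  apply: (le_trans LA); rewrite /A.
  rewrite -expRM; apply: (@le_trans _ _ (expR (- (Y / (2 * m%:R))))).
    rewrite ler_expR mulNr mulNr lerN2 -mulrA -invfM ler_pdivrMr ?mulr_gt0//.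
    rewrite mulrAC mulrA ler_pdivlMr ?mulr_gt0// [X in X <= _](_ : _ = Y ^+ 7 * (2 * m%:R)); last by ring.
    by rewrite -[leRHS]mulrA ler_pM2r ?mulr_gt0// ltW.
  by apply: le_trans (expR_le_inv _) _; rewrite ?divr_gt0 ?mulr_gt0// invf_div.
have [k k5] : exists k, Y ^+ 5 / d.+1%:R <= `|tnth p0.2 k|.
  apply: contrapT => /forallNP nk; move: n5; apply/negP; rewrite -leNgt /n1.
  apply: (@le_trans _ _ (\sum_(k < d) Y ^+ 5 / d.+1%:R)).
    by apply: ler_sum => k _; have /negP := nk k; rewrite -ltNge => /ltW.
  rewrite sumr_const card_ord -[_ *+ d]mulr_natr mulrAC ler_pdivrMr//.
  by rewrite ler_wpM2l ?exprn_ge0 ?(ltW Yp)// ler_nat.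
apply: (red (E3 * K)) => //; [|by rewrite mulr_ge0 ?ltW|by lra].
apply: (le_trans LG).
have hk := Hiso Y l p0 z k YY0 (ad _ (mem_head _ _)) (fun p pz => ad p (mem_behead (s := p0 :: z) pz))
  (fun p pz => le_trans rY (sep p pz)) k5.
have {}hk : ((c3 * Y `^ (3 * alpha) - C3)%:E <= tnrm (p0 :: z))%E.
  apply: le_trans (hk _) _.
    apply: le_trans S7; rewrite /S big_cons -[leLHS]add0r lerD ?n1_ge0//.
    apply: ler_sum => p _; rewrite /n1 (bigD1 k)//= lerDl; exact: sumr_ge0.
  rewrite /tnrm (bigD1 k)//= leeDl// sume_ge0// => i _; exact: snrm_ge0.
have GE : G <= expR (- ((c3 * Y `^ (3 * alpha) - C3) / 2)).
  rewrite /G; move: hk (tnrm_ge0 (p0 :: z)); case: (tnrm (p0 :: z)) => [x| |]//.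
    by rewrite lee_fin -EFinM eneg_fin => hx _; rewrite ler_expR lerN2; lra.
  by move=> _ _; rewrite mulry gtr0_sg ?invr_gt0// mul1e /eneg/= expR_ge0.
apply: (@le_trans _ _ ((expR (- ((c3 * Y `^ (3 * alpha) - C3) / 2))) `^ m%:R^-1)).
  by rewrite ge0_ler_powR ?nnegrE ?expR_ge0.
rewrite -expRM (_ : - ((c3 * Y `^ (3 * alpha) - C3) / 2) * m%:R^-1 =
   C3 / (2 * m%:R) + - (c3 / (2 * m%:R) * Y `^ (3 * alpha))); last by field; rewrite gt_eqF.
rewrite expRD -[leRHS]mulrA ler_pM2l//; apply: le_trans (HK _ (ltW Yp)) _.
rewrite ler_pM2l// lef_pV2 ?posrE ?oneDsqr_gt0//.
have : Y * 1 <= Y ^+ 2 by rewrite expr2 ler_pM2l.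
lra.
Qed.

(** The product is rewritten as one factor per point, each taking its own minimum and an m-th root
    of the common weight [W]; [prod_isolated] then applies to these factors. *)
Lemma weight_product (B e be : R) (m : nat) : 1 <= B -> B^-1 <= e -> 0 <= be -> be <= 1 ->
  exists2 C, 0 < C & forall Y l z, 1 <= Y -> size z = m ->
  (forall p, p \in z -> admissible h B e p.1) ->
  path <%R 0 (map (fun p : point => tnth p.1 l) z) ->
  (\prod_(p <- z) qbd (Y ^+ 6) p.2) * eneg (2^-1%:E * tnrm z) <=
  C * (Y `^ (- be)) ^+ m * gapD (be + be) 0 (map (fun p : point => tnth p.1 l) z).
Proof.
move=> B1 Be be0 be1.
have B0 : 0 < B by apply: lt_le_trans B1.
case: m => [|m].
  exists 1 => // Y l z _ /size0nil-> _ _; rewrite big_nil mul1r expr0 !mulr1.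
  by rewrite eneg_le1// mule_ge0 ?tnrm_ge0// lee_fin invr_ge0.
have [C C0 HC] := isolated_weight B1 Be (ltn0Sn m).
exists ((C `^ be * B `^ be * B `^ be) ^+ m.+1); first by rewrite exprn_gt0// !mulr_gt0 ?powR_gt0.
move=> Y l z Y1 sz ad sorted_z.
have Yp : 0 < Y by apply: lt_le_trans Y1.
have X0 : 0 < 2 * Y ^+ 6 by rewrite mulr_gt0// exprn_gt0.
pose W := expR (- (\sum_(p <- z) n1 p.2) / (2 * Y ^+ 6)) * eneg (2^-1%:E * tnrm z).
have W0 : 0 <= W by rewrite mulr_ge0 ?expR_ge0 ?eneg_ge0.
have W1 : W <= 1.
  rewrite -[leRHS]mulr1 ler_pM ?expR_ge0 ?eneg_ge0//.
    by rewrite expR_le1 mulNr oppr_le0 divr_ge0 ?(ltW X0)// sumr_ge0// => p _; exact: n1_ge0.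
  by rewrite eneg_le1// mule_ge0 ?tnrm_ge0// lee_fin invr_ge0.
pose f (p : point) := Num.min 1 (n1 p.2 / (2 * Y ^+ 6)) * W `^ (m.+1)%:R^-1.
have f0 p : 0 <= f p.
  by rewrite mulr_ge0 ?powR_ge0// le_min ler01 divr_ge0 ?n1_ge0// ltW.
have f1 p : f p <= 1.
  rewrite -[leRHS]mulr1 ler_pM ?powR_ge0//.
  - by rewrite le_min ler01 divr_ge0 ?n1_ge0// ltW.
  - by rewrite ge_min lexx.
  - by rewrite powR_le1 ?invr_ge0.
have -> : (\prod_(p <- z) qbd (Y ^+ 6) p.2) * eneg (2^-1%:E * tnrm z) = \prod_(p <- z) f p.
  rewrite /f big_split/= /qbd big_split/= -mulrA; congr (_ * _).
  rewrite [RHS]big_const_seq count_predT iter_mulr_1 sz -[RHS]powR_mulrn ?powR_ge0// -powRrM mulVf// powRr1//.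
  rewrite /W; congr (_ * _); rewrite -(expR_sum z xpredT (fun p => - (n1 p.2 / (2 * Y ^+ 6)))).
  by congr expR; rewrite mulNr mulr_suml sumrN.
have sep z1 p z2 r : z = z1 ++ p :: z2 -> 0 < r -> r <= B ->
    (forall p', p' \in z1 ++ z2 -> r <= `|tnth p'.1 l - tnth p.1 l|) ->
    f p <= ((C / Y) / r) `^ be.
  move=> zE r0 rB sepr.
  have pz : perm_eq z (p :: (z1 ++ z2)).
    by rewrite zE -cat1s -(cat1s _ (_ ++ _)) perm_catCA.
  have := HC Y l p (z1 ++ z2) r Y1 _ r0 rB sepr.
  rewrite -(perm_big _ pz)/= (_ : tnrm (p :: (z1 ++ z2)) = tnrm z); last first.
    by apply: eq_bigr => k _; apply/esym/snrm_perm.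
  rewrite -/W -/(f p) => h1.
  have {}h1 : f p <= C / Y / r.
    rewrite -mulrA -invfM; apply: h1 => q; rewrite -(perm_mem pz); exact: ad.
  (* Since f p <= 1, lowering its exponent to be <= 1 only weakens the bound; a small be is needed
     for integrability. *)
  apply: (@le_trans _ _ (f p `^ be)).
    have [->|fp0] := eqVneq (f p) 0; first exact: powR_ge0.
    by rewrite ger1_powR// f1 lt_neqAle eq_sym fp0 f0.
  by rewrite ge0_ler_powR ?nnegrE// !divr_ge0 ?ltW.
have CY : 0 < C / Y by rewrite divr_gt0.
have zB (p : point) : p \in z -> tnth p.1 l <= B.
  by move=> /ad[/(_ l)/andP[]].
apply: le_trans (prod_isolated B1 CY be0 f0 sorted_z zB sep) _.
rewrite sz ler_wpM2r ?gapD_ge0// -exprMn.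
rewrite ler_pXn2r ?nnegrE ?mulr_ge0 ?powR_ge0//.
rewrite powRM ?invr_ge0 ?(ltW C0) ?(ltW Yp)// le_eqVlt; apply/orP; left; apply/eqP.
have -> : Y^-1 `^ be = Y `^ (- be) by rewrite -powR_inv1 ?(ltW Yp)// -powRrM mulN1r.
by ring.
Qed.

End weights.

(** * Moments of the Cauchy-kernel averages *)

Section fubini_bound.
Local Open Scope ereal_scope.
Context d1 d2 (T1 : measurableType d1) (T2 : measurableType d2) (R : realType).
Variables (P : probability T1 R) (m2 : {sigma_finite_measure set T2 -> \bar R}).
Variables (f : T1 * T2 -> R) (g : T2 -> R).
Hypotheses (mf : measurable_fun setT f) (ig : m2.-integrable setT (EFin \o g)).
Hypothesis fg : forall w y, (`|f (w, y)| <= g y)%R.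

Let g0 y : (0 <= g y)%R.
Proof. exact: le_trans (fg point y). Qed.

Let mfE : measurable_fun setT (EFin \o f).
Proof. exact/measurable_EFinP. Qed.

Let intf : (P \x m2).-integrable setT (EFin \o f).
Proof.
apply/integrable12ltyP => //.
apply: (@le_lt_trans _ _ (\int[P]_x \int[m2]_y (g y)%:E)).
  apply: ge0_le_integralT => x _; first exact: integral_ge0.
  by apply: ge0_le_integralT => y _ //=; rewrite lee_fin.
pose c0 := \int[m2]_y (g y)%:E; rewrite -/c0.
rewrite (@integral_cst _ _ _ P setT measurableT c0).
rewrite [X in c0 * X](_ : _ = 1) ?mule1; last exact: probability_setT.
move/integrableP : ig => [_]; apply: le_lt_trans.
by apply: ge0_le_integralT => y; rewrite ?lee_fin//= ger0_norm.
Qed.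

Lemma integrable_section1 w : m2.-integrable setT (fun y => (f (w, y))%:E).
Proof.
apply: (le_integrable measurableT _ _ ig).
  apply/measurable_EFinP; apply: (measurableT_comp mf).
  exact: measurable_pair1.
by move=> y _; rewrite /= lee_fin (le_trans (fg w y))// ler_norm.
Qed.

Lemma integrable_section2 y : P.-integrable setT (fun w => (f (w, y))%:E).
Proof.
apply: (@le_integrable _ _ _ P setT measurableT _ (fun=> (g y)%:E)).
- apply/measurable_EFinP; apply: (measurableT_comp mf).
  exact: measurable_pair2.
- by move=> w _; rewrite /= lee_fin (le_trans (fg w y))// ler_norm.
- exact: finite_measure_integrable_cst.
Qed.

Lemma measurable_Rintegral_section : measurable_fun setT (fun w => (\int[m2]_y f (w, y))%R).
Proof.
apply: (measurableT_comp (fine_measurable measurableT)).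
exact: (measurable_fubini_F intf).
Qed.

(** [g] only justifies the exchange of integrals; the size comes from [U], which may be infinite on
    a null set. *)
Lemma fubini_bounded (U : T2 -> \bar R) (C : R) :
  (forall y, (`|\int[P]_w f (w, y)|%R)%:E <= U y) -> \int[m2]_y U y <= C%:E ->
  (`|\int[P]_w \int[m2]_y f (w, y)|%R <= C)%R.
Proof.
move=> fU UC.
have E : (\int[P]_w \int[m2]_y f (w, y))%R = fine (\int[m2]_y \int[P]_w (f (w, y))%:E).
  have <- := Fubini intf.
  congr fine; apply: eq_integral => w _; rewrite /= fineK//.
  exact: (integrable_fin_num measurableT (integrable_section1 w)).
have mG : measurable_fun setT (fun y => \int[P]_w (f (w, y))%:E).
  exact: (measurable_fubini_G intf).
rewrite E -lee_fin.
have bd : `|\int[m2]_y \int[P]_w (f (w, y))%:E| <= C%:E.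
  apply: le_trans UC; apply: le_trans (le_abse_integral _ measurableT mG) _.
  apply: ge0_le_integralT => y _ //; apply: le_trans (fU y).
  rewrite /Rintegral -{1}(fineK (integrable_fin_num measurableT (integrable_section2 y))).
  by [].
have fin : \int[m2]_y \int[P]_w (f (w, y))%:E \is a fin_num.
  by rewrite fin_num_abs (le_lt_trans bd)// ltry.
by move: bd; rewrite -{1}(fineK fin).
Qed.

End fubini_bound.

(** * Fourier representation of the kernel differences *)

Section fourier_difference.
Variables (R : realType) (d : nat).
Implicit Types (X : R) (xi : d.-tuple R) (y : 'I_d -> R).

Definition pkd X y : R := \prod_(i < d) pk X (y i).

Definition qkd X y : R := pkd (2 * X) y - pkd X y.

Definition qhat X xi : R :=
  (2 * pi) ^- d * (expabs (2 * X)^-1 xi - expabs X^-1 xi).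

Lemma expabsE lam xi : expabs lam xi = expR (- (lam * n1 xi)).
Proof.
rewrite /expabs -(expR_sum _ xpredT (fun i => - (lam * `|tnth xi i|))).
by congr expR; rewrite sumrN mulr_sumr.
Qed.

Lemma qhat_ge0 X xi : 0 < X -> 0 <= qhat X xi.
Proof.
move=> X0; rewrite mulr_ge0 ?invr_ge0 ?exprn_ge0 ?mulr_ge0 ?pi_ge0//.
rewrite subr_ge0 !expabsE ler_expR lerN2 ler_wpM2r ?n1_ge0//.
by rewrite lef_pV2 ?posrE ?mulr_gt0//; lra.
Qed.

(** exp(-t) - exp(-2t) = exp(-t) (1 - exp(-t)) with 1 - exp(-t) <= min(1, t), and (2 pi)^(-d) <=
    1. *)
Lemma qhat_le X xi : 0 < X -> qhat X xi <= qbd X xi.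
Proof.
move=> X0.
have h1 : (2 * pi) ^- d <= 1 :> R.
  rewrite invf_le1 ?exprn_gt0 ?mulr_gt0 ?pi_gt0// exprn_ege1//.
  by have := pi_ge2 R; lra.
apply: (@le_trans _ _ (expabs (2 * X)^-1 xi - expabs X^-1 xi)).
  rewrite /qhat ler_piMl//; have := qhat_ge0 xi X0; rewrite /qhat.
  by rewrite pmulr_rge0// invr_gt0 exprn_gt0 ?mulr_gt0 ?pi_gt0.
rewrite !expabsE /qbd [_^-1 * _]mulrC; set t := n1 xi / (2 * X).
have t0 : 0 <= t by rewrite divr_ge0 ?n1_ge0// mulr_ge0// ltW.
rewrite (_ : X^-1 * n1 xi = t + t); last by rewrite /t; field; rewrite gt_eqF.
rewrite opprD expRD -{1}[expR (- t)]mul1r -mulrBl ler_wpM2r ?expR_ge0//.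
rewrite le_min gerBl expR_ge0/=.
have := expR_ge1Dx (- t); lra.
Qed.

Lemma measurable_qhat X : measurable_fun [set: d.-tuple R] (qhat X).
Proof.
apply: measurable_funM => //.
by apply: measurable_funB; exact: measurable_expabs.
Qed.

Lemma integrable_expabs lam : 0 < lam ->
  (lebT R d).-integrable setT (fun xi => (expabs lam xi)%:E) /\
  (\int[lebT R d]_xi (expabs lam xi)%:E = ((2 / lam) ^+ d)%:E)%E.
Proof.
move=> l0.
have E : (\int[lebT R d]_xi (expabs lam xi)%:E = ((2 / lam) ^+ d)%:E)%E.
  have := fourierd (pi / 2) (fun _ : 'I_d => 0) l0; rewrite cos_pihalf mul0r addr0 => <-.
  apply: eq_integral => xi _; rewrite /dotp big1 ?add0r ?cos_pihalf ?addr0 ?mulr1//.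
  by move=> i _; rewrite mulr0.
split=> //; apply/integrableP; split.
  by apply/measurable_EFinP; exact: measurable_expabs.
under eq_integral do rewrite gee0_abs ?lee_fin ?expabs_ge0//.
by rewrite E ltry.
Qed.

Lemma fourier_expabs X c y : 0 < X ->
  (lebT R d).-integrable setT (fun xi => (expabs X^-1 xi * cos (dotp xi y + c))%:E) /\
  \int[lebT R d]_xi (expabs X^-1 xi * cos (dotp xi y + c)) =
  cos c * ((2 * pi) ^+ d * pkd X y).
Proof.
move=> X0; have l0 : 0 < X^-1 by rewrite invr_gt0.
have [i1 E1] := integrable_expabs l0.
have mc : measurable_fun [set: d.-tuple R] (fun xi => cos (dotp xi y + c)).
  apply: measurable_cosT; apply: measurable_funD => //.
  by apply: measurable_dotp => // i; exact: measurable_cst.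
have me := measurable_expabs X^-1 (@measurable_id _ (d.-tuple R) setT).
have i2 : (lebT R d).-integrable setT (fun xi => (expabs X^-1 xi * cos (dotp xi y + c))%:E).
  apply: (le_integrable measurableT _ _ i1).
    by apply/measurable_EFinP; exact: measurable_funM.
  move=> xi _; rewrite /= lee_fin normrM ler_piMr//.
  by rewrite ler_norml cos_geN1 cos_le1.
split=> //.
have := fourierd c y l0.
have -> : (\int[lebT R d]_xi (expabs X^-1 xi * (1 + cos (dotp xi y + c)))%:E =
  \int[lebT R d]_xi (expabs X^-1 xi)%:E +
  \int[lebT R d]_xi (expabs X^-1 xi * cos (dotp xi y + c))%:E)%E.
  rewrite -integralD//; apply: eq_integral => xi _.
  by rewrite -EFinD mulrDr mulr1.
rewrite E1 EFinD => /(congr1 fine)/=.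
rewrite -(fineK (integrable_fin_num measurableT i2)) -EFinD/= => /addrI.
rewrite /Rintegral => ->; congr (_ * _).
have -> : (2 * pi) ^+ d = \prod_(i < d) (2 * pi : R) by rewrite prodr_const card_ord.
rewrite /pkd -big_split/=; apply: eq_bigr => i _; rewrite pk_inv.
have D0 := oneDsqr_gt0 (X * y i); have p0 := pi_gt0 R.
have -> : X^-1 ^+ 2 + y i ^+ 2 = (1 + (X * y i) ^+ 2) / X ^+ 2.
  by field; rewrite gt_eqF.
move: (1 + _) D0 (pi : R) p0 => D D0 p p0.
by field; rewrite ?lt0r_neq0.
Qed.

(** The phase c carries the frequencies introduced earlier, so a product of kernel differences
    becomes, factor by factor, an integral of a single cosine; the sine part vanishes because [qhat]
    is even. *)
Lemma fourier_qhat X c y : 0 < X ->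
  \int[lebT R d]_xi (qhat X xi * cos (dotp xi y + c)) = cos c * qkd X y.
Proof.
move=> X0.
have [i1 E1] := fourier_expabs c y (mulr_gt0 (ltr0Sn R 1) X0).
have [i2 E2] := fourier_expabs c y X0.
have c0 : (2 * pi) ^+ d != 0 :> R by rewrite gt_eqF// exprn_gt0// mulr_gt0// pi_gt0.
transitivity (\int[lebT R d]_xi ((2 * pi) ^- d * (expabs (2 * X)^-1 xi * cos (dotp xi y + c)
   - expabs X^-1 xi * cos (dotp xi y + c)))).
  by apply: eq_Rintegral => xi _; rewrite /qhat; ring.
rewrite RintegralZl//; last exact: (integrableB measurableT i1 i2).
rewrite RintegralB// E1 E2 /qkd; by field.
Qed.

Lemma integrable_qhat X : 0 < X -> (lebT R d).-integrable setT (fun xi => (qhat X xi)%:E).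
Proof.
move=> X0.
have [i1 _] := integrable_expabs (lam := (2 * X)^-1) ltac:(by rewrite invr_gt0 mulr_gt0).
apply: (le_integrable measurableT _ _ i1).
  by apply/measurable_EFinP; exact: measurable_qhat.
move=> xi _; rewrite /= lee_fin [leRHS]ger0_norm ?expabs_ge0// ger0_norm ?qhat_ge0//.
rewrite /qhat ler_pdivrMl ?exprn_gt0 ?mulr_gt0 ?pi_gt0//.
apply: (@le_trans _ _ (expabs (2 * X)^-1 xi)); first by rewrite gerBl expabs_ge0.
rewrite ler_peMl ?expabs_ge0// exprn_ege1//.
by have := pi_ge2 R; lra.
Qed.

Lemma pkd_ge0 X y : 0 <= X -> 0 <= pkd X y.
Proof. by move=> X0; apply: prodr_ge0 => i _; exact: pk_ge0. Qed.

Lemma pkd_le X y : 0 <= X -> pkd X y <= X ^+ d.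
Proof.
move=> X0; have -> : X ^+ d = \prod_(i < d) X by rewrite prodr_const card_ord.
by apply: ler_prod => i _; rewrite pk_ge0//= pk_le.
Qed.

Lemma qkd_le X y : 0 <= X -> `|qkd X y| <= (2 * X) ^+ d + X ^+ d.
Proof.
move=> X0; apply: (le_trans (ler_normB _ _)).
by rewrite !ger0_norm ?pkd_ge0 ?mulr_ge0// lerD// pkd_le// mulr_ge0.
Qed.

Lemma measurable_pkd dT (T : measurableType dT) X (y : T -> 'I_d -> R) :
  (forall i, measurable_fun setT (fun t => y t i)) ->
  measurable_fun setT (fun t => pkd X (y t)).
Proof.
move=> my; apply: measurable_prod => i _.
exact: (measurableT_comp (measurable_pk X) (my i)).
Qed.

Lemma measurable_qkd dT (T : measurableType dT) X (y : T -> 'I_d -> R) :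
  (forall i, measurable_fun setT (fun t => y t i)) ->
  measurable_fun setT (fun t => qkd X (y t)).
Proof. by move=> my; apply: measurable_funB; exact: measurable_pkd. Qed.

End fourier_difference.

(** * Integrating out the frequency of the lowest remaining point *)

Section peel_density.
Variables (R : realType) (N d : nat) (alpha : R) (h : 'I_N -> N.-tuple R -> R) (c : R).
Hypotheses (al0 : 0 < alpha) (al2 : alpha <= 2) (c0 : 0 < c).
Local Notation leb := (@lebesgue_measure R).
Local Notation ker := (ker alpha h c).
Local Notation point := (N.-tuple R * d.-tuple R)%type.
Local Notation snrm := (snrm alpha h c).
Local Notation tnrm := (tnrm alpha h c).
Local Notation admissible := (admissible h).
Local Notation halfline l b e := (slab l `]b, +oo[ e).
Implicit Types (z : seq point) (s t : seq (N.-tuple R)) (y : N.-tuple R).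

Definition hnrm (D : set (N.-tuple R)) z : R := eneg (2^-1%:E * \sum_(k < d) snrm D z k)%E.

Lemma half_ge0 (x : \bar R) : (0 <= x -> 0 <= 2^-1%:E * x)%E.
Proof. by move=> x0; rewrite mule_ge0// lee_fin invr_ge0. Qed.

Lemma le_hnrm D z : measurable D -> eneg (2^-1%:E * tnrm z) <= hnrm D z.
Proof.
move=> mD; apply: le_eneg; first by rewrite half_ge0// sume_ge0// => k _; exact: snrm_ge0.
rewrite lee_wpmul2l ?lee_fin ?invr_ge0//; apply: lee_sum => k _.
apply: ge0_subset_integral => //; first exact: measurable_comb_powR.
Qed.

Lemma hnrm_cons z y xi l (b e : R) : 0 <= b < tnth y l ->
  hnrm (halfline l b e) ((y, xi) :: z) =
  (\prod_(k < d) eneg (2^-1%:E *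
     phia (lebT R N) alpha (slab l `]b, tnth y l] e) (comb alpha h c z k) (ker y) (tnth xi k))) *
  hnrm (halfline l (tnth y l) e) z.
Proof.
move=> /andP[b0 by_].
have E k : (snrm (halfline l b e) ((y, xi) :: z) k =
   phia (lebT R N) alpha (slab l `]b, tnth y l] e) (comb alpha h c z k) (ker y) (tnth xi k) +
   snrm (halfline l (tnth y l) e) z k)%E.
  have -> : halfline l b e = slab l `]b, tnth y l] e `|` halfline l (tnth y l) e.
    apply/seteqP; split => v.
      move=> [/=]; rewrite in_itv/= andbT => bv H; have [vy|vy] := leP (tnth v l) (tnth y l).
        by left; split => //; rewrite /= in_itv/= bv.
      by right; split => //; rewrite /= in_itv/= vy.
    move=> [[/=]|[/=]]; rewrite in_itv/= => H1 H2; split => //=; rewrite in_itv/= andbT.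
      by case/andP : H1.
    by move: H1; rewrite andbT; exact: lt_trans.
  have U := @ge0_integral_setU _ _ _ (lebT R N) _ _ (measurable_slab l e (measurable_itv `]b, tnth y l]))
    (measurable_slab l e (measurable_itv `]tnth y l, +oo[))
    (fun v => (`|comb alpha h c ((y, xi) :: z) k v| `^ alpha)%:E).
  transitivity (\int[lebT R N]_(v in slab l `]b, tnth y l] e) (`|comb alpha h c ((y, xi) :: z) k v| `^ alpha)%:E
    + \int[lebT R N]_(v in halfline l (tnth y l) e) (`|comb alpha h c ((y, xi) :: z) k v| `^ alpha)%:E)%E.
    apply: U.
    - by apply: measurable_funTS; exact: measurable_comb_powR.
    - by move=> v _; rewrite lee_fin powR_ge0.
    - apply/disj_set2P; rewrite -subset0 => v [[/=]].
      by rewrite !in_itv/= => /andP[_ vy] _ [/=]; rewrite in_itv/= andbT ltNge vy.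
  apply: (f_equal2 (fun a b : \bar R => a + b)%E).
    by apply: eq_integral => v _; rewrite /comb big_cons.
  apply: eq_integral => v; rewrite inE => sv; have := sv => -[/=].
  rewrite in_itv/= andbT => yv _; rewrite /comb big_cons/=.
  rewrite (ker_above _ _ _ sv) ?mulr0 ?add0r//; last exact: ltW.
  by rewrite (le_trans b0)// ltW// (lt_trans by_).
pose A k := phia (lebT R N) alpha (slab l `]b, tnth y l] e) (comb alpha h c z k) (ker y) (tnth xi k).
transitivity (eneg (2^-1%:E * \sum_(k < d) (A k + snrm (halfline l (tnth y l) e) z k))%E).
  by apply: (f_equal (fun a => eneg (2^-1%:E * a)%E)); apply: eq_bigr => k _; exact: E.
rewrite /hnrm.
have p0 k : (0 <= 2^-1%:E * phia (lebT R N) alpha (slab l `]b, tnth y l] e)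
   (comb alpha h c z k) (ker y) (tnth xi k))%E by rewrite half_ge0// phia_ge0.
rewrite big_split/= ge0_muleDr; last 2 first.
- by apply: sume_ge0 => k _; exact: phia_ge0.
- by apply: sume_ge0 => k _; exact: snrm_ge0.
rewrite enegD.
- congr (_ * _); rewrite ge0_sume_distrr; last by move=> k _; exact: phia_ge0.
  exact: eneg_sum.
- by rewrite half_ge0// sume_ge0// => k _; exact: phia_ge0.
- by rewrite half_ge0// sume_ge0// => k _; exact: snrm_ge0.
Qed.

(** The d components separate, and for each one [integral_eneg_phia] applies with r of order (y_l -
    b)^(h_l y), bounded below by [ker_lower]; the points in [z] enter only through its irrelevant
    shift [f]. *)
Lemma integral_hnrm_cons (B e : R) : 1 <= B -> B^-1 <= e ->
  exists2 C, 0 < C & forall z y l b H, admissible B e y -> 0 <= b < tnth y l ->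
  h l y <= H -> H <= 1 ->
  (\int[lebT R d]_xi (hnrm (halfline l b e) ((y, xi) :: z))%:E <=
   (C * (tnth y l - b) `^ (- (d%:R * H)) * hnrm (halfline l (tnth y l) e) z)%:E)%E.
Proof.
move=> B1 Be.
have B0 : 0 < B by apply: lt_le_trans B1.
have [c2 c20 Hk] := ker_lower h al0 al2 c0 B1 Be.
have [K K0 HK] := integral_eneg_phia (lebT R N) al0 al2.
have D0 : 0 < K * B / c2 by rewrite divr_gt0// mulr_gt0.
exists ((K * B / c2) ^+ d); first by rewrite exprn_gt0.
move=> z y l b H ady /andP[b0 by_] hH H1.
have g0 : 0 < tnth y l - b by rewrite subr_gt0.
set g := tnth y l - b in g0 *.
have gB : g <= B by rewrite /g; have /andP[_] := ady.1 l; lra.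
have h01 := ady.2 l.
set G := hnrm _ z.
have G0 : 0 <= G by exact: eneg_ge0.
pose F k a := (eneg (2^-1%:E *
     phia (lebT R N) alpha (slab l `]b, tnth y l] e) (comb alpha h c z k) (ker y) a))%:E.
have mF k : measurable_fun setT (F k).
  apply/measurable_EFinP; apply: measurable_eneg; apply: emeasurable_funM => //.
  apply: measurable_phia => //; first exact: measurable_slab.
  exact: measurable_comb.
  exact: measurable_ker.
have F0 k a : (0 <= F k a)%E by rewrite lee_fin eneg_ge0.
have FK k : (\int[leb]_a F k a <= (K * B / c2 * g `^ (- H))%:E)%E.
  have r0 : 0 < c2 * g `^ (h l y) by rewrite mulr_gt0 ?powR_gt0.
  apply: (@le_trans _ _ (K / (c2 * g `^ (h l y)))%:E).
    apply: HK => //; first exact: measurable_slab.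
    exact: measurable_comb.
    exact: measurable_ker.
    by apply: Hk; [exact: ady.1|exact: ady.2|rewrite b0].
  rewrite lee_fin invfM mulrA (_ : K * B / c2 * g `^ (- H) = K / c2 * (B * g `^ (- H))); last by ring.
  rewrite ler_pM2l ?divr_gt0// powRN ler_pdivlMr ?powR_gt0// mulrC ler_pdivrMr ?powR_gt0//.
  (* Dividing by B makes the gap at most 1, where replacing h by the larger H goes in the right
     direction. *)
  have -> : g `^ H = (g / B) `^ H * B `^ H by rewrite -powRM ?divfK ?gt_eqF// ?divr_ge0 ?ltW.
  have -> : g `^ h l y = (g / B) `^ (h l y) * B `^ (h l y).
    by rewrite -powRM ?divfK ?gt_eqF// ?divr_ge0 ?ltW.
  have gB1 : g / B <= 1 by rewrite ler_pdivrMr// mul1r.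
  have gB0 : 0 < g / B by rewrite divr_gt0.
  apply: (@le_trans _ _ ((g / B) `^ (h l y) * B)).
    apply: ler_pM; rewrite ?powR_ge0//.
      by rewrite ger_powR// gB0.
    by rewrite -[leRHS]powRr1 ?(ltW B0)// ler_powR.
  rewrite mulrC ler_pM2l// ler_peMr ?powR_ge0//.
  by rewrite -(powRr0 B) ler_powR//; case/andP : h01 => /ltW.
have E xi : ((hnrm (halfline l b e) ((y, xi) :: z))%:E =
   G%:E * \big[*%E/1%E]_(k < d) F k (tnth xi k))%E.
  rewrite hnrm_cons ?b0// -/G mulrC EFinM; congr (_ * _)%E.
  by rewrite (big_morph EFin (id1 := 1%E) (op1 := *%E)).
under eq_integral do rewrite E.
rewrite ge0_integralZl//; last 2 first.
- apply: measurable_prode => k; apply: (measurableT_comp (mF k)); exact: measurable_tnth.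
- by move=> xi _; exact: prode_ge0.
rewrite integral_lebT_prod// [leRHS]EFinM muleC lee_wpmul2r ?lee_fin//.
have -> : (K * B / c2) ^+ d * g `^ (- (d%:R * H)) = \prod_(k < d) (K * B / c2 * g `^ (- H)).
  rewrite [RHS]prodr_const card_ord [RHS]exprMn; apply: (f_equal2 *%R) => //.
  by rewrite -powR_mulrn ?powR_ge0// -powRrM; congr (_ `^ _); ring.
rewrite (big_morph EFin (id1 := 1%E) (op1 := *%E))//.
pose I k := (\int[leb]_a F k a)%E.
suff : (0 <= \big[*%E/1%E]_(k < d) I k <=
  \big[*%E/1%E]_(k < d) (K * B / c2 * g `^ (- H))%:E)%E by case/andP.
elim/big_ind2 : _ => //.
- by rewrite lexx lee_fin ler01.
- move=> x1 x2 y1 y2 /andP[? ?] /andP[? ?]; rewrite mule_ge0//=.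
  exact: lee_pmul.
- by move=> k _; apply/andP; split; [exact: integral_ge0|exact: FK].
Qed.

End peel_density.

Lemma integrable_bounded (R : realType) dT (T : measurableType dT)
    (P : probability T R) (f : T -> R) (C : R) :
  measurable_fun setT f -> (forall w, `|f w| <= C) -> P.-integrable setT (EFin \o f).
Proof.
move=> mf fC; apply: measurable_bounded_integrable => //.
  by rewrite [X in (X < _)%E](_ : _ = 1%E) ?ltry//; exact: probability_setT.
by exists C; split; [rewrite num_real|move=> r Cr w _; apply: le_trans (fC w) (ltW Cr)].
Qed.

Section peel_process.
Context (R : realType) (dO : measure_display) (Omega : measurableType dO).
Variables (P : probability Omega R) (N d : nat) (alpha : R) (h : 'I_N -> N.-tuple R -> R) (c : R).
Variable X : 'I_d -> Omega -> N.-tuple R -> R.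
Hypotheses (al0 : 0 < alpha) (al2 : alpha <= 2) (c0 : 0 < c).
Hypothesis mX : forall k s, measurable_fun setT (fun w => X k w s).
Hypothesis HX : is_LMSS P alpha h c X.
Variable x : 'I_d -> R.
Local Notation point := (N.-tuple R * d.-tuple R)%type.
Local Notation tnrm := (tnrm alpha h c).
Local Notation hnrm := (hnrm alpha h c).
Local Notation admissible := (admissible h).
Local Notation halfline l b e := (slab l `]b, +oo[ e).
Implicit Types (z : seq point) (s t : seq (N.-tuple R)) (y : N.-tuple R) (w : Omega).

Definition incr w y : 'I_d -> R := fun k => X k w y - x k.

Definition phase w z : R := \sum_(p <- z) dotp p.2 (incr w p.1).

Definition prodq q w s : R := \prod_(y <- s) qkd q (incr w y).

Lemma measurable_incr y k : measurable_fun setT (fun w => incr w y k).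
Proof. by apply: measurable_funB => //; exact: mX. Qed.

Lemma measurable_phase z : measurable_fun setT (fun w => phase w z).
Proof.
apply: measurable_sum => p; apply: measurable_dotp => //.
by move=> k; exact: measurable_incr.
Qed.

Lemma measurable_prodq q s : measurable_fun setT (fun w => prodq q w s).
Proof.
rewrite /prodq; elim: s => [|y s IH].
  by under eq_fun do rewrite big_nil; exact: measurable_cst.
under eq_fun do rewrite big_cons.
apply: measurable_funM => //; apply: measurable_qkd => k; exact: measurable_incr.
Qed.

Lemma prodq_le q w s : 0 <= q -> `|prodq q w s| <= ((2 * q) ^+ d + q ^+ d) ^+ size s.
Proof.
move=> q0; rewrite /prodq; elim: s => [|y s IH]; first by rewrite big_nil normr1.
by rewrite big_cons normrM exprS ler_pM// qkd_le.
Qed.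

(** Centring at x only shifts the phase by a constant; by the addition formula the cosine part gets
    a factor of modulus at most 1 and the sine part integrates to 0. *)
Lemma cos_phase_le z : (forall p, p \in z -> nonneg_pt p.1) ->
  `|\int[P]_w cos (phase w z)| <= eneg (tnrm z).
Proof.
move=> nz; pose pt (j : 'I_(size z)) := tnth (in_tuple z) j.
have [] := HX (u := fun j => (pt j).1) (fun j k => tnth (pt j).2 k).
  by move=> j; apply: nz; exact: mem_tnth.
pose S w := \sum_(j < size z) \sum_(k < d) tnth (pt j).2 k * X k w (pt j).1.
pose sh := \sum_(p <- z) dotp p.2 x.
have SE w : phase w z = S w - sh.
  rewrite /S /sh /phase -(big_tnth _ _ z xpredT (fun p => \sum_(k < d) tnth p.2 k * X k w p.1)).
  rewrite -sumrB; apply: eq_bigr => p _; rewrite /dotp -sumrB; apply: eq_bigr => k _.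
  by rewrite mulrBr.
have mS : measurable_fun setT S.
  rewrite (_ : S = fun w => phase w z + sh); last by apply/funext => w; rewrite SE subrK.
  by apply: measurable_funD => //; exact: measurable_phase.
have mc : measurable_fun setT (fun w => cos (S w)) by exact: measurable_cosT.
have ms : measurable_fun setT (fun w => sin (S w)).
  by apply: (measurableT_comp _ mS); apply: continuous_measurable_fun; exact: continuous_sin.
have ic : P.-integrable setT (EFin \o (fun w => cos (S w))).
  by apply: (@integrable_bounded _ _ _ P _ 1) => // w; rewrite ler_norml cos_geN1 cos_le1.
have is_ : P.-integrable setT (EFin \o (fun w => sin (S w))).
  by apply: (@integrable_bounded _ _ _ P _ 1) => // w; rewrite ler_norml sin_geN1 sin_le1.
move=> Ec Es.
have -> : \int[P]_w cos (phase w z) = cos sh * \int[P]_w cos (S w) + sin sh * \int[P]_w sin (S w).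
  rewrite -!RintegralZl// -RintegralD//.
  - by apply: eq_Rintegral => w _; rewrite SE cosB mulrC [X in _ + X]mulrC.
  - exact: (integrableZl measurableT (cos sh) ic).
  - exact: (integrableZl measurableT (sin sh) is_).
have -> : \int[P]_w cos (S w) = eneg (tnrm z).
  rewrite /Rintegral Ec /eneg; congr (fine (expeR (- _))); apply: eq_bigr => k _.
  transitivity (lebN (fun v => (`|comb alpha h c z k v| `^ alpha)%:E)).
    apply: (f_equal (@lebN R N)); apply/funext => v; apply: (f_equal (fun a => (`|a| `^ alpha)%:E)).
    by rewrite -(big_tnth _ _ z xpredT (fun p => tnth p.2 k * (c * lmss_kernel alpha h p.1 v))).
  by apply: lebN_integral; [exact: measurable_comb_powR|move=> v; rewrite lee_fin powR_ge0].
have -> : \int[P]_w sin (S w) = 0 by rewrite /Rintegral Es.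
rewrite mulr0 addr0 normrM [X in _ * X]ger0_norm ?eneg_ge0// ler_piMl ?eneg_ge0//.
by rewrite ler_norml cos_geN1 cos_le1.
Qed.

Lemma qbd_ge0 q (xi : d.-tuple R) : 0 < q -> 0 <= qbd q xi.
Proof.
move=> q0; rewrite mulr_ge0 ?expR_ge0// le_min ler01/= divr_ge0 ?n1_ge0//.
by rewrite mulr_ge0// ltW.
Qed.

Lemma prod_qbd_ge0 q z : 0 < q -> 0 <= \prod_(p <- z) qbd q p.2.
Proof. by move=> q0; apply: prodr_ge0 => p _; exact: qbd_ge0. Qed.

Lemma gapD_rcons be b (g : seq R) (y : R) :
  gapD be b (rcons g y) = gapD be b g * (y - last b g) `^ (- be).
Proof. by elim: g b => [|a g IH] b /=; rewrite ?mulr1 ?mul1r// IH mulrA. Qed.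

Lemma le_last_path (b : R) (g : seq R) : path <%R b g -> b <= last b g.
Proof. by elim: g b => //= a g IH b /andP[/ltW ba] /IH; exact: le_trans. Qed.

Lemma measurable_hnrm_cons z y l (b e : R) : 0 <= b < tnth y l ->
  measurable_fun setT (fun xi : d.-tuple R => hnrm (halfline l b e) ((y, xi) :: z)).
Proof.
move=> by_; under eq_fun do rewrite hnrm_cons//.
apply: measurable_funM => //; apply: measurable_prod => k _.
apply: measurable_eneg; apply: emeasurable_funM => //.
apply: (measurableT_comp _ (measurable_tnth k)).
apply: measurable_phia => //; first exact: measurable_slab.
- exact: measurable_comb.
- exact: measurable_ker.
Qed.

(* Each factor is written as a Fourier integral and integrated out from the
   largest coordinate downwards: only the last kernel lives on the top slab. *)
Lemma peel_bound_of (B e C : R) : 1 <= B -> B^-1 <= e -> 0 < C ->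
  (forall z y l b H, admissible B e y -> 0 <= b < tnth y l -> h l y <= H -> H <= 1 ->
    (\int[lebT R d]_xi (hnrm (halfline l b e) ((y, xi) :: z))%:E <=
     (C * (tnth y l - b) `^ (- (d%:R * H)) * hnrm (halfline l (tnth y l) e) z)%:E)%E) ->
  forall q l H (A : R) (full : seq (N.-tuple R)), 0 < q -> H <= 1 ->
  (forall y, y \in full -> admissible B e y /\ h l y <= H) ->
  path <%R 0 (map (fun y => tnth y l) full) ->
  (forall z, map fst z = full ->
     (\prod_(p <- z) qbd q p.2) * eneg (2^-1%:E * tnrm z) <= A) ->
  `|\int[P]_w prodq q w full| <=
    A * C ^+ size full * gapD (d%:R * H) 0 (map (fun y => tnth y l) full).
Proof.
move=> B1 Be C0 HC q l H A full q0 H1 adf sorted_full HA.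
have e0 : 0 < e by apply: lt_le_trans Be; rewrite invr_gt0 (lt_le_trans _ B1).
pose co y := tnth y l.
  have A0 : 0 <= A.
    pose z1 := map (fun y => (y, [tuple (0 : R) | k < d])) full.
    apply: le_trans (HA z1 _).
      by rewrite mulr_ge0 ?eneg_ge0 ?prod_qbd_ge0.
    by rewrite -map_comp map_id_in.
(* Invariant: [s] holds the points not yet expanded, [z] the higher ones with frozen frequencies.
   The weights and one half of the exponent are reserved for A; the other half, restricted to the
   slab above the last point of [s], remains as [hnrm]. *)
have main s z : s ++ map fst z = full ->
   `|\int[P]_w (prodq q w s * cos (phase w z))| * (\prod_(p <- z) qbd q p.2) <=
   A * C ^+ size s * gapD (d%:R * H) 0 (map co s) *
     hnrm (halfline l (last 0 (map co s)) e) z.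
  elim/last_ind: s z => [|s y IH] z zE.
    rewrite /= expr0 !mulr1; under eq_Rintegral do rewrite /prodq big_nil mul1r.
    have nz p : p \in z -> nonneg_pt p.1.
      move=> pz i; have /adf[[/(_ i)/andP[+ _] _] _] : p.1 \in full.
        by rewrite -zE map_f.
      by apply: le_trans; rewrite mulr_ge0// ltW.
    have Q0 := prod_qbd_ge0 z q0.
    apply: (@le_trans _ _ (eneg (tnrm z) * \prod_(p <- z) qbd q p.2)).
      by rewrite ler_wpM2r// cos_phase_le.
    (* All points are expanded: one half of the exponent goes with the weights into A, the other is
       restricted to the slab above 0. *)
    rewrite eneg_half ?tnrm_ge0// mulrAC.
    apply: ler_pM; rewrite ?mulr_ge0 ?eneg_ge0//.
      by rewrite mulrC HA.
    by apply: le_hnrm; exact: measurable_slab.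
  set Q := \prod_(p <- z) _.
  have Q0 : 0 <= Q by exact: prod_qbd_ge0.
  have yf : y \in full by rewrite -zE mem_cat mem_rcons mem_head.
  have [ady hy] := adf _ yf.
  have b0y : 0 <= last 0 (map co s) < tnth y l.
    move: sorted_full; rewrite -zE map_cat map_rcons cat_rcons cat_path/= => /and3P[ps + _].
    by move=> ->; rewrite andbT le_last_path.
  set b := last 0 _ in IH b0y.
  rewrite size_rcons map_rcons last_rcons gapD_rcons -/b -/(co y).
  (* The factor of y is replaced by its Fourier integral, which adds (y, xi) to the phase. *)
  have -> : \int[P]_w (prodq q w (rcons s y) * cos (phase w z)) =
     \int[P]_w \int[lebT R d]_xi (prodq q w s * (qhat q xi * cos (phase w ((y, xi) :: z)))).
    apply: eq_Rintegral => w _.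
    rewrite RintegralZl//; last first.
      apply: (le_integrable measurableT _ _ (integrable_qhat d q0)).
        apply/measurable_EFinP; apply: measurable_funM; first exact: measurable_qhat.
        apply: measurable_cosT; rewrite /phase; under eq_fun do rewrite big_cons.
        have md : measurable_fun setT (fun xi : d.-tuple R => dotp xi (incr w y)).
          by apply: measurable_dotp => // k; exact: measurable_cst.
        exact: (measurable_funD md (measurable_cst (phase w z))).
      move=> xi _; rewrite /= lee_fin normrM ler_piMr//.
      by rewrite ler_norml cos_geN1 cos_le1.
    under eq_Rintegral do rewrite /phase big_cons/=.
    rewrite fourier_qhat// /prodq -cats1 big_cat/= big_seq1 -mulrA; congr (_ * _).
    by rewrite mulrC.
  (* [qbd] is 0 at frequency 0, and the argument below divides by Q. *)
  have [Qz|Qz] := eqVneq Q 0.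
    rewrite Qz mulr0.
    by rewrite !mulr_ge0 ?gapD_ge0 ?powR_ge0 ?eneg_ge0 ?exprn_ge0 ?(ltW C0).
  have Qp : 0 < Q by rewrite lt_neqAle eq_sym Qz Q0.
  rewrite -ler_pdivlMr//.
  set Cs := A * C ^+ size s * gapD (d%:R * H) 0 (map co s) in IH.
  have Cs0 : 0 <= Cs by rewrite !mulr_ge0 ?gapD_ge0 ?exprn_ge0 ?(ltW C0).
  pose F (p : Omega * d.-tuple R) : R :=
    prodq q p.1 s * (qhat q p.2 * cos (phase p.1 ((y, p.2) :: z))).
  pose M := ((2 * q) ^+ d + q ^+ d) ^+ size s.
  apply: (@fubini_bounded _ _ _ _ _ P (lebT R d) F (fun xi => M * qhat q xi) _ _ _
    (fun xi => (Cs / Q * hnrm (halfline l b e) ((y, xi) :: z))%:E)).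
  - apply: measurable_funM.
      exact: (measurableT_comp (measurable_prodq q s)).
    apply: measurable_funM.
      exact: (measurableT_comp (@measurable_qhat R d q)).
    apply: measurable_cosT; rewrite /phase; under eq_fun do rewrite big_cons.
    apply: measurable_funD => //.
      apply: measurable_dotp; first exact: measurable_snd.
      by move=> k; exact: (measurableT_comp (measurable_incr y k)).
    exact: (measurableT_comp (measurable_phase z)).
  - exact: (integrableZl measurableT M (integrable_qhat d q0)).
  - move=> w xi; rewrite /F/= normrM; apply: ler_pM => //; first by rewrite prodq_le// ltW.
    rewrite normrM ger0_norm ?qhat_ge0// ler_piMr ?qhat_ge0//.
    by rewrite ler_norml cos_geN1 cos_le1.
  (* The induction hypothesis carries the weight [qbd], which absorbs [qhat] by [qhat_le]. *)
  - move=> xi; rewrite lee_fin /F/= mulrAC ler_pdivlMr//.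
    have zE' : s ++ map fst ((y, xi) :: z) = full by rewrite -zE cat_rcons.
    apply: le_trans (IH _ zE'); rewrite big_cons -/Q [leRHS]mulrA ler_wpM2r//=.
    have -> : \int[P]_w (prodq q w s * (qhat q xi * cos (phase w ((y, xi) :: z)))) =
       qhat q xi * \int[P]_w (prodq q w s * cos (phase w ((y, xi) :: z))).
      rewrite -RintegralZl//.
        by apply: eq_Rintegral => w _; rewrite mulrCA.
      apply: (@integrable_bounded _ _ _ P _ M).
        apply: measurable_funM; first exact: measurable_prodq.
        by apply: measurable_cosT; exact: measurable_phase.
      move=> w; rewrite normrM -[leRHS]mulr1; apply: ler_pM => //.
        by rewrite prodq_le// ltW.
      by rewrite ler_norml cos_geN1 cos_le1.
    rewrite normrM ger0_norm ?qhat_ge0// mulrC ler_wpM2l// qhat_le//.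
  - under eq_integral do rewrite EFinM.
    rewrite ge0_integralZl_EFin ?divr_ge0//; last 2 first.
    + by move=> xi _; rewrite lee_fin eneg_ge0.
    + by apply/measurable_EFinP; exact: measurable_hnrm_cons.
    apply: (@le_trans _ _ ((Cs / Q)%:E * (C * (co y - b) `^ (- (d%:R * H)) *
       hnrm (halfline l (co y) e) z)%:E)%E).
      rewrite lee_wpmul2l ?lee_fin ?divr_ge0//; exact: HC.
    rewrite -EFinM lee_fin le_eqVlt; apply/orP; left; apply/eqP.
    by rewrite exprS /Cs; field.
have := main full [::]; rewrite cats0 => /(_ erefl).
rewrite big_nil mulr1.
rewrite (_ : hnrm _ [::] = 1) ?mulr1; last first.
  rewrite /hnrm big1 ?mule0 ?eneg0// => k _; rewrite /snrm integral0_eq// => v _.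
  by rewrite /comb big_nil normr0 powR0// gt_eqF.
apply: le_trans; rewrite le_eqVlt; apply/orP; left; apply/eqP; congr (`|_|).
by apply: eq_Rintegral => w _; rewrite /phase big_nil cos0 mulr1.
Qed.

End peel_process.

(** * Gap products bounded without ordering the points *)

Section insertion.
Variable R : realType.
Implicit Types (be b x y : R) (s t : seq R).

Fixpoint ins x t : seq R :=
  if t is y :: t' then (if x < y then x :: y :: t' else y :: ins x t') else [:: x].

Lemma perm_ins x t : perm_eq (ins x t) (x :: t).
Proof.
elim: t => //= y t IH; case: ifP => // _.
by rewrite (perm_trans (y := y :: x :: t)) ?perm_cons// -(cat1s y) -(cat1s x) perm_catCA.
Qed.

Lemma path_ins b x t : b < x -> x \notin t -> path <%R b t -> path <%R b (ins x t).
Proof.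
elim: t b => [|y t IH] b /= bx; first by rewrite bx.
rewrite inE negb_or => /andP[xy xt] /andP[by_ yt].
have [xly|yx] := ltP x y; rewrite /= ?bx ?xly// by_ IH//.
by rewrite lt_neqAle eq_sym xy.
Qed.

(* Inserting [x] into a sorted sequence [s] multiplies the gap product [gapD]
   by at most [dsum be x s], which is symmetric in [s]: no integration over
   ordered simplices is needed. *)
Definition dsum be x s : R := 2 * \sum_(p <- s) `|x - p| `^ (- be).

Lemma dsum_ge0 be x s : 0 <= dsum be x s.
Proof. by rewrite mulr_ge0// sumr_ge0// => p _; exact: powR_ge0. Qed.

(** The larger of x and y is at least (x + y)/2, so its power -be is at most 2 (x + y)^(-be); the
    smaller one remains as a summand. *)
Lemma powR_mul_split be x y : 0 < x -> 0 < y -> 0 <= be -> be <= 1 ->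
  x `^ (- be) * y `^ (- be) <= (x + y) `^ (- be) * (2 * (x `^ (- be) + y `^ (- be))).
Proof.
move=> + + be0 be1; wlog xy : x y / x <= y.
  move=> W x0 y0; have [xy|/ltW yx] := leP x y; first exact: W.
  by rewrite mulrC [x + y]addrC [_ `^ _ + _]addrC W.
move=> x0 y0.
have h2 : y `^ (- be) <= (x + y) `^ (- be) * 2.
  rewrite !powRN ler_pdivlMl ?powR_gt0 ?addr_gt0// ler_pdivrMr ?powR_gt0//.
  apply: (@le_trans _ _ ((2 * y) `^ be)).
    by rewrite ge0_ler_powR ?nnegrE//; lra.
  rewrite powRM ?(ltW y0)// ler_pM2r ?powR_gt0//.
  by rewrite -[leRHS]powRr1// ler_powR// ler1n.
apply: (@le_trans _ _ (x `^ (- be) * ((x + y) `^ (- be) * 2))).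
  by rewrite ler_wpM2l ?powR_ge0.
rewrite mulrCA ler_wpM2l ?powR_ge0// mulrC ler_pM2l// lerDl powR_ge0//.
Qed.

(** Insertion splits one gap into two, and [powR_mul_split] restores the old gap times distances
    from x to its neighbours; adding distances to further points only increases the bound. *)
Lemma gapD_ins be b x t : 0 <= be -> be <= 1 -> b < x -> x \notin t -> path <%R b t ->
  gapD be b (ins x t) <= gapD be b t * dsum be x (b :: t).
Proof.
move=> be0 be1; elim: t b => [|y t IH] b /= bx.
  move=> _ _; rewrite !mulr1 mul1r /dsum big_seq1 ger0_norm ?subr_ge0 ?(ltW bx)//.
  by have := powR_ge0 (x - b) (- be); lra.
rewrite inE negb_or => /andP[xy xt] /andP[by_ yt].
have [xly|yx] := ltP x y.
  rewrite /= mulrA.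
  apply: (@le_trans _ _ ((y - b) `^ (- be) * (2 * ((x - b) `^ (- be) + (y - x) `^ (- be))) * gapD be y t)).
    rewrite ler_wpM2r ?gapD_ge0// (_ : y - b = (x - b) + (y - x)); last by ring.
    by rewrite powR_mul_split ?subr_gt0.
  rewrite [leLHS]mulrAC ler_wpM2l ?mulr_ge0 ?powR_ge0 ?gapD_ge0// /dsum ler_pM2l//.
  rewrite !big_cons addrA ger0_norm ?subr_ge0 ?(ltW bx)//.
  rewrite [`|x - y|]distrC ger0_norm ?subr_ge0 ?(ltW xly)// lerDl sumr_ge0//.
have yx' : y < x by rewrite lt_neqAle eq_sym xy.
rewrite /= -mulrA ler_wpM2l ?powR_ge0//; apply: le_trans (IH y yx' xt yt) _.
rewrite ler_wpM2l ?gapD_ge0// /dsum ler_pM2l// [leRHS]big_cons lerDr.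
exact: powR_ge0.
Qed.

(** Majorant of the gap product of the sorted list, built by successive insertions in the given
    order. Its head variable occurs in a single factor and can be integrated out first. *)
Fixpoint Bd be s : R := if s is x :: s' then Bd be s' * dsum be x (0 :: s') else 1.

Lemma sorted_gapD s : uniq s -> {in s, forall x, 0 < x} ->
  exists t, [/\ perm_eq t s, path <%R 0 t &
    forall be, 0 <= be -> be <= 1 -> gapD be 0 t <= Bd be s].
Proof.
elim: s => [|x s IH] /=; first by exists [::].
move=> /andP[xs us] s0.
have [|t [ts pt tB]] := IH us; first by move=> y ys; apply: s0; rewrite inE ys orbT.
have x0 : 0 < x by apply: s0; exact: mem_head.
have xt : x \notin t by rewrite (perm_mem ts).
exists (ins x t); split.
- by rewrite (perm_trans (perm_ins x t)) ?perm_cons.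
- exact: path_ins.
- move=> be be0 be1; apply: le_trans (gapD_ins be0 be1 x0 xt pt) _.
  apply: ler_pM; rewrite ?gapD_ge0 ?dsum_ge0 ?tB//.
  rewrite /dsum ler_pM2l// !big_cons lerD2l.
  by rewrite (perm_big _ ts).
Qed.

Lemma gapD_powR be b t th : gapD be b t `^ th = gapD (be * th) b t.
Proof.
elim: t b => [|y t IH] b /=; first by rewrite powR1.
by rewrite powRM ?powR_ge0 ?gapD_ge0// IH -powRrM mulNr.
Qed.

End insertion.

(** * Multipoint bound: geometric mean over the coordinates *)

Section multipoint.
Context (R : realType) (dO : measure_display) (Omega : measurableType dO).
Variables (P : probability Omega R) (N d : nat) (alpha : R) (h : 'I_N -> N.-tuple R -> R) (c : R).
Variable X : 'I_d -> Omega -> N.-tuple R -> R.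
Hypotheses (al0 : 0 < alpha) (al2 : alpha <= 2) (c0 : 0 < c).
Hypothesis mX : forall k s, measurable_fun setT (fun w => X k w s).
Hypothesis HX : is_LMSS P alpha h c X.
Local Notation admissible := (admissible h).
Local Notation coord l s := (map (fun y : N.-tuple R => tnth y l) s).
Implicit Types (s t : seq (N.-tuple R)) (y : N.-tuple R) (w : Omega).

(** Both halves of the exponent are used along the same coordinate l: isolation gives the gap
    exponent be + be, the frequency integrals give d H. *)
Lemma prodq_line (B e be : R) m : 1 <= B -> B^-1 <= e -> 0 <= be -> be <= 1 ->
  exists2 C, 0 < C & forall x Y l H s, 1 <= Y -> H <= 1 -> size s = m ->
  (forall y, y \in s -> admissible B e y /\ h l y <= H) ->
  path <%R 0 (coord l s) ->
  `|\int[P]_w prodq X x (Y ^+ 6) w s| <=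
    C * (Y `^ (- be)) ^+ m * gapD (be + be + d%:R * H) 0 (coord l s).
Proof.
move=> B1 Be be0 be1.
have [C1 C10 H1] := weight_product d h al0 al2 c0 m B1 Be be0 be1.
have [C2 C20 H2] := integral_hnrm_cons d h al0 al2 c0 B1 Be.
exists (C1 * C2 ^+ m); first by rewrite mulr_gt0 ?exprn_gt0.
move=> x Y l H s Y1 HH sm ads ps.
have Y0 : 0 < Y ^+ 6 by rewrite exprn_gt0// (lt_le_trans _ Y1).
have := peel_bound_of al0 mX HX x B1 Be C20 H2 Y0 HH (A := C1 * (Y `^ (- be)) ^+ m * gapD (be + be) 0 (coord l s)) ads ps.
move=> /(_ _)/le_trans; apply.
  move=> z zs.
  have E : coord l s = map (fun p => tnth p.1 l) z by rewrite -zs -map_comp.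
  rewrite E; apply: H1 => //.
  - by rewrite -sm -zs size_map.
  - by move=> p pz; have [] := ads p.1; rewrite // -zs map_f.
  - by rewrite -E.
rewrite sm -(gapDD (be + be) (d%:R * H) ps) le_eqVlt; apply/orP; left; apply/eqP; ring.
Qed.

Lemma prod_powR n (a : R) (th : 'I_n -> R) : 0 < a ->
  \prod_l a `^ th l = a `^ (\sum_l th l).
Proof.
move=> a0; rewrite (big_morph (powR a) (id1 := 1) (op1 := *%R))//; last exact: powRr0.
by move=> t1 t2; rewrite powRD// (gt_eqF a0) implybT.
Qed.

Lemma geometric_mean n (x K : R) (th g : 'I_n -> R) : 0 <= x -> 0 < K ->
  (forall l, 0 <= g l) -> (forall l, 0 <= th l) -> \sum_l th l = 1 -> (forall l, x <= K * g l) ->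
  x <= K * \prod_l g l `^ th l.
Proof.
move=> x0 K0 g0 th0 th1 xg.
have [->|xp] := eqVneq x 0.
  by rewrite mulr_ge0 ?(ltW K0)// prodr_ge0// => l _; exact: powR_ge0.
have {}x0 : 0 < x by rewrite lt_neqAle eq_sym xp.
have prodE a : 0 < a -> a = \prod_l a `^ th l.
  by move=> a0; rewrite prod_powR// th1 powRr1// ltW.
rewrite [leLHS]prodE// [X in _ <= X * _]prodE// -big_split/=; apply: ler_prod => l _.
rewrite powR_ge0/= -powRM ?(ltW K0)// ge0_ler_powR ?nnegrE ?(ltW x0)//.
by rewrite mulr_ge0 ?(ltW K0).
Qed.

(** With weights th_l = (1 / H_l) / S the exponent in coordinate l is (2 be / H_l + d) / S, and 1 /
    H_l <= S. So every be with 2 be S < S - d keeps all exponents below 1. *)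
Lemma prodq_multipoint (B e : R) (H : 'I_N -> R) : 1 <= B -> B^-1 <= e ->
  (forall l, 0 < H l <= 1) -> d%:R < \sum_l (H l)^-1 ->
  exists be (bl : 'I_N -> R), [/\ 0 < be, forall l, 0 <= bl l < 1 &
  forall m, exists2 C, 0 < C & forall x Y s, 1 <= Y -> size s = m ->
  (forall y, y \in s -> admissible B e y /\ forall l, h l y <= H l) ->
  (forall l, uniq (coord l s)) ->
  `|\int[P]_w prodq X x (Y ^+ 6) w s| <=
    C * (Y `^ (- be)) ^+ m * \prod_l Bd (bl l) (coord l s)].
Proof.
move=> B1 Be H01; set S := \sum_l _ => dS.
have e0 : 0 < e by apply: lt_le_trans Be; rewrite invr_gt0 (lt_le_trans _ B1).
have S0 : 0 < S by apply: le_lt_trans dS.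
(* Any denominator above 2 would do for the exponents; 3 also yields be <= 1. *)
pose be := (S - d%:R) / (3 * S).
have be0 : 0 < be by rewrite divr_gt0 ?mulr_gt0 ?subr_gt0.
have d0 : 0 <= d%:R :> R by [].
have beS : 3 * (be * S) = S - d%:R by rewrite /be; field; rewrite gt_eqF.
have be1 : be <= 1 by rewrite /be ler_pdivrMr ?mulr_gt0//; lra.
clearbody be; pose th l := (H l)^-1 / S.
have th0 l : 0 <= th l.
  by have /andP[/ltW ? _] := H01 l; rewrite divr_ge0 ?invr_ge0// ltW.
have th1 : \sum_l th l = 1 by rewrite -mulr_suml divff// gt_eqF.
pose bl l := (be + be + d%:R * H l) * th l.
have bl01 l : 0 <= bl l < 1.
  have /andP[H0 H1] := H01 l.
  rewrite /bl mulr_ge0//= ?addr_ge0 ?(ltW be0)//; last by rewrite mulr_ge0// ltW.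
  rewrite /th mulrA ltr_pdivrMr// mul1r mulrDl mulfK ?gt_eqF//.
  have : (H l)^-1 <= S.
    rewrite /S (bigD1 l)//= lerDl sumr_ge0// => i _.
    by have /andP[/ltW ? _] := H01 i; rewrite invr_ge0.
  move=> /(ler_wpM2l (ltW be0)); lra.
exists be, bl; split=> // m.
have [C C0 HC] := prodq_line m B1 Be (ltW be0) be1.
exists C => // x Y s Y1 sm ads us.
have /choice[t Ht] : forall l, exists t : seq R, [/\ perm_eq t (coord l s), path <%R 0 t &
    forall b, 0 <= b -> b <= 1 -> gapD b 0 t <= Bd b (coord l s)].
  move=> l; apply: sorted_gapD => // _ /mapP[y ys ->].
  have [[/(_ l)/andP[+ _] _] _] := ads _ ys.
  by apply: lt_le_trans; rewrite mulr_gt0.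
have Y0 : 0 < Y by apply: lt_le_trans Y1.
have K0 : 0 < C * (Y `^ (- be)) ^+ m by rewrite mulr_gt0// exprn_gt0 ?powR_gt0.
have main l : `|\int[P]_w prodq X x (Y ^+ 6) w s| <=
    C * (Y `^ (- be)) ^+ m * gapD (be + be + d%:R * H l) 0 (t l).
  have [pt pth _] := Ht l.
  have [Is pI tE] := perm_iotaP 0 pt.
  (* The permutation sorting the l-th coordinates is lifted to the points; the product over [s] does
     not depend on their order. *)
  pose s' := map (nth (cst_pt N 0) s) Is.
  have ps : perm_eq s' s by apply/(perm_iotaP (cst_pt N 0)); exists Is => //; rewrite size_map in pI.
  have cs : coord l s' = t l.
    rewrite tE -map_comp; apply/eq_in_map => i; rewrite (perm_mem pI) mem_iota size_map/= => il.
    by rewrite (nth_map (cst_pt N 0)).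
  have -> : \int[P]_w prodq X x (Y ^+ 6) w s = \int[P]_w prodq X x (Y ^+ 6) w s'.
    by apply: eq_Rintegral => w _; rewrite /prodq (perm_big _ ps).
  rewrite -cs; apply: HC => //.
  - by have /andP[] := H01 l.
  - by rewrite (perm_size ps).
  - by move=> y; rewrite (perm_mem ps) => /ads[].
  - by rewrite cs.
apply: le_trans (geometric_mean (normr_ge0 _) K0 (fun l => gapD_ge0 _ _ _) th0 th1 main) _.
rewrite ler_pM2l//; apply: ler_prod => l _; rewrite powR_ge0/= gapD_powR.
have [_ _] := Ht l; apply; have /andP[] := bl01 l => //.
by move=> _ /ltW.
Qed.

End multipoint.

(** * Integrals of the singular kernel *)

Section singular_kernel.
Variable R : realType.
Local Notation leb := (@lebesgue_measure R).

Lemma integral_powRN_segment (be a T : R) : 0 <= be -> be < 1 -> 0 < a -> a <= T ->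
  (\int[leb]_(x in `[a, T]) (x `^ (- be))%:E <= (T `^ (1 - be) / (1 - be))%:E)%E.
Proof.
move=> be0 be1 a0 aT.
have g0 : 0 < 1 - be by rewrite subr_gt0.
have [->|neq] := eqVneq a T.
  rewrite set_itv1 integral_set1 lee_fin divr_ge0 ?powR_ge0// ltW//.
have {}aT : a < T by rewrite lt_neqAle neq.
pose F (x : R) := x `^ (1 - be) / (1 - be).
have dF (x : R) : 0 < x -> is_derive x 1 F (x `^ (- be)).
  move=> x0; have D := is_derive1_powR (1 - be) x0.
  have := isdM D (isd_cst x ((1 - be)^-1)).
  move=> /isd_val; apply; rewrite (_ : 1 - be - 1 = - be); last by ring.
  by field; rewrite gt_eqF.
have cF (x : R) : 0 < x -> {for x, continuous F}.
  by move=> x0; apply: differentiable_continuous; apply/derivable1_diffP; have [] := dF _ x0.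
rewrite (@continuous_FTC2 _ _ F)//.
- by rewrite -EFinB lee_fin /F gerBl divr_ge0 ?powR_ge0// ltW.
- apply: continuous_in_subspaceT => x; rewrite inE/= in_itv/= => /andP[ax _].
  have x0 : 0 < x by apply: lt_le_trans ax.
  apply: differentiable_continuous; apply/derivable1_diffP.
  by have [] := is_derive1_powR (- be) x0.
- split.
  + move=> x; rewrite in_itv/= => /andP[ax _].
    by have [] := dF _ (lt_trans a0 ax).
  + exact/cvg_at_right_filter/cF.
  + by apply/cvg_at_left_filter/cF; apply: lt_trans aT.
- move=> x; rewrite in_itv/= => /andP[ax _].
  have [_] := dF _ (lt_trans a0 ax); by rewrite derive1E.
Qed.

Lemma integral_powRN (be T : R) : 0 <= be -> be < 1 ->
  (\int[leb]_(x in `]0%R, T]) (x `^ (- be))%:E <= (T `^ (1 - be) / (1 - be))%:E)%E.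
Proof.
move=> be0 be1.
have g0 : 0 < 1 - be by rewrite subr_gt0.
have mf (D : set R) : measurable_fun D (fun x : R => (x `^ (- be))%:E).
  by apply/measurable_EFinP; apply: measurable_funTS; exact: measurable_powR.
(* The integrand is singular at 0, so the primitive is applied on segments away from 0 and the
   bound, free of n, passes to the limit. *)
pose D n : set R := `[n.+1%:R^-1, T]%classic.
have -> : `]0%R, T]%classic = \bigcup_n D n :> set R.
  apply/seteqP; split => x /=; rewrite in_itv/=.
    move=> /andP[x0 xT].
    have [n _ /(_ n (leqnn n))/= nx] := near_infty_natSinv_lt (PosNum x0).
    by exists n => //; rewrite /D/= in_itv/= xT ltW.
  move=> [n _]; rewrite /D/= in_itv/= => /andP[nx ->]; rewrite andbT.
  by apply: lt_le_trans nx; rewrite invr_gt0.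
have Dsub : {homo D : n m / (n <= m)%N >-> (n <= m)%O}.
  move=> i j ij; apply/subsetPset => x; rewrite /D/= !in_itv/= => /andP[+ ->]; rewrite andbT; apply: le_trans.
  by rewrite lef_pV2 ?posrE// ler_nat.
have /cvg_lim <- // : (\int[leb]_(x in D i) (x `^ (- be))%:E)%E @[i --> \oo] -->
    (\int[leb]_(x in \bigcup_i D i) (x `^ (- be))%:E)%E.
  apply: ge0_nondecreasing_set_cvg_integral => //.
  - by move=> n; exact: measurable_itv.
  - by move=> n; exact: mf.
  - by move=> n x _; rewrite lee_fin powR_ge0.
apply: lime_le.
  apply: ereal_nondecreasing_is_cvgn => i j ij.
  apply: ge0_subset_integral => //; [exact: measurable_itv|exact: measurable_itv|exact: mf| |].
    by move=> x _; rewrite lee_fin powR_ge0.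
  exact/subsetPset/Dsub.
apply: nearW => n; have [nT|nT] := leP n.+1%:R^-1 T.
  by apply: integral_powRN_segment; rewrite ?invr_gt0.
rewrite /D set_itv_ge ?bnd_simp -?ltNge// integral_set0 lee_fin.
by rewrite divr_ge0 ?powR_ge0// ltW.
Qed.

(* The value +oo at 0 makes the bound by [dsumE] trivial at points with
   coincident coordinates. *)
Definition kap (be T r : R) : \bar R :=
  ((`|r| `^ (- be) * \1_(`[- T, T]%classic : set R) r)%:E + +oo * (\1_([set 0] : set R) r)%:E)%E.

Lemma kap_ge0 be T r : (0 <= kap be T r)%E.
Proof. by rewrite adde_ge0 ?mule_ge0 ?lee_fin ?mulr_ge0 ?powR_ge0. Qed.

Lemma measurable_kap be T : measurable_fun setT (kap be T).
Proof.
apply: emeasurable_funD.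
  apply/measurable_EFinP; apply: measurable_funM.
    by apply: (measurableT_comp (measurable_powR (- be))); exact: measurable_absT.
  by apply: measurable_indic; exact: measurable_itv.
apply: emeasurable_funM => //; apply/measurable_EFinP.
by apply: measurable_indic; exact: measurable_set1.
Qed.

Lemma integral_kap be T : 0 <= be -> be < 1 -> 0 <= T ->
  exists2 K, 0 < K & (\int[leb]_r kap be T r <= K%:E)%E.
Proof.
move=> be0 be1 T0.
have g0 : 0 < 1 - be by rewrite subr_gt0.
pose Q := T `^ (1 - be) / (1 - be).
exists (Q + Q + 1); first by rewrite ltr_wpDl// addr_ge0// divr_ge0 ?powR_ge0 ?ltW.
pose f r := (`|r| `^ (- be) * \1_(`[- T, T]%classic : set R) r)%:E.
have f0 r : (0 <= f r)%E by rewrite lee_fin mulr_ge0 ?powR_ge0.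
have mf : measurable_fun setT f.
  apply/measurable_EFinP; apply: measurable_funM.
    by apply: (measurableT_comp (measurable_powR (- be))); exact: measurable_absT.
  by apply: measurable_indic; exact: measurable_itv.
have mi : measurable_fun setT (fun r : R => (\1_([set 0] : set R) r)%:E : \bar R).
  by apply/measurable_EFinP; apply: measurable_indic; exact: measurable_set1.
have i0 (r : R) : (0 <= (\1_([set 0] : set R) r)%:E :> \bar R)%E by rewrite lee_fin.
rewrite ge0_integralD//; last by apply: emeasurable_funM => //; exact: measurable_cst.
(* The infinite value is taken on the null set {0} only and integrates to 0. *)
rewrite [X in (_ + X)%E](_ : _ = 0%E) ?adde0; last first.
  rewrite ge0_integralZl// integral_indic// setIT.
  by rewrite [X in (_ * X)%E](lebesgue_measure_set1 0) mule0.
rewrite integral_leb_split//.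
have E : (\int[leb]_(x in `[0%R, +oo[) f x <= Q%:E)%E.
  rewrite -integral_itv_obnd_cbnd; last by apply: measurable_funTS.
  apply: le_trans (integral_powRN T be0 be1).
  rewrite integral_mkcond [leRHS]integral_mkcond; apply: ge0_le_integralT => x.
    by rewrite patchE; case: ifP.
  rewrite !patchE; case: ifPn => [|_]; last by case: ifP; rewrite ?lee_fin ?powR_ge0.
  rewrite inE/= in_itv/= andbT => x0; rewrite /f indicE gtr0_norm//.
  have [xT|xT] := leP x T.
    rewrite [X in if X then _ else _](_ : _ = true); last by apply/idP; rewrite inE/= in_itv/= x0 xT.
    by rewrite lee_fin ler_piMr ?powR_ge0// lern1 leq_b1.
  rewrite [X in X%:R](_ : _ = 0%N) ?mulr0; last first.
    by apply/eqP; rewrite eqb0 notin_setE/= in_itv/= [x <= T]leNgt xT andbF.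
  by case: ifP => _; rewrite ?lee_fin ?powR_ge0.
apply: (@le_trans _ _ (Q%:E + Q%:E)%E); last by rewrite -EFinD lee_fin lerDl.
apply: leeD => //; apply: le_trans E; rewrite le_eqVlt; apply/orP; left; apply/eqP.
apply: eq_integral => x _; rewrite /f normrN; congr (_ * _)%:E.
rewrite !indicE; congr (nat_of_bool _)%:R.
by apply/idP/idP; rewrite !inE/= !in_itv/=; lra.
Qed.

End singular_kernel.

Section kernel_sum.
Variable R : realType.
Local Notation leb := (@lebesgue_measure R).

Definition dsumE (be T x : R) (s : seq R) : \bar R :=
  (2%:E * \sum_(p <- s) kap be T (x - p))%E.

Lemma dsumE_ge0 be T x s : (0 <= dsumE be T x s)%E.
Proof. by rewrite mule_ge0// sume_ge0// => p _; exact: kap_ge0. Qed.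

Lemma measurable_dsumE be T s : measurable_fun setT (fun x => dsumE be T x s).
Proof.
apply: emeasurable_funM => //; apply: emeasurable_sum => p.
apply: (measurableT_comp (measurable_kap be T)).
exact: measurable_funB.
Qed.

Lemma le_dsumE be T x s : {in s, forall p, `|x - p| <= T} ->
  ((dsum be x s)%:E <= dsumE be T x s)%E.
Proof.
move=> sT; rewrite /dsum /dsumE EFinM lee_wpmul2l// -sumEFin.
rewrite big_seq [leRHS]big_seq; apply: lee_sum => p ps.
rewrite /kap indicE mem_set ?mulr1; last by rewrite /= in_itv/= -ler_norml sT.
by rewrite leeDl// mule_ge0// lee_fin.
Qed.

Lemma dsumE_pinfty be T x s : x \in s -> dsumE be T x s = +oo%E.
Proof.
move=> xs; rewrite /dsumE (big_rem x)//= [X in (2%:E * (X + _))%E](_ : _ = +oo%E).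
  by rewrite addye ?gt0_muley// gt_eqF// (lt_le_trans ltNy0)// sume_ge0// => p _; exact: kap_ge0.
by rewrite /kap subrr [X in (+oo * X)%E](_ : _ = 1%E) ?mule1 ?addey// indicE mem_set.
Qed.

(** Strict positivity matters because 0 times +oo is 0: it keeps a product over coordinates infinite
    as soon as one factor is. *)
Lemma dsumE_gt0 be T x s : 0 < x <= T -> (0 < dsumE be T x (0%R :: s))%E.
Proof.
move=> /andP[x0 xT].
have : ((dsum be x [:: 0%R])%:E <= dsumE be T x [:: 0%R])%E.
  by apply: le_dsumE => p; rewrite inE => /eqP->; rewrite subr0 gtr0_norm.
rewrite /dsum /dsumE big_seq1 subr0 gtr0_norm// big_seq1 big_cons => xk.
apply: lt_le_trans (_ : (2 * x `^ (- be))%:E <= _)%E; first by rewrite lte_fin mulr_gt0 ?powR_gt0.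
rewrite (le_trans xk)// lee_wpmul2l// subr0 leeDl// sume_ge0// => p _; exact: kap_ge0.
Qed.

Lemma integral_dsumE be T K s : (\int[leb]_r kap be T r <= K%:E)%E ->
  (\int[leb]_x dsumE be T x s <= (2 * (size s)%:R * K)%:E)%E.
Proof.
move=> hK.
have mk p : measurable_fun setT (fun x : R => kap be T (x - p)).
  apply: (measurableT_comp (measurable_kap be T)).
  exact: measurable_funB.
rewrite ge0_integralZl//; last 2 first.
- by apply: emeasurable_sum => p; exact: mk.
- by move=> x _; rewrite sume_ge0// => p _; exact: kap_ge0.
rewrite ge0_integral_sum//; last by move=> p x _; exact: kap_ge0.
rewrite -mulrA EFinM lee_wpmul2l//.
apply: (@le_trans _ _ (\sum_(p <- s) K%:E)%E).
  apply: lee_sum => p _; apply: le_trans hK.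
  rewrite (@integral_leb_shift R (kap be T) (- p))//; first exact: measurable_kap.
  exact: kap_ge0.
rewrite sumEFin lee_fin big_const_seq count_predT iter_addr_0 mulr_natl.
exact: lexx.
Qed.

Lemma Bd_gt0 (be : R) s : {in s, forall x, 0 < x} -> 0 < Bd be s.
Proof.
elim: s => //= x s IH sp; rewrite mulr_gt0//.
  by apply: IH => y ys; apply: sp; rewrite inE ys orbT.
rewrite /dsum mulr_gt0// big_cons subr0 ltr_pwDl//.
  by rewrite powR_gt0// normr_gt0 gt_eqF// sp// mem_head.
by apply: sumr_ge0 => p _; exact: powR_ge0.
Qed.

End kernel_sum.

(** * Moments of the averages over a set of points *)

Section moments.
Context (R : realType) (dO : measure_display) (Omega : measurableType dO).
Variables (P : probability Omega R) (N d : nat) (alpha : R) (h : 'I_N -> N.-tuple R -> R) (c : R).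
Variable X : 'I_d -> Omega -> N.-tuple R -> R.
Hypotheses (al0 : 0 < alpha) (al2 : alpha <= 2) (c0 : 0 < c).
Hypothesis mXj : forall k, measurable_fun [set: Omega * N.-tuple R] (fun p => X k p.1 p.2).
Hypothesis HX : is_LMSS P alpha h c X.
Local Notation admissible := (admissible h).
Local Notation coord l s := (map (fun y : N.-tuple R => tnth y l) s).
Implicit Types (s t : seq (N.-tuple R)) (y : N.-tuple R) (w : Omega) (x : 'I_d -> R).

Lemma measurable_process k y : measurable_fun setT (fun w => X k w y).
Proof.
exact: (measurableT_comp (mXj k) (@measurable_pair2 _ _ Omega _ y)).
Qed.

Lemma measurable_incr_joint x k :
  measurable_fun [set: Omega * N.-tuple R] (fun p => incr X x p.1 p.2 k).
Proof. by apply: measurable_funB => //; exact: mXj. Qed.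

Lemma integrable_bounded_set (J : set (N.-tuple R)) (B K : R) : measurable J ->
  (forall y, J y -> forall l, 0 <= tnth y l <= B) ->
  (lebT R N).-integrable setT (fun y => (\1_J y * K)%:E).
Proof.
move=> mJ JB.
suff i1 : (lebT R N).-integrable setT (EFin \o \1_J).
  rewrite (_ : (fun y => _) = (fun y => K%:E * (EFin \o \1_J) y)%E).
    exact: integrableZl.
  by apply/funext => y; rewrite /= -EFinM mulrC.
apply/integrableP; split; first by apply/measurable_EFinP; exact: measurable_indic.
apply: (@le_lt_trans _ _ (\int[lebT R N]_y (\big[*%E/1%E]_(l < N)
    (\1_(`[0%R, B]%classic : set R) (tnth y l))%:E)))%E.
  apply: ge0_le_integralT => y _ //=.
  rewrite prodEFin.
  rewrite lee_fin ger0_norm// indicE; case: (boolP (y \in J)) => [|_]; last first.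
    by apply: prodr_ge0.
  rewrite inE => /JB yB; rewrite big1// => l _; rewrite indicE mem_set//=.
  by rewrite in_itv/= yB.
rewrite (integral_lebT_prod (f := fun _ r => (\1_(`[0%R, B]%classic : set R) r)%:E))//.
  have -> : (\big[*%E/1%E]_(i < N) \int[lebesgue_measure]_r (\1_(`[0%R, B]%classic : set R) r)%:E =
     (\prod_(i < N) fine (lebesgue_measure (`[0%R, B]%classic : set R)))%:E)%E.
    rewrite (big_morph EFin (id1 := 1%E) (op1 := *%E))//; apply: eq_bigr => i _.
    transitivity (lebesgue_measure (`[0%R, B]%classic `&` setT)).
      by apply: (@integral_indic _ _ R lebesgue_measure setT measurableT); exact: measurable_itv.
    rewrite setIT fineK// [X in X \is a fin_num](lebesgue_measure_itv `[0%R, B]) /=.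
    by case: ifP.
  by rewrite ltry.
move=> i; apply/measurable_EFinP; apply: measurable_indic; exact: measurable_itv.
Qed.

Definition avg x q (J : set (N.-tuple R)) w : R :=
  \int[lebT R N]_y (\1_J y * qkd q (incr X x w y)).

Lemma measurable_integrand J x q : measurable J ->
  measurable_fun [set: Omega * N.-tuple R] (fun p => \1_J p.2 * qkd q (incr X x p.1 p.2)).
Proof.
move=> mJ; apply: measurable_funM.
  exact: (measurableT_comp (measurable_indic mJ)).
apply: measurable_qkd => k; exact: measurable_incr_joint.
Qed.

Lemma integrand_le J x q w y : 0 <= q ->
  `|\1_J y * qkd q (incr X x w y)| <= \1_J y * ((2 * q) ^+ d + q ^+ d).
Proof. by move=> q0; rewrite normrM ger0_norm// ler_wpM2l// qkd_le. Qed.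

Lemma measurable_avg J (B : R) x q : measurable J ->
  (forall y, J y -> forall l, 0 <= tnth y l <= B) -> 0 <= q ->
  measurable_fun setT (avg x q J).
Proof.
move=> mJ boxJ q0; apply: (@measurable_Rintegral_section _ _ _ _ _ P (lebT R N) _
  (fun y => \1_J y * ((2 * q) ^+ d + q ^+ d)) (measurable_integrand x q mJ)).
  exact: integrable_bounded_set boxJ.
by move=> w y /=; exact: integrand_le.
Qed.

Lemma avg_le J (B : R) q : measurable J ->
  (forall y, J y -> forall l, 0 <= tnth y l <= B) -> 0 <= q -> exists K, forall x w, `|avg x q J w| <= K.
Proof.
move=> mJ boxJ q0; have ib := integrable_bounded_set (((2 * q) ^+ d + q ^+ d)) mJ boxJ.
exists (\int[lebT R N]_y (\1_J y * ((2 * q) ^+ d + q ^+ d))) => x w.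
have := @integrable_section1 _ _ _ _ _ (lebT R N) _ _ (measurable_integrand x q mJ) ib
  (fun w y => integrand_le J x w y q0) w => iw.
apply: le_trans (le_normr_Rintegral measurableT iw) _.
apply: le_Rintegral => //.
  exact: (integrable_norm iw).
by move=> y _; exact: integrand_le.
Qed.

Section piece.
Variables (B e : R) (H : 'I_N -> R) (J : set (N.-tuple R)).
Hypotheses (mJ : measurable J) (B1 : 1 <= B) (Be : B^-1 <= e).
Hypothesis adJ : forall y, J y -> admissible B e y.

Let e0 : 0 < e. Proof. by apply: lt_le_trans Be; rewrite invr_gt0 (lt_le_trans _ B1). Qed.

Let boxJ y : J y -> forall l, 0 <= tnth y l <= B.
Proof.
by move=> /adJ[+ _] l => /(_ l)/andP[h1 ->]; rewrite andbT (le_trans _ h1)// mulr_ge0// ltW.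
Qed.

Let bq q := (2 * q) ^+ d + q ^+ d : R.

(** One factor [avg] at a time is opened by Fubini: its variable y joins [s], and integrating the
    factors [dsum] that y adds, coordinate by coordinate, costs a constant. The multipoint bound is
    needed only for full lists of m points. *)
Lemma moment_recursion (bl Kk : 'I_N -> R) (A : R) (m : nat) x q :
  0 < q -> 0 < A -> (forall l, 0 < Kk l) ->
  (forall l, (\int[lebesgue_measure]_r kap (bl l) B r <= (Kk l)%:E)%E) ->
  (forall s, size s = m -> {in s, forall y, J y} -> (forall l, uniq (coord l s)) ->
     `|\int[P]_w prodq X x q w s| <= A * \prod_l Bd (bl l) (coord l s)) ->
  (forall j s, (size s + j)%N = m -> {in s, forall y, J y} -> (forall l, uniq (coord l s)) ->
     `|\int[P]_w (avg x q J w ^+ j * prodq X x q w s)| <=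
     A * (\prod_l (2 * m.+1%:R * Kk l)) ^+ j * \prod_l Bd (bl l) (coord l s)).
Proof.
move=> q0 A0 Kk0 HK1 HA; set D := \prod_l _.
have D0 : 0 < D by apply: prodr_gt0 => l _; rewrite !mulr_gt0.
elim=> [|j IH] s sj sJ us.
  rewrite expr0 mulr1; under eq_Rintegral do rewrite expr0 mul1r.
  by apply: HA => //; rewrite -sj addn0.
have q0' := ltW q0.
pose F (p : Omega * N.-tuple R) : R :=
  \1_J p.2 * qkd q (incr X x p.1 p.2) * (avg x q J p.1 ^+ j * prodq X x q p.1 s).
have -> : \int[P]_w (avg x q J w ^+ j.+1 * prodq X x q w s) =
   \int[P]_w \int[lebT R N]_y F (w, y).
  apply: eq_Rintegral => w _; rewrite exprS -mulrA /F/= RintegralZr//.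
  have ib := integrable_bounded_set (bq q) mJ boxJ.
  exact: (@integrable_section1 _ _ _ _ _ (lebT R N) _ _ (measurable_integrand x q mJ) ib
    (fun w y => integrand_le J x w y q0') w).
have [K HK] := avg_le mJ boxJ q0'.
have K0 : 0 <= K by apply: le_trans (HK x point); rewrite normr_ge0.
pose M := bq q * (K ^+ j * bq q ^+ size s).
have bq0 : 0 <= bq q by rewrite addr_ge0 ?exprn_ge0 ?mulr_ge0.
have mav : measurable_fun setT (avg x q J) := measurable_avg x mJ boxJ q0'.
have s0 l : {in coord l s, forall r, 0 < r <= B}.
  move=> _ /mapP[y ys ->]; have [+ _] := adJ (sJ _ ys); move=> /(_ l)/andP[h1 ->].
  by rewrite andbT (lt_le_trans _ h1)// mulr_gt0.
have B0 : 0 <= B by apply: le_trans B1.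
pose G := \prod_l Bd (bl l) (coord l s).
have G0 : 0 < G by apply: prodr_gt0 => l _; apply: Bd_gt0 => r /s0/andP[].
(* [dsumE] instead of [dsum]: the majorant is infinite where y shares a coordinate with a point of
   [s], the case not covered by the induction hypothesis. *)
pose U y : \bar R := ((A * D ^+ j * G)%:E *
  \big[*%E/1%E]_(l < N) dsumE (bl l) B (tnth y l) (0%R :: coord l s))%E.
apply: (@fubini_bounded _ _ _ _ _ P (lebT R N) F (fun y => \1_J y * M) _ _ _ U).
- apply: measurable_funM; first exact: measurable_integrand.
  apply: measurable_funM.
    by apply: measurable_funX; exact: (measurableT_comp mav).
  exact: (measurableT_comp (measurable_prodq measurable_process x q s)).
- exact: integrable_bounded_set boxJ.
- move=> w y; rewrite /F/= normrM /M mulrA; apply: ler_pM => //.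
    exact: integrand_le.
  rewrite normrM normrX; apply: ler_pM => //.
    by rewrite lerXn2r ?nnegrE.
  exact: prodq_le.
- move=> y; case: (boolP (y \in J)) => yJ; last first.
    rewrite (_ : \int[P]_w F (w, y) = 0) ?normr0.
      rewrite mule_ge0 ?lee_fin ?mulr_ge0 ?exprn_ge0 ?(ltW A0) ?(ltW D0) ?(ltW G0)//.
      by apply: prode_ge0 => l _; exact: dsumE_ge0.
    rewrite -[RHS](mul0r (fine (P setT))) -Rintegral_cst//.
    by apply: eq_Rintegral => w _; rewrite /F/= indicE (negbTE yJ) !mul0r.
  rewrite inE in yJ.
  have yl l : 0 < tnth y l <= B.
    have [+ _] := adJ yJ; move=> /(_ l)/andP[h1 ->].
    by rewrite andbT (lt_le_trans _ h1)// mulr_gt0.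
  have dp l : (0 < dsumE (bl l) B (tnth y l) (0%R :: coord l s))%E by exact: dsumE_gt0.
  have AG0 : 0 < A * D ^+ j * G by rewrite !mulr_gt0 ?exprn_gt0.
  have [uy|] := pselect (forall l, uniq (coord l (y :: s))); last first.
    move=> /existsNP[l]; rewrite /= us andbT => /negP/negPn yls.
    rewrite /U (bigD1 l)//= dsumE_pinfty ?inE ?yls ?orbT// gt0_mulye; last first.
      by elim/big_ind : _ => //; exact: mule_gt0.
    by rewrite gt0_muley ?lte_fin// leey.
  have -> : \int[P]_w F (w, y) = \int[P]_w (avg x q J w ^+ j * prodq X x q w (y :: s)).
    apply: eq_Rintegral => w _; rewrite /F/= indicE mem_set// mul1r /prodq big_cons; ring.
  apply: (@le_trans _ _ (A * D ^+ j * \prod_l Bd (bl l) (coord l (y :: s)))%:E).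
    rewrite lee_fin; apply: IH => //; first by rewrite /= addSnnS.
    by move=> y'; rewrite inE => /orP[/eqP->|/sJ].
  rewrite /U /= big_split/= -/G mulrA EFinM lee_wpmul2l ?lee_fin ?(ltW AG0)//.
  rewrite -prodEFin.
  suff : (0 <= \big[*%E/1%E]_(l < N) (dsum (bl l) (tnth y l) (0%R :: coord l s))%:E <=
     \big[*%E/1%E]_(l < N) dsumE (bl l) B (tnth y l) (0%R :: coord l s))%E by case/andP.
  elim/big_ind2 : _ => //.
  + by rewrite lexx lee_fin ler01.
  + move=> x1 x2 y1 y2 /andP[? ?] /andP[? ?]; rewrite mule_ge0//=.
    exact: lee_pmul.
  + move=> l _; rewrite lee_fin dsum_ge0/=; apply: le_dsumE => p.
    have /andP[y0 yB] := yl l.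
    rewrite inE => /orP[/eqP->|/s0/andP[p0 pB]]; first by rewrite subr0 gtr0_norm.
    by rewrite ler_norml; apply/andP; split; lra.
- rewrite ge0_integralZl//; last 3 first.
  + apply: measurable_prode => l; apply: (measurableT_comp (measurable_dsumE _ _ _)).
    exact: measurable_tnth.
  + by move=> y _; apply: prode_ge0 => l _; exact: dsumE_ge0.
  + by rewrite lee_fin !mulr_ge0 ?exprn_ge0 ?(ltW A0) ?(ltW D0) ?(ltW G0).
  rewrite (integral_lebT_prod (f := fun l r => dsumE (bl l) B r (0%R :: coord l s))); last 2 first.
  + by move=> l; exact: measurable_dsumE.
  + by move=> l r; exact: dsumE_ge0.
  rewrite [leRHS](_ : _ = ((A * D ^+ j * G)%:E * D%:E)%E); last first.
    by rewrite -EFinM -/G exprSr mulrA mulrAC.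
  rewrite lee_wpmul2l ?lee_fin ?mulr_ge0 ?exprn_ge0 ?(ltW A0) ?(ltW D0) ?(ltW G0)//.
  rewrite /D -prodEFin.
  suff : (0 <= \big[*%E/1%E]_(l < N) \int[lebesgue_measure]_r dsumE (bl l) B r (0%R :: coord l s) <=
     \big[*%E/1%E]_(l < N) (2 * m.+1%:R * Kk l)%:E)%E by case/andP.
  elim/big_ind2 : _ => //.
  + by rewrite lexx lee_fin ler01.
  + move=> x1 x2 y1 y2 /andP[? ?] /andP[? ?]; rewrite mule_ge0//=.
    exact: lee_pmul.
  + move=> l _; rewrite integral_ge0/=; last by move=> r _; exact: dsumE_ge0.
    apply: le_trans (integral_dsumE (0%R :: coord l s) (HK1 l)) _.
    rewrite lee_fin ler_wpM2r ?(ltW (Kk0 l))// ler_pM2l// ler_nat/= size_map ltnS.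
    by rewrite -sj leq_addr.
Qed.

End piece.
End moments.

Lemma sum_powr_le (R : realDomainType) (I : finType) (a : I -> R) (i0 : I) m :
  (\sum_i a i) ^+ (2 * m) <= #|I|%:R ^+ (2 * m) * \sum_i a i ^+ (2 * m).
Proof.
have ev (b : R) : b ^+ (2 * m) = `|b| ^+ (2 * m) by rewrite !exprM real_normK// num_real.
have ge0 (b : R) : 0 <= b ^+ (2 * m) by rewrite ev exprn_ge0.
pose j := [arg max_(j > i0) `|a j|]%O.
have hj i : `|a i| <= `|a j| by rewrite /j; case: arg_maxP => //= k _; apply.
apply: (@le_trans _ _ ((#|I|%:R * `|a j|) ^+ (2 * m))).
  rewrite ev lerXn2r ?nnegrE ?mulr_ge0//; apply: le_trans (ler_norm_sum _ _ _) _.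
  rewrite mulr_natl -sumr_const; exact: ler_sum.
rewrite exprMn ler_wpM2l ?exprn_ge0// -ev (bigD1 j)//= lerDl.
by apply: sumr_ge0 => i _.
Qed.

Lemma Rintegral_sum dT (T : measurableType dT) (R : realType)
    (mu : {measure set T -> \bar R}) (I : Type) (s : seq I) (f : I -> T -> R) :
  (forall i, mu.-integrable setT (EFin \o f i)) ->
  mu.-integrable setT (EFin \o (fun y => \sum_(i <- s) f i y)) /\
  \int[mu]_y \sum_(i <- s) f i y = \sum_(i <- s) \int[mu]_y f i y.
Proof.
move=> fi; elim: s => [|i s [IH1 IH2]].
  split; last by under eq_Rintegral do rewrite big_nil; rewrite big_nil Rintegral_cst// mul0r.
  rewrite (_ : _ \o _ = cst 0%E); first exact: integrable0.
  by apply/funext => y /=; rewrite big_nil.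
split; last by under eq_Rintegral do rewrite big_cons; rewrite RintegralD// IH2 big_cons.
rewrite (_ : _ \o _ = (EFin \o f i) \+ (EFin \o (fun y => \sum_(i <- s) f i y)%R))%E.
  exact: integrableD.
by apply/funext => y /=; rewrite big_cons EFinD.
Qed.

Lemma compact_rect (R : realType) N (a b : N.-tuple R) :
  compact (@tup2row R N @` rect a b).
Proof.
have -> : @tup2row R N @` rect a b =
    [set v : 'rV[R]_N | forall i, `[tnth a i, tnth b i]%classic (v ord0 i)].
  apply/seteqP; split => [_ [t ht <-] i|v hv] /=.
    by rewrite in_itv/= mxE; exact: ht.
  exists [tuple v ord0 i | i < N].
    by move=> l; rewrite tnth_mktuple; have := hv l; rewrite /= in_itv.
  by apply/rowP => i; rewrite mxE tnth_mktuple.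
apply: (@rV_compact R N (fun i => `[tnth a i, tnth b i]%classic)) => i.
exact: segment_compact.
Qed.

Section moment_bounds.
Context (R : realType) (dO : measure_display) (Omega : measurableType dO).
Variables (P : probability Omega R) (N d : nat) (alpha : R) (h : 'I_N -> N.-tuple R -> R) (c : R).
Variable X : 'I_d -> Omega -> N.-tuple R -> R.
Hypotheses (al0 : 0 < alpha) (al2 : alpha <= 2) (c0 : 0 < c).
Hypothesis mXj : forall k, measurable_fun [set: Omega * N.-tuple R] (fun p => X k p.1 p.2).
Hypothesis HX : is_LMSS P alpha h c X.
Local Notation admissible := (admissible h).
Implicit Types (y : N.-tuple R) (w : Omega) (x : 'I_d -> R) (J : set (N.-tuple R)).

Lemma piece_moment (B e : R) (H : 'I_N -> R) : 1 <= B -> B^-1 <= e ->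
  (forall l, 0 < H l <= 1) -> d%:R < \sum_l (H l)^-1 ->
  exists2 be, 0 < be & forall m, exists2 C, 0 < C & forall x Y J, 1 <= Y -> measurable J ->
  (forall y, J y -> admissible B e y /\ forall l, h l y <= H l) ->
  `|\int[P]_w (avg X x (Y ^+ 6) J w ^+ m)| <= C * (Y `^ (- be)) ^+ m.
Proof.
move=> B1 Be H01 dS.
have [be [bl [be0 bl01 Hm]]] := prodq_multipoint al0 al2 c0 (measurable_process mXj) HX B1 Be H01 dS.
have B0 : 0 <= B by apply: le_trans B1.
have /choice[Kk HK] : forall l, exists K, 0 < K /\
    (\int[lebesgue_measure]_r kap (bl l) B r <= K%:E)%E.
  by move=> l; have /andP[b0 b1] := bl01 l; have [K ? ?] := integral_kap b0 b1 B0; exists K.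
exists be => // m; have [C C0 HC] := Hm m.
exists (C * (\prod_(l < N) (2 * m.+1%:R * Kk l)) ^+ m).
  rewrite mulr_gt0// exprn_gt0//; apply: prodr_gt0 => l _; rewrite !mulr_gt0//.
  by have [] := HK l.
move=> x Y J Y1 mJ adJ; have Y0 : 0 < Y by apply: lt_le_trans Y1.
have q0 : 0 < Y ^+ 6 by rewrite exprn_gt0.
have A0 : 0 < C * (Y `^ (- be)) ^+ m by rewrite mulr_gt0// exprn_gt0// powR_gt0.
have adJ1 y : J y -> admissible B e y by move=> /adJ[].
have H1 := @moment_recursion _ _ _ P _ _ _ _ mXj _ _ _ mJ B1 Be adJ1 bl _ _ m x _ q0 A0
  (fun l => (HK l).1) (fun l => (HK l).2) _ m [::] erefl.
have -> : \int[P]_w (avg X x (Y ^+ 6) J w ^+ m) =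
   \int[P]_w (avg X x (Y ^+ 6) J w ^+ m * prodq X x (Y ^+ 6) w [::]).
  by apply: eq_Rintegral => w _; rewrite /prodq big_nil mulr1.
have HA s : size s = m -> {in s, forall y, J y} ->
    (forall l, uniq (map (fun y : N.-tuple R => tnth y l) s)) ->
    `|\int[P]_w prodq X x (Y ^+ 6) w s| <= C * (Y `^ (- be)) ^+ m *
      \prod_l Bd (bl l) (map (fun y : N.-tuple R => tnth y l) s).
  by move=> sm sJ us; apply: HC => // y ys; apply: adJ; exact: sJ.
apply: (le_trans (H1 HA _ _)) => //.
rewrite [X in _ * X <= _]big1// mulr1 le_eqVlt; apply/orP; left; apply/eqP.
by rewrite -!mulrA [X in _ * X]mulrC.
Qed.

Lemma integrable_avg_integrand (J : set (N.-tuple R)) (B : R) x q w : measurable J -> 0 <= q ->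
  (forall y, J y -> forall l, 0 <= tnth y l <= B) ->
  (lebT R N).-integrable setT (fun y => (\1_J y * qkd q (incr X x w y))%:E).
Proof.
move=> mJ q0 JB.
apply: (le_integrable measurableT _ _ (integrable_bounded_set ((2 * q) ^+ d + q ^+ d) mJ JB)).
  apply/measurable_EFinP; exact: (measurableT_comp (measurable_integrand mXj x q mJ) (@measurable_pair1 _ _ Omega _ w)).
move=> y _; rewrite /= lee_fin; apply: le_trans (integrand_le _ _ _ _ _ q0) (ler_norm _).
Qed.

Lemma avg_sum (I : finType) (D : I -> set (N.-tuple R)) J (B : R) x q w :
  measurable J -> (forall i, measurable (D i)) -> 0 <= q ->
  (forall y, J y -> forall l, 0 <= tnth y l <= B) ->
  (forall y, J y -> \sum_i \1_(D i) y = 1 :> R) ->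
  avg X x q J w = \sum_i avg X x q (J `&` D i) w.
Proof.
move=> mJ mD q0 JB HD; rewrite /avg.
pose f i y : R := \1_(J `&` D i) y * qkd q (incr X x w y).
have fi i : (lebT R N).-integrable setT (EFin \o f i).
  by apply: (@integrable_avg_integrand _ B) => [|//|y [/JB]//]; exact: measurableI.
transitivity (\int[lebT R N]_y \sum_i f i y).
  apply: eq_Rintegral => y _; rewrite /f -mulr_suml; congr (_ * _).
  under eq_bigr do rewrite indicI.
  rewrite -mulr_sumr [in LHS]indicE; case: (boolP (y \in J)) => yJ.
    by rewrite indicE yJ mul1r HD//; rewrite inE in yJ.
  by rewrite indicE (negbTE yJ) mul0r.
by have [] := Rintegral_sum (index_enum I) fi.
Qed.

Definition cell (a dl : R) n (f : {ffun 'I_N -> 'I_n}) : set (N.-tuple R) :=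
  [set y | forall l, a + (f l)%:R * dl <= tnth y l < a + (f l).+1%:R * dl].

Lemma measurable_cell a dl n f : measurable (@cell a dl n f).
Proof.
rewrite (_ : cell _ _ _ = \bigcap_(l in setT)
   ((fun v : N.-tuple R => tnth v l) @^-1` `[a + (f l)%:R * dl, a + (f l).+1%:R * dl[)).
  apply: fin_bigcap_measurable => // l _.
  rewrite -[X in measurable X]setTI; apply: measurable_tnth => //; exact: measurable_itv.
apply/seteqP; split => [y H l _|y H l] /=; first by rewrite in_itv/= H.
by have := H l I; rewrite /= in_itv.
Qed.

(** The indicator of a cell is a product over coordinates, so the sum over all cells is a product of
    one-dimensional sums, each of which telescopes to 1. *)
Lemma sum_cell a dl n y : 0 < dl -> (forall l, a <= tnth y l < a + n%:R * dl) ->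
  \sum_(f : {ffun 'I_N -> 'I_n}) \1_(cell a dl f) y = 1 :> R.
Proof.
move=> dl0 yl.
pose g l (j : 'I_n) : R := (a + j%:R * dl <= tnth y l < a + j.+1%:R * dl)%R%:R.
transitivity (\sum_(f : {ffun 'I_N -> 'I_n}) \prod_l g l (f l)).
  apply: eq_bigr => f _; rewrite indicE /g; case: (boolP (y \in _)) => [|].
    by rewrite inE => H; rewrite big1// => l _; rewrite H.
  rewrite notin_setE => /existsNP[l]/negP/negbTE Hl.
  by rewrite (bigD1 l)//= Hl mul0r.
rewrite -(bigA_distr_bigA g); apply: big1 => l _.
pose u j : R := - (a + j%:R * dl <= tnth y l)%R%:R.
transitivity (\sum_(0 <= j < n) (u j.+1 - u j)).
  rewrite big_mkord; apply: eq_bigr => j _; rewrite /g /u opprK.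
  rewrite ltNge; case: (leP (a + j.+1%:R * dl)) => h1 /=; last by rewrite andbT oppr0 add0r.
  have -> : a + j%:R * dl <= tnth y l.
    by apply: le_trans h1; rewrite lerD2l ler_pM2r// ler_nat.
  by rewrite addNr.
rewrite telescope_sumr// /u mul0r addr0; have /andP[-> h2] := yl l.
by rewrite leNgt h2/= oppr0 sub0r opprK.
Qed.

(** The multipoint bound needs constant exponents H_l above h_l. Uniform continuity of h on the
    compact set allows H_l = h_l(v) + eta near v, capped at 1, with the condition on d preserved. *)
Lemma local_hurst_bound (eps T : R) : hurst_assumptions h -> 0 < eps ->
  d%:R < inf [set \sum_(l < N) (h l v)^-1 | v in rect (cst_pt N eps) (cst_pt N T)] ->
  exists2 dl, 0 < dl & forall v, rect (cst_pt N eps) (cst_pt N T) v ->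
    exists H : 'I_N -> R, [/\ forall l, 0 < H l <= 1, d%:R < \sum_l (H l)^-1 &
      forall y, rect (cst_pt N eps) (cst_pt N T) y ->
        (forall l, `|tnth y l - tnth v l| <= dl) -> forall l, h l y <= H l].
Proof.
set I := rect _ _ => -[m [M [mM [hm Hc]]]] eps0 dinf.
have Ipos : I `<=` @nonneg_pt R N.
  by move=> v Iv l; have /andP[+ _] := Iv l; rewrite tnth_nseq; apply: le_trans; exact: ltW.
have [K [K0 HK]] := Hc I Ipos (@compact_rect R N _ _).
pose S := \sum_l (m l)^-2.
have S0 : 0 <= S.
  by apply: sumr_ge0 => l _; have [m0 _] := mM l; rewrite invr_ge0 exprn_ge0// ltW.
set S1 := inf _ in dinf.
(* Raising h_l by eta lowers 1 / h_l by at most eta / m_l^2, so the total loss eta S is below the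
   margin S1 - d. *)
pose eta := (S1 - d%:R) / (1 + S).
have S10 : 0 < 1 + S by rewrite ltr_wpDr.
have eta0 : 0 < eta by rewrite divr_gt0// subr_gt0.
have etaS : eta * S < S1 - d%:R.
  have : eta * (1 + S) = S1 - d%:R by rewrite /eta divfK// gt_eqF.
  by rewrite mulrDr mulr1 => <-; rewrite ltrDr.
(* Each term of [rho] is to be at most eta1, so that K rho <= eta; N + 1 rather than N avoids a
   division by zero. *)
clearbody eta; pose eta1 := Num.min 1 (eta / (K * N.+1%:R)).
have eta10 : 0 < eta1 by rewrite lt_min ltr01 divr_gt0// mulr_gt0.
have eta11 : eta1 <= 1 by rewrite /eta1 ge_min lexx.
pose r l := eta1 `^ (m l)^-1.
have r0 l : 0 < r l by rewrite powR_gt0.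
have r1 l : r l <= 1.
  by have [m0 _] := mM l; rewrite powR_le1 ?(ltW eta10)// invr_ge0 ltW.
(* A positive number below every r l, since all of them are at most 1. *)
exists (\prod_l r l); first by apply: prodr_gt0 => l _.
move=> v Iv; have nv := Ipos _ Iv; have hv := hm _ nv.
exists (fun l => Num.min 1 (h l v + eta)); split.
- move=> l; rewrite ge_min lexx lt_min ltr01 andbT /= addr_gt0//.
  by have [m0 _] := mM l; have /andP[+ _] := hv l; exact: lt_le_trans.
- have infv : S1 <= \sum_l (h l v)^-1.
    apply: ge_inf; last by exists v.
    exists 0 => _ [u Iu <-]; apply: sumr_ge0 => l _; rewrite invr_ge0.
    have [m0 _] := mM l; have /andP[+ _] := hm _ (Ipos _ Iu) l.
    exact/le_trans/ltW.
  apply: (@lt_le_trans _ _ (\sum_l ((h l v)^-1 - eta * (m l)^-2))).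
    rewrite sumrB -mulr_sumr -/S; lra.
  apply: ler_sum => l _.
  have [m0 _] := mM l; have /andP[ml _] := hv l.
  have h0 : 0 < h l v by apply: lt_le_trans ml.
  have he : 0 < h l v + eta by rewrite addr_gt0.
  apply: (@le_trans _ _ (h l v + eta)^-1); last first.
    rewrite lef_pV2 ?posrE ?lt_min ?ltr01//; last by rewrite ge_min lexx orbT.
  rewrite lerBlDr -lerBlDl.
  have -> : (h l v)^-1 - (h l v + eta)^-1 = eta / (h l v * (h l v + eta)).
    by field; rewrite !gt_eqF.
  rewrite ler_pM2l// lef_pV2 ?posrE ?exprn_gt0 ?mulr_gt0// expr2.
  by apply: ler_pM; rewrite ?(ltW m0)// (le_trans ml)// lerDl ltW.
- move=> y Iy yv l; rewrite le_min; have ny := Ipos _ Iy; apply/andP; split.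
    by have [_ [_ M1]] := mM l; have /andP[_ hM] := hm _ ny l; rewrite (le_trans hM)// ltW.
  have : `|h l y - h l v| <= eta.
    apply: (le_trans (HK _ _ Iy Iv l)).
    have rho1 : rho m M y v <= N.+1%:R * eta1.
      apply: (@le_trans _ _ (\sum_(i < N) eta1)); last first.
        by rewrite sumr_const card_ord -[_ *+ N]mulr_natl ler_wpM2r ?(ltW eta10)// ler_nat.
      apply: ler_sum => i _; rewrite ge_min; apply/orP; left.
      have [m0 _] := mM i.
      apply: (@le_trans _ _ (r i `^ m i)).
        rewrite ge0_ler_powR ?nnegrE ?(ltW m0) ?(ltW (r0 i))//.
        apply: (le_trans (yv i)); rewrite (bigD1 i)//= ler_piMr ?(ltW (r0 i))//.
        by apply: prodr_ile1 => j _; rewrite (ltW (r0 j)) r1.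
      by rewrite /r -powRrM mulVf ?gt_eqF// powRr1// ltW.
    apply: (le_trans (ler_wpM2l (ltW K0) rho1)).
    have : eta1 <= eta / (K * N.+1%:R) by rewrite /eta1 ge_min lexx orbT.
    by rewrite ler_pdivlMr ?mulr_gt0// mulrC mulrA.
  by rewrite ler_norml => /andP[_]; rewrite lerBlDl addrC.
Qed.

(** The cube is cut into finitely many cells on which constant exponents are available; the decay
    rate is the worst one among the cells. *)
Lemma moment_bound (eps T : R) : hurst_assumptions h -> 0 < eps -> eps < T ->
  d%:R < inf [set \sum_(l < N) (h l v)^-1 | v in rect (cst_pt N eps) (cst_pt N T)] ->
  exists2 be, 0 < be & forall m, exists2 C, 0 < C & forall x Y J, 1 <= Y -> measurable J ->
  J `<=` rect (cst_pt N eps) (cst_pt N T) ->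
  \int[P]_w (avg X x (Y ^+ 6) J w ^+ (2 * m)) <= C * (Y `^ (- be)) ^+ (2 * m).
Proof.
set I := rect _ _ => hh eps0 epsT dinf.
have [dl dl0 Hdl] := local_hurst_bound hh eps0 dinf.
have T0 : 0 < T by apply: lt_trans epsT.
(* Chosen so that 2e = eps bounds the coordinates below, B >= T bounds them above, and 1/B <= e. *)
pose e := eps / 2; pose B := 1 + T + 2 / eps.
have e0 : 0 < e by rewrite divr_gt0.
have B1 : 1 <= B by rewrite /B -addrA lerDl addr_ge0 ?divr_ge0 ?ltW.
have B0 : 0 < B by apply: lt_le_trans B1.
have Be : B^-1 <= e.
  rewrite -[leRHS]invrK lef_pV2 ?posrE ?invr_gt0// /e invf_div /B lerDr.
  by rewrite addr_ge0// ltW.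
have IB y l : I y -> 0 <= tnth y l <= B.
  move=> /(_ l); rewrite !tnth_nseq => /andP[h1 h2]; rewrite (le_trans (ltW eps0) h1)/=.
  rewrite (le_trans h2)// /B; have : 0 <= 2 / eps by rewrite divr_ge0// ltW.
  lra.
have adI y : I y -> admissible B e y.
  move=> Iy; split => l.
    have /andP[_ ->] := IB y l Iy; rewrite andbT /e mulrC divfK//.
    by have /andP[] := Iy l; rewrite tnth_nseq.
  have [m [M [mM [hm _]]]] := hh; have [m0 [_ M1]] := mM l.
  have : nonneg_pt y by move=> i; have /andP[] := IB y i Iy.
  by move=> /hm/(_ l)/andP[h1 h2]; rewrite (lt_le_trans m0 h1) (le_lt_trans h2 M1).
have [n nT] : exists n, T - eps < n.+1%:R * dl.
  have /archi_boundP : 0 <= (T - eps) / dl by rewrite divr_ge0 ?subr_ge0 ?ltW.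
  set k := Num.bound _ => kb; exists k; rewrite -ltr_pdivrMr//.
  by apply: lt_trans kb _; rewrite ltr_nat.
have sumI y : I y -> \sum_(f : {ffun 'I_N -> 'I_n.+1}) \1_(cell eps dl f) y = 1 :> R.
  move=> Iy; apply: sum_cell => // l; have /andP[] := Iy l; rewrite !tnth_nseq => -> h2/=.
  by rewrite -ltrBlDl (le_lt_trans _ nT)// lerD2r.
have epsI : I (cst_pt N eps) by move=> l; rewrite !tnth_nseq lexx ltW.
(* A cell that misses [I] gets an arbitrary reference point, its condition being vacuous. *)
have /choice[v Hv] : forall f : {ffun 'I_N -> 'I_n.+1}, exists v, I v /\
    forall y, I y -> cell eps dl f y -> forall l, `|tnth y l - tnth v l| <= dl.
  move=> f; have [[v [Iv fv]]|no] := pselect (exists v, I v /\ cell eps dl f v); last first.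
    by exists (cst_pt N eps); split => // y Iy fy; exfalso; apply: no; exists y.
  exists v; split => // y _ fy l; have /andP[v1 v2] := fv l; have /andP[y1 y2] := fy l.
  have E : (f l).+1%:R * dl = (f l)%:R * dl + dl by rewrite -natr1 mulrDl mul1r.
  by rewrite ler_norml; apply/andP; split; lra.
have /choice[b Hb] : forall f : {ffun 'I_N -> 'I_n.+1}, exists be, 0 < be /\
   forall m, exists2 C, 0 < C & forall x Y J, 1 <= Y -> measurable J -> J `<=` I ->
     `|\int[P]_w (avg X x (Y ^+ 6) (J `&` cell eps dl f) w ^+ m)| <= C * (Y `^ (- be)) ^+ m.
  move=> f; have [Iv fv] := Hv f; have [H [H01 HS Hy]] := Hdl _ Iv.
  have [be be0 Hbe] := piece_moment B1 Be H01 HS.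
  exists be; split => // m; have [C C0 HC] := Hbe m; exists C => // x Y J Y1 mJ JI.
  apply: HC => //; first by apply: measurableI => //; exact: measurable_cell.
  move=> y [/JI Iy fy]; split; first exact: adI.
  by apply: Hy => //; exact: fv.
pose i0 : {ffun 'I_N -> 'I_n.+1} := [ffun=> ord0].
pose be := \big[Num.min/1]_f b f.
have beb f : be <= b f by exact: bigmin_le_cond.
have be0 : 0 < be by apply: lt_bigmin => // f _; have [] := Hb f.
exists be => // m.
have /choice[C HC] : forall f, exists C, 0 < C /\ forall x Y J, 1 <= Y -> measurable J -> J `<=` I ->
     `|\int[P]_w (avg X x (Y ^+ 6) (J `&` cell eps dl f) w ^+ (2 * m))| <= C * (Y `^ (- b f)) ^+ (2 * m).
  by move=> f; have [_ /(_ (2 * m)%N)[C C0 HC]] := Hb f; exists C.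
set n2 := #|{ffun 'I_N -> 'I_n.+1}|%:R ^+ (2 * m) : R.
have n20 : 0 < n2 by rewrite exprn_gt0// ltr0n; apply/card_gt0P; exists i0.
exists (n2 * \sum_f C f).
  rewrite mulr_gt0// (bigD1 i0)//= ltr_pwDl//; first by have [] := HC i0.
  by apply: sumr_ge0 => f _; have [/ltW] := HC f.
move=> x Y J Y1 mJ JI.
have Y0 : 0 < Y by apply: lt_le_trans Y1.
have q0 : 0 <= Y ^+ 6 by rewrite exprn_ge0// ltW.
pose A (f : {ffun 'I_N -> 'I_n.+1}) w := avg X x (Y ^+ 6) (J `&` cell eps dl f) w.
have mJf (f : {ffun 'I_N -> 'I_n.+1}) : measurable (J `&` cell eps dl f) by apply: measurableI => //; exact: measurable_cell.
have JB y : J y -> forall l, 0 <= tnth y l <= B by move=> /JI Iy l; exact: IB.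
have JfB (f : {ffun 'I_N -> 'I_n.+1}) y : (J `&` cell eps dl f) y -> forall l, 0 <= tnth y l <= B.
  by move=> [/JB].
have iA f : P.-integrable setT (EFin \o (fun w => A f w ^+ (2 * m))).
  have [K HK] := avg_le mXj (mJf f) (JfB f) q0.
  apply: (@integrable_bounded _ _ _ P _ (K ^+ (2 * m))).
    by apply: measurable_funX; exact: (measurable_avg P mXj x (mJf f) (JfB f) q0).
  move=> w; rewrite normrX lerXn2r ?nnegrE ?(le_trans (normr_ge0 _) (HK x w))//.
  exact: HK.
have [iS ES] := Rintegral_sum (index_enum _) iA.
have iJ : P.-integrable setT (EFin \o (fun w => avg X x (Y ^+ 6) J w ^+ (2 * m))).
  have [K HK] := avg_le mXj mJ JB q0.
  apply: (@integrable_bounded _ _ _ P _ (K ^+ (2 * m))).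
    by apply: measurable_funX; exact: (measurable_avg P mXj x mJ JB q0).
  move=> w; rewrite normrX lerXn2r ?nnegrE ?(le_trans (normr_ge0 _) (HK x w))//.
apply: (@le_trans _ _ (\int[P]_w (n2 * \sum_f A f w ^+ (2 * m)))).
  apply: le_Rintegral => //; first exact: (integrableZl measurableT n2 iS).
  move=> w _; rewrite (avg_sum x w mJ (@measurable_cell eps dl n.+1) q0 JB).
    exact: sum_powr_le.
  by move=> y /JI; exact: sumI.
rewrite RintegralZl// ES -[leRHS]mulrA ler_pM2l// mulr_suml; apply: ler_sum => f _.
have [Cf Hf] := HC f; apply: le_trans (ler_norm _) _; apply: le_trans (Hf x Y J Y1 mJ JI) _.
by rewrite ler_pM2l// lerXn2r ?nnegrE ?powR_ge0// ler_powR// lerN2.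
Qed.

End moment_bounds.

(** * Regularity of the averages *)

Lemma Rintegral_norm_le dT (T : measurableType dT) (R : realType)
    (mu : {measure set T -> \bar R}) (f : T -> R) (g : T -> \bar R) (K : R) :
  mu.-integrable setT (EFin \o f) -> (forall s, (`|f s|%:E <= g s)%E) ->
  (\int[mu]_s g s <= K%:E)%E -> `|\int[mu]_s f s| <= K.
Proof.
move=> fi fg gK; rewrite -lee_fin (EFin_normr_Rintegral measurableT fi).
have [/= mf _] := integrableP _ _ _ fi.
apply: le_trans (le_abse_integral _ measurableT mf) _.
by apply: le_trans gK; apply: ge0_le_integralT => s _; [exact: abse_ge0|exact: fg].
Qed.

Section kernel_lipschitz.
Variable R : realType.

Lemma pkd_lipschitz d q (y y' : 'I_d -> R) : 0 <= q ->
  `|pkd q y - pkd q y'| <= q ^+ d.+1 * \sum_i `|y i - y' i|.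
Proof.
move=> q0; elim: d y y' => [|d IH] y y'; first by rewrite /pkd !big_ord0 subrr normr0 mulr0.
rewrite /pkd !big_ord_recl -/(pkd q (fun i => y (lift ord0 i))) -/(pkd q (fun i => y' (lift ord0 i))).
set A := pkd _ _; set A' := pkd _ _.
have -> : pk q (y ord0) * A - pk q (y' ord0) * A' =
   (pk q (y ord0) - pk q (y' ord0)) * A + pk q (y' ord0) * (A - A') by ring.
apply: (le_trans (ler_normD _ _)); rewrite [leRHS]mulrDr; apply: lerD; rewrite normrM.
  rewrite (_ : q ^+ d.+2 * _ = (q ^+ 2 * `|y ord0 - y' ord0|) * q ^+ d); last by rewrite -addn2 exprD; ring.
  apply: ler_pM => //; first exact: pk_lipschitz.
  by rewrite ger0_norm ?pkd_ge0// pkd_le.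
rewrite exprS -mulrA; apply: ler_pM => //; last exact: IH.
by rewrite ger0_norm ?pk_ge0// pk_le.
Qed.

End kernel_lipschitz.

Section rectangles.
Variables (R : realType) (N : nat).
Local Notation leb := (@lebesgue_measure R).
Implicit Types (s t : N.-tuple R).

Lemma measurable_rect (a b : N.-tuple R) : measurable (rect a b).
Proof.
rewrite (_ : rect a b = \bigcap_(l in setT)
   ((fun v : N.-tuple R => tnth v l) @^-1` `[tnth a l, tnth b l])).
  apply: fin_bigcap_measurable => // l _.
  rewrite -[X in measurable X]setTI; apply: measurable_tnth => //; exact: measurable_itv.
apply/seteqP; split => [y H l _|y H l] /=; first by rewrite in_itv/= H.
by have := H l I; rewrite /= in_itv.
Qed.

Lemma lebT_rect (a b : N.-tuple R) : (forall l, tnth a l <= tnth b l) ->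
  lebT R N (rect a b) = (\prod_l (tnth b l - tnth a l))%:E.
Proof.
move=> ab.
transitivity (\int[lebT R N]_s (\1_(rect a b) s)%:E)%E.
  by rewrite integral_indic ?setIT//; exact: measurable_rect.
transitivity (\int[lebT R N]_s (\big[*%E/1%E]_(l < N)
    (\1_(`[tnth a l, tnth b l]%classic : set R) (tnth s l))%:E))%E.
  apply: eq_integral => s _; rewrite prodEFin; congr (_%:E).
  rewrite indicE; case: (boolP (s \in _)) => [|].
    by rewrite inE => H; rewrite big1// => l _; rewrite indicE mem_set//= in_itv/= H.
  rewrite notin_setE => /existsNP[l]Hl; rewrite (bigD1 l)//= indicE memNset ?mul0r//.
rewrite (integral_lebT_prod (f := fun l r => (\1_(`[tnth a l, tnth b l]%classic : set R) r)%:E))//.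
  rewrite -prodEFin; apply: eq_bigr => l _.
  transitivity (leb (`[tnth a l, tnth b l]%classic `&` setT)).
    by apply: (@integral_indic _ _ R leb setT measurableT); exact: measurable_itv.
  rewrite setIT [LHS](lebesgue_measure_itv `[tnth a l, tnth b l])/= lte_fin.
  by have := ab l; rewrite le_eqVlt => /orP[/eqP->|->//]; rewrite ltxx subrr.
by move=> i; apply/measurable_EFinP; apply: measurable_indic; exact: measurable_itv.
Qed.

Lemma lebT_rect_le (a b : N.-tuple R) (C : R) :
  (forall l, tnth a l <= tnth b l) -> (forall l, tnth b l - tnth a l <= C) ->
  (lebT R N (rect a b) <= (C ^+ N)%:E)%E.
Proof.
move=> ab C1; rewrite lebT_rect// lee_fin.
have -> : C ^+ N = \prod_(l < N) C by rewrite prodr_const card_ord.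
by apply: ler_prod => l _; rewrite subr_ge0 ab C1.
Qed.

Definition setl (a : N.-tuple R) (l : 'I_N) (r : R) : N.-tuple R :=
  [tuple if i == l then r else tnth a i | i < N].

(** A point of one rectangle outside the other has some coordinate l between t_l and t'_l, hence
    lies in the corresponding thin slice of the big rectangle. *)
Lemma indic_rect_diff (a b t t' : N.-tuple R) s :
  rect a b t -> rect a b t' ->
  `|\1_(rect a t) s - \1_(rect a t') s| <=
  \sum_l \1_(rect (setl a l (Num.min (tnth t l) (tnth t' l)))
                  (setl b l (Num.max (tnth t l) (tnth t' l)))) s :> R.
Proof.
move=> It It'.
wlog [st st'] : t t' It It' / rect a t s /\ ~ rect a t' s.
  move=> W; rewrite !indicE.
  have [ht|ht] := pselect (rect a t s); have [ht'|ht'] := pselect (rect a t' s).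
  - by rewrite !mem_set// subrr normr0 sumr_ge0.
  - have := W t t' It It' (conj ht ht'); rewrite !indicE; apply: le_trans.
    by rewrite lexx.
  - have := W t' t It' It (conj ht' ht); rewrite !indicE distrC => /le_trans; apply.
    by apply: ler_sum => l _; rewrite minC maxC.
  - by rewrite !memNset// subrr normr0 sumr_ge0.
have [l Hl] : exists l, tnth t' l < tnth s l.
  apply: contrapT => /forallNP H; apply: st' => l; have /andP[-> _] := st l.
  by rewrite leNgt/=; apply/negP/H.
rewrite (bigD1 l)//= [X in _ <= X + _]indicE mem_set; last first.
  move=> i; rewrite !tnth_mktuple; have /andP[s1 s2] := st i; have /andP[t1 t2] := It i.
  case: eqP => [->|_]; last by rewrite s1 (le_trans s2 t2).
  by rewrite ge_min (ltW Hl) orbT le_max; have /andP[_ ->] := st l.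
rewrite !indicE mem_set// memNset// subr0 normr1 lerDl; exact: sumr_ge0.
Qed.

Lemma lebT_slice_le (a b : N.-tuple R) (C u v : R) l : (forall i, tnth a i <= tnth b i) ->
  1 <= C -> (forall i, tnth b i - tnth a i <= C) ->
  (lebT R N (rect (setl a l (Num.min u v)) (setl b l (Num.max u v))) <= (C ^+ N * `|u - v|)%:E)%E.
Proof.
move=> ab C1 abC; rewrite lebT_rect; last first.
  by move=> i; rewrite !tnth_mktuple; case: ifP => // _; rewrite ge_min !le_max lexx.
rewrite lee_fin (bigD1 l)//= !tnth_mktuple eqxx mulrC ler_pM//.
- by apply: prodr_ge0 => i /negbTE il; rewrite !tnth_mktuple il subr_ge0.
- by rewrite subr_ge0 ge_min !le_max lexx.
- have -> : C ^+ N = \prod_(i < N) C by rewrite prodr_const card_ord.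
  rewrite [leRHS](bigD1 l)//=; apply: le_trans (ler_peMl _ C1); last first.
    by apply: prodr_ge0 => i _; rewrite (le_trans _ C1).
  apply: ler_prod => i /negbTE il; rewrite !tnth_mktuple il subr_ge0 ab; exact: abC.
- by case: (leP u v) => uv; rewrite ?ler_norm// distrC ler_norm.
Qed.

End rectangles.

Section approximation.
Context (R : realType) (dO : measure_display) (Omega : measurableType dO).
Variables (P : probability Omega R) (N d : nat) (alpha : R) (h : 'I_N -> N.-tuple R -> R) (c : R).
Variable X : 'I_d -> Omega -> N.-tuple R -> R.
Hypotheses (al0 : 0 < alpha) (al2 : alpha <= 2) (c0 : 0 < c).
Hypothesis mXj : forall k, measurable_fun [set: Omega * N.-tuple R] (fun p => X k p.1 p.2).
Hypothesis HX : is_LMSS P alpha h c X.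
Variables (eps T : R).
Hypotheses (eps0 : 0 < eps) (epsT : eps < T).
Local Notation I := (rect (cst_pt N eps) (cst_pt N T)).
Local Notation rc t := (rect (cst_pt N eps) t).
Implicit Types (s t : N.-tuple R) (w : Omega) (x : 'I_d -> R).

Definition approxL q w x t : R :=
  \int[lebT R N]_s (\1_(rc t) s * pkd q (incr X x w s)).

Let T0 : 0 < T. Proof. exact: lt_trans epsT. Qed.

Lemma box_I J : J `<=` I -> forall y, J y -> forall l, 0 <= tnth y l <= T.
Proof.
move=> JI y /JI Iy l; have /andP[h1 h2] := Iy l; rewrite !tnth_nseq in h1 h2.
by rewrite h2 andbT (le_trans (ltW eps0)).
Qed.

Lemma sub_rect t : I t -> rc t `<=` I.
Proof.
move=> It s st l; have /andP[-> h2] := st l; have /andP[_ h3] := It l.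
exact: le_trans h3.
Qed.

Lemma measurable_incr_section x w k :
  measurable_fun [set: N.-tuple R] (fun s => incr X x w s k).
Proof.
exact: (measurableT_comp (measurable_incr_joint mXj x k) (@measurable_pair1 _ _ Omega _ w)).
Qed.

Lemma measurable_pkd_section q x w :
  measurable_fun [set: N.-tuple R] (fun s => pkd q (incr X x w s)).
Proof. by apply: measurable_pkd => k; exact: measurable_incr_section. Qed.

Lemma integrable_approxL q w x J : 0 <= q -> measurable J -> J `<=` I ->
  (lebT R N).-integrable setT (fun s => (\1_J s * pkd q (incr X x w s))%:E).
Proof.
move=> q0 mJ JI.
apply: (le_integrable measurableT _ _ (integrable_bounded_set (q ^+ d) mJ (box_I JI))).
  apply/measurable_EFinP; apply: measurable_funM; first exact: measurable_indic.
  exact: measurable_pkd_section.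
move=> s _; rewrite /= lee_fin ger0_norm ?mulr_ge0 ?pkd_ge0// ger0_norm ?mulr_ge0 ?exprn_ge0//.
by rewrite ler_wpM2l// pkd_le.
Qed.

Lemma approxL_ge0 q w x t : 0 <= q -> 0 <= approxL q w x t.
Proof.
move=> q0; rewrite /approxL /Rintegral fine_ge0// integral_ge0// => s _.
by rewrite lee_fin mulr_ge0 ?pkd_ge0.
Qed.

Lemma approxL_step q w x t : 0 <= q -> I t ->
  approxL (2 * q) w x t - approxL q w x t = avg X x q (rc t) w.
Proof.
move=> q0 It; have mt := @measurable_rect R N (cst_pt N eps) t.
rewrite /approxL -RintegralB//.
- by apply: eq_Rintegral => s _; rewrite -mulrBr.
- by apply: integrable_approxL => //; [rewrite mulr_ge0|exact: sub_rect].
- by apply: integrable_approxL => //; exact: sub_rect.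
Qed.

Let V := (1 + T) ^+ N.

Lemma approxL_le q w x t : 0 <= q -> I t -> approxL q w x t <= V * q ^+ d.
Proof.
move=> q0 It; rewrite -[leLHS]ger0_norm ?approxL_ge0//.
apply: (Rintegral_norm_le (g := fun s => ((q ^+ d)%:E * (\1_(rc t) s)%:E)%E)).
- by apply: integrable_approxL => //; [exact: measurable_rect|exact: sub_rect].
- move=> s; rewrite -EFinM lee_fin ger0_norm ?mulr_ge0 ?pkd_ge0// mulrC ler_wpM2r//.
  exact: pkd_le.
- rewrite ge0_integralZl_EFin ?exprn_ge0//; last first.
    by apply/measurable_EFinP; apply: measurable_indic; exact: measurable_rect.
  rewrite integral_indic// ?setIT; last exact: measurable_rect.
  rewrite mulrC EFinM lee_wpmul2l ?lee_fin ?exprn_ge0//.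
  apply: lebT_rect_le => l; have /andP[h1 h2] := It l; first exact: h1.
  by move: h1 h2 eps0; rewrite !tnth_nseq; lra.
Qed.

(** Moving x changes the kernel, which has Lipschitz constant q^(d+1); moving t changes the domain
    by slices on which the kernel is at most q^d <= q^(d+1). *)
Lemma approxL_lipschitz q w x x' t t' : 1 <= q -> I t -> I t' ->
  `|approxL q w x t - approxL q w x' t'| <=
  V * q ^+ d.+1 * (\sum_i `|x i - x' i| + \sum_l `|tnth t l - tnth t' l|).
Proof.
move=> q1 It It'; have q0 : 0 <= q by apply: le_trans q1.
set dx := \sum_i _; set dt := \sum_l _.
have mt u := @measurable_rect R N (cst_pt N eps) u.
have it u y : I u -> (lebT R N).-integrable setT (fun s => (\1_(rc u) s * pkd q (incr X y w s))%:E).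
  by move=> Iu; apply: integrable_approxL => //; exact: sub_rect.
rewrite /approxL -RintegralB//; [|exact: it|exact: it].
pose S l : set (N.-tuple R) := rect (setl (cst_pt N eps) l (Num.min (tnth t l) (tnth t' l)))
                  (setl (cst_pt N T) l (Num.max (tnth t l) (tnth t' l))).
have mS l : measurable (S l) := @measurable_rect R N _ _.
have dx0 : 0 <= dx by exact: sumr_ge0.
apply: (Rintegral_norm_le (g := fun s => ((q ^+ d.+1 * dx)%:E * (\1_(rc t) s)%:E +
    (q ^+ d)%:E * \sum_l (\1_(S l) s)%:E)%E)).
- exact: (integrableB measurableT (it _ x It) (it _ x' It')).
- move=> s; rewrite sumEFin -!EFinM -EFinD lee_fin.
  set p := pkd q _; set p' := pkd q _.
  have -> : \1_(rc t) s * p - \1_(rc t') s * p' =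
     \1_(rc t) s * (p - p') + (\1_(rc t) s - \1_(rc t') s) * p' by ring.
  apply: (le_trans (ler_normD _ _)); rewrite !normrM; apply: lerD.
    rewrite ger0_norm// mulrC ler_wpM2r//.
    apply: le_trans (pkd_lipschitz _ _ q0) _; rewrite ler_wpM2l ?exprn_ge0//.
    by apply: ler_sum => i _; rewrite /incr opprB addrC addrA subrK distrC addrC.
  rewrite mulrC; apply: ler_pM => //; first by rewrite ger0_norm ?pkd_ge0// pkd_le.
  exact: indic_rect_diff.
have mi (A : set (N.-tuple R)) : measurable A -> measurable_fun setT (fun s => (\1_A s)%:E : \bar R).
  by move=> mA; apply/measurable_EFinP; exact: measurable_indic.
rewrite ge0_integralD//; last 4 first.
- by move=> s _; rewrite mule_ge0 ?lee_fin// mulr_ge0// exprn_ge0.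
- by apply: emeasurable_funM => //; exact: mi.
- by move=> s _; rewrite mule_ge0 ?lee_fin ?exprn_ge0// sume_ge0// => l _; rewrite lee_fin.
- by apply: emeasurable_funM => //; apply: emeasurable_sum => l; exact: mi.
rewrite ge0_integralZl_EFin ?mulr_ge0 ?exprn_ge0//; last exact: mi.
rewrite ge0_integralZl_EFin ?exprn_ge0//; last 2 first.
- by move=> s _; rewrite sume_ge0// => l _; rewrite lee_fin.
- by apply: emeasurable_sum => l; exact: mi.
rewrite ge0_integral_sum//; last by move=> l; exact: mi.
have cT i : tnth (cst_pt N T) i - tnth (cst_pt N eps) i <= 1 + T.
  by move: eps0 T0; rewrite !tnth_nseq; lra.
have V0 : 0 <= V by rewrite exprn_ge0// addr_ge0// ltW.
rewrite mulrDr EFinD; apply: leeD.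
  rewrite integral_indic// setIT.
  rewrite (_ : V * _ * _ = q ^+ d.+1 * dx * V); last by ring.
  rewrite [leRHS]EFinM lee_wpmul2l ?lee_fin ?mulr_ge0 ?exprn_ge0//.
  apply: lebT_rect_le => l; have /andP[h1 h2] := It l; first exact: h1.
  by move: h1 h2 eps0; rewrite !tnth_nseq; lra.
apply: (@le_trans _ _ ((q ^+ d)%:E * (V * dt)%:E)%E); last first.
  rewrite -EFinM lee_fin mulrCA -mulrA ler_wpM2l// ler_wpM2r ?sumr_ge0//.
  by rewrite exprS ler_peMl ?exprn_ge0.
rewrite lee_wpmul2l ?lee_fin ?exprn_ge0// mulr_sumr -sumEFin.
apply: lee_sum => l _; rewrite integral_indic// setIT.
apply: lebT_slice_le => //; last by rewrite lerDl ltW.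
by move=> i; rewrite !tnth_nseq ltW.
Qed.

End approximation.

(** The series of all [S k] has finite integral, so it is finite almost everywhere and bounds each
    of its terms. *)
Lemma ae_bounded_summable dT (T : measurableType dT) (R : realType)
    (mu : {measure set T -> \bar R}) (S : nat -> T -> R) (K : R) : 0 <= K ->
  (forall k, measurable_fun setT (S k)) -> (forall k w, 0 <= S k w) ->
  (forall k, (\int[mu]_w (S k w)%:E <= (K / (2 ^ k.+1)%:R)%:E)%E) ->
  {ae mu, forall w, exists B, forall k, S k w <= B}.
Proof.
move=> K0 mS S0 SK.
pose F w := (\sum_(0 <= k <oo) (S k w)%:E)%E.
have mF : measurable_fun setT F.
  apply: (@ge0_emeasurable_sum _ _ _ _ (fun k w => (S k w)%:E) xpredT).
    by move=> k w _ _; rewrite lee_fin.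
  by move=> k _; exact/measurable_EFinP.
have F0 w : (0 <= F w)%E by apply: nneseries_ge0 => k _ _; rewrite lee_fin.
have iF : mu.-integrable setT F.
  apply/integrableP; split => //.
  apply: (@le_lt_trans _ _ (\int[mu]_w F w)%E).
    by apply: ge0_le_integralT => w _; rewrite ?abse_ge0 ?gee0_abs.
  rewrite integral_nneseries//; last 2 first.
  - by move=> k; exact/measurable_EFinP.
  - by move=> k w _; rewrite lee_fin.
  apply: (@le_lt_trans _ _ K%:E); last by rewrite ltry.
  apply: le_trans (epsilon_trick0 xpredT K0).
  apply: lee_nneseries => [k _ _|k _]; last exact: SK.
  by apply: integral_ge0 => w _; rewrite lee_fin.
apply: filterS (integrable_ae measurableT iF) => w /(_ I) Fw.
exists (fine (F w)) => k; rewrite -lee_fin fineK//.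
apply: le_trans (@nneseries_lim_ge _ (fun k => (S k w)%:E) xpredT 0 k.+1 _).
  by rewrite big_mkcond/= big_nat_recr//= leeDr// sume_ge0// => i _; rewrite lee_fin.
by move=> i _ _; rewrite lee_fin.
Qed.

Section almost_sure.
Context (R : realType) (dO : measure_display) (Omega : measurableType dO).
Variables (P : probability Omega R) (N d : nat) (alpha : R) (h : 'I_N -> N.-tuple R -> R) (c : R).
Variable X : 'I_d -> Omega -> N.-tuple R -> R.
Hypotheses (al0 : 0 < alpha) (al2 : alpha <= 2) (c0 : 0 < c).
Hypothesis mXj : forall k, measurable_fun [set: Omega * N.-tuple R] (fun p => X k p.1 p.2).
Hypothesis HX : is_LMSS P alpha h c X.
Variables (eps T : R).
Hypotheses (eps0 : 0 < eps) (epsT : eps < T).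
Hypothesis hh : hurst_assumptions h.
Local Notation I := (rect (cst_pt N eps) (cst_pt N T)).
Local Notation rc t := (rect (cst_pt N eps) t).
Hypothesis dinf : d%:R < inf [set \sum_(l < N) (h l v)^-1 | v in I].
Implicit Types (s t : N.-tuple R) (w : Omega) (x : 'I_d -> R).

Local Notation q k := (2 ^+ k : R).
Local Notation M k w x t := (avg X x (q k) (rc t) w).

Let q0 k : 0 < q k. Proof. by rewrite exprn_gt0. Qed.
Let q1 k : 1 <= q k. Proof. by rewrite exprn_ege1// ler1n. Qed.

(** With Y = 2^(k/6), so that Y^6 = q, the moment of order 2m decays like q^(-be m / 3), which beats
    any prescribed power for m large. *)
Lemma dyadic_moment D : exists2 m, (0 < m)%N & exists2 C, 0 < C &
  forall k x t, I t -> \int[P]_w (M k w x t ^+ (2 * m)) <= C / q k ^+ D.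
Proof.
have [be be0 Hbe] := moment_bound al0 al2 c0 mXj HX hh eps0 epsT dinf.
have [m mD] : exists m : nat, D%:R <= be / 6 * (2 * m.+1)%:R.
  have /archi_boundP : 0 <= D%:R / be by rewrite divr_ge0// ltW.
  (* n exceeds D / be, and be / 6 times 2 (3n + 1) is at least be n. *)
  set n := Num.bound _ => nb; exists (3 * n)%N.
  rewrite mulrAC ler_pdivlMr// -ler_pdivrMl//; apply: (@le_trans _ _ (n%:R * 6)).
    by rewrite mulrA ler_pM2r// mulrC ltW.
  by rewrite -natrM ler_nat; lia.
have [C C0 HC] := Hbe m.+1.
exists m.+1 => //; exists C => // k x t It.
pose Y : R := 2 `^ (k%:R / 6).
have Y1 : 1 <= Y by rewrite /Y -[leLHS](powRr0 2) ler_powR ?ler1n// divr_ge0.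
have YE : Y ^+ 6 = q k.
  by rewrite -powR_mulrn ?powR_ge0// -powRrM divfK// powR_mulrn.
have := HC x Y (rc t) Y1 (@measurable_rect R N _ _) (sub_rect It).
rewrite YE => /le_trans; apply; rewrite ler_pM2l// -exprVn.
have -> : (Y `^ (- be)) ^+ (2 * m.+1) = 2 `^ (k%:R / 6 * (- be) * (2 * m.+1)%:R).
  by rewrite -powR_mulrn ?powR_ge0// /Y -!powRrM mulrA.
have -> : (q k)^-1 ^+ D = 2 `^ (- (k%:R * D%:R)).
  by rewrite powRN -natrM powR_mulrn// exprVn exprM.
rewrite ler_powR ?ler1n//.
have := ler_wpM2l (ler0n R k) mD; lra.
Qed.

Section grid.
Variable k : nat.
Local Notation n := ((2 ^ k) ^ (d + 3))%N.
(** Mesh q^(-(d+2)) on an interval of length 2q requires 2 q^(d+3) steps, which is 2n; the same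
    count covers [eps, T] once T - eps <= q. *)
Definition grid : finType := ({ffun 'I_d -> 'I_(2 * n).+1} * {ffun 'I_N -> 'I_(2 * n).+1})%type.

Definition gridx (g : grid) : 'I_d -> R := fun i => (g.1 i)%:R / q k ^+ (d + 2) - q k.

Definition gridt (g : grid) : N.-tuple R :=
  [tuple Num.min T (eps + (g.2 l)%:R / q k ^+ (d + 2)) | l < N].

Lemma gridt_in g : I (gridt g).
Proof.
move=> l; rewrite tnth_mktuple !tnth_nseq ge_min lexx le_min (ltW epsT)/= andbT.
by rewrite lerDl divr_ge0// exprn_ge0.
Qed.

Lemma card_grid : #|grid|%:R <= 3 ^+ (d + N) * q k ^+ ((d + 3) * (d + N)) :> R.
Proof.
rewrite card_prod !card_ffun !card_ord -expnD.
rewrite natrX exprM -exprMn lerXn2r ?nnegrE ?mulr_ge0 ?exprn_ge0//.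
rewrite -natrX -natrX -natrM ler_nat.
have : (0 < (2 ^ k) ^ (d + 3))%N by rewrite !expn_gt0.
lia.
Qed.

Lemma grid_approx x t : (forall i, `|x i| <= q k) -> I t -> T - eps <= q k ->
  exists g, (forall i, `|x i - gridx g i| <= (q k ^+ (d + 2))^-1) /\
            (forall l, `|tnth t l - tnth (gridt g) l| <= (q k ^+ (d + 2))^-1).
Proof.
move=> xq It Tq.
set Q := q k ^+ (d + 2); have Q0 : 0 < Q by rewrite exprn_gt0.
have nE : n%:R = Q * q k.
  by rewrite !natrX /Q -exprSr addn2 addn3.
have tr (y : R) : 0 <= y -> y <= 2 * q k -> exists j : 'I_(2 * n).+1, 0 <= y - j%:R / Q <= Q^-1.
  move=> y0 yq; have yQ : 0 <= y * Q by rewrite mulr_ge0// ltW.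
  have h1 : (Num.trunc (y * Q) < (2 * n).+1)%N.
    rewrite ltnS truncn_le_nat; apply: (@le_lt_trans _ _ (2 * n)%:R).
      by rewrite natrM nE [Q * _]mulrC mulrA ler_pM2r.
    by rewrite ltr_nat.
  exists (Ordinal h1) => /=; have /andP[h2 h3] := truncn_itv yQ.
  rewrite subr_ge0 ler_pdivrMr// h2/= lerBlDr -[X in X + _]mul1r -mulrDl ler_pdivlMr//.
  by rewrite addrC natr1 ltW.
have /choice[gx Hx] : forall i, exists j : 'I_(2 * n).+1, 0 <= x i + q k - j%:R / Q <= Q^-1.
  by move=> i; have := xq i; rewrite ler_norml => /andP[h1 h2]; apply: tr; lra.
have /choice[gt Ht] : forall l, exists j : 'I_(2 * n).+1, 0 <= tnth t l - eps - j%:R / Q <= Q^-1.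
  move=> l; have /andP[] := It l; rewrite !tnth_nseq => h1 h2; have := q0 k.
  by move=> ?; apply: tr; lra.
exists (finfun gx, finfun gt); split => [i|l].
  have /andP[h1 h2] := Hx i; rewrite /gridx/= ffunE -/Q ler_norml.
  have Qi : 0 < Q^-1 by rewrite invr_gt0.
  by apply/andP; split; lra.
have /andP[h1 h2] := Ht l; have /andP[] := It l; rewrite !tnth_nseq => t1 t2.
rewrite tnth_mktuple /= ffunE -/Q min_r; last by lra.
rewrite ler_norml; have Qi : 0 < Q^-1 by rewrite invr_gt0.
by apply/andP; split; lra.
Qed.

End grid.

Let box_t t : I t -> forall y, rc t y -> forall l, 0 <= tnth y l <= T.
Proof. by move=> It; apply: (box_I eps0); exact: sub_rect. Qed.

(** The expected sum over the grid stays summable in k even after multiplication by q; that spare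
    factor q becomes the pathwise geometric decay. *)
Lemma ae_grid_bound : exists2 m, (0 < m)%N & {ae P, forall w, exists2 K, 0 < K &
  forall k (g : grid k), q k * (M k w (gridx g) (gridt g) ^+ (2 * m)) <= K}.
Proof.
pose D := ((d + 3) * (d + N))%N.
(* q^D pays for the number of grid points, one more power for the factor q, and the last one leaves
   the summable 2^(-k). *)
have [m m0 [C C0 HC]] := dyadic_moment D.+2; exists m => //.
pose S k w := q k * \sum_(g : grid k) M k w (gridx g) (gridt g) ^+ (2 * m).
have ev (b : R) : 0 <= b ^+ (2 * m) by rewrite exprM exprn_ge0// sqr_ge0.
have mM k x t : I t -> measurable_fun setT (fun w => M k w x t ^+ (2 * m)).
  move=> It; apply: measurable_funX.
  by apply: (measurable_avg P mXj x (@measurable_rect R N _ _) (box_t It)); exact: ltW.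
have mS k : measurable_fun setT (S k).
  by apply: measurable_funM => //; apply: measurable_sum => g; apply: mM; exact: gridt_in.
have S0 k w : 0 <= S k w by rewrite mulr_ge0 ?(ltW (q0 k))// sumr_ge0.
have iM k x t : I t -> P.-integrable setT (EFin \o (fun w => M k w x t ^+ (2 * m))).
  move=> It; have [K HK] := avg_le mXj (@measurable_rect R N _ _) (box_t It) (ltW (q0 k)).
  apply: (@integrable_bounded _ _ _ P _ (K ^+ (2 * m))); first exact: mM.
  move=> w; rewrite normrX lerXn2r ?nnegrE ?(le_trans (normr_ge0 _) (HK x w))//.
have SK k : (\int[P]_w (S k w)%:E <= (2 * 3 ^+ (d + N) * C / (2 ^ k.+1)%:R)%:E)%E.
  have [iS ES] := Rintegral_sum (index_enum (grid k)) (fun g => iM k (gridx g) (gridt g) (gridt_in g)).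
  have iqS := integrableZl measurableT (q k) iS.
  rewrite -(fineK (integrable_fin_num measurableT iqS)) lee_fin.
  have := RintegralZl (q k) measurableT iS; rewrite {1}/Rintegral ES => ->.
  apply: (@le_trans _ _ (q k * (#|grid k|%:R * (C / q k ^+ D.+2)))).
    rewrite ler_pM2l// mulr_natl -sumr_const; apply: ler_sum => g _.
    by apply: HC; exact: gridt_in.
  rewrite natrX [2 ^+ k.+1]exprS.
  apply: (@le_trans _ _ (q k * (3 ^+ (d + N) * q k ^+ D * (C / q k ^+ D.+2)))).
    rewrite ler_pM2l// ler_wpM2r ?divr_ge0 ?(ltW C0) ?exprn_ge0 ?(ltW (q0 k))//.
    exact: card_grid.
  rewrite le_eqVlt; apply/orP; left; apply/eqP; rewrite !exprS.
  by field; rewrite expf_neq0 ?gt_eqF.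
have K0 : 0 <= 2 * 3 ^+ (d + N) * C by rewrite !mulr_ge0 ?exprn_ge0 ?(ltW C0).
apply: filterS (ae_bounded_summable K0 mS S0 SK) => w [B HB].
exists (B + 1); first by rewrite ltr_wpDl// (le_trans (S0 0 w)).
move=> k g; apply: (@le_trans _ _ (S k w)); last by rewrite (le_trans (HB k))// lerDl.
by rewrite /S ler_pM2l// (bigD1 g)//= lerDl sumr_ge0.
Qed.

(* Grid points are so dense that the Lipschitz constant of order [q ^ (d + 1)]
   costs only a factor [1 / q]. *)
Lemma ae_geometric : {ae P, forall w, exists K th, [/\ 0 < K, 0 < th < 1 &
  forall k x t, (forall i, `|x i| <= q k) -> I t -> T - eps <= q k ->
  `|M k w x t| <= K * th ^+ k]}.
Proof.
have [m m0 H] := ae_grid_bound; apply: filterS H => w [K K0 HK].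
have m20 : (0 < 2 * m)%N by rewrite muln_gt0.
have m2R : 0 < (2 * m)%:R :> R by rewrite ltr0n.
(* The 2m-th root of 1/2: from q M^(2m) <= K follows |M| of order th^k. *)
pose th : R := 2^-1 `^ (2 * m)%:R^-1.
have th0 : 0 < th by rewrite powR_gt0.
have thm : th ^+ (2 * m) = 2^-1.
  by rewrite -powR_mulrn ?(ltW th0)// -powRrM mulVf ?gt_eqF// powRr1.
have th1 : th < 1.
  rewrite ltNge; apply/negP => h1; have : 1 <= th ^+ (2 * m) by rewrite exprn_ege1.
  by rewrite thm; lra.
have thk k : (q k)^-1 = (th ^+ k) ^+ (2 * m) by rewrite -exprVn -thm -!exprM mulnC.
have th_ge k : (q k)^-1 <= th ^+ k.
  have t0 : 0 <= th ^+ k by rewrite exprn_ge0// ltW.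
  by rewrite thk -[leRHS]expr1 ler_wiXn2l// exprn_ile1// ltW.
pose K1 := Num.max 1 K.
pose V := (1 + T) ^+ N * (2 ^+ d.+1 + 1) * (d + N)%:R.
have T0 : 0 < T by apply: lt_trans epsT.
have V0 : 0 <= V by rewrite !mulr_ge0 ?exprn_ge0 ?addr_ge0 ?exprn_ge0 ?(ltW T0).
exists (K1 + V), th; split; [|by rewrite th0|].
  by rewrite ltr_wpDr// lt_max ltr01.
move=> k x t xq It Tq; have [g [gx gt]] := grid_approx xq It Tq.
rewrite mulrDl.
have -> : M k w x t = M k w (gridx g) (gridt g) + (M k w x t - M k w (gridx g) (gridt g)) by ring.
apply: le_trans (ler_normD _ _) _; apply: lerD.
  have K11 : 1 <= K1 by rewrite le_max lexx.
  have K10 : 0 <= K1 by apply: le_trans K11.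
  (* [K1] is the maximum with 1 so that K <= K1 <= K1^(2m), which avoids taking a root of K. *)
  rewrite -(ler_pXn2r m20) ?nnegrE ?mulr_ge0 ?exprn_ge0 ?(ltW th0)//.
  rewrite -normrX ger0_norm; last by rewrite exprM exprn_ge0// sqr_ge0.
  rewrite exprMn -thk ler_pdivlMr// mulrC; apply: (le_trans (HK k g)).
  apply: (@le_trans _ _ K1); first by rewrite le_max lexx orbT.
  by rewrite -[leLHS]expr1 ler_weXn2l.
have Ig := gridt_in g.
rewrite -(approxL_step mXj eps0 w x (ltW (q0 k)) It) -(approxL_step mXj eps0 w (gridx g) (ltW (q0 k)) Ig).
have Lx q' : 1 <= q' -> `|approxL X eps q' w x t - approxL X eps q' w (gridx g) (gridt g)| <=
   (1 + T) ^+ N * q' ^+ d.+1 * ((d + N)%:R * (q k ^+ (d + 2))^-1).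
  move=> q'1; apply: le_trans (approxL_lipschitz mXj eps0 epsT w x (gridx g) q'1 It Ig) _.
  rewrite ler_wpM2l ?mulr_ge0 ?exprn_ge0 ?addr_ge0 ?(ltW T0) ?(le_trans _ q'1)//.
  rewrite natrD mulrDl; apply: lerD; rewrite mulr_natl -[X in _ *+ X]card_ord -sumr_const; exact: ler_sum.
have -> (a b a' b' : R) : a - b - (a' - b') = (a - a') - (b - b') by ring.
apply: le_trans (ler_normB _ _) _.
have q21 : 1 <= 2 * q k by have := q1 k; lra.
apply: le_trans (lerD (Lx _ q21) (Lx _ (q1 k))) _.
apply: (@le_trans _ _ (V * (q k)^-1)); last by rewrite ler_wpM2l.
rewrite /V exprMn addn2 !exprS le_eqVlt; apply/orP; left; apply/eqP.
by field; rewrite expf_neq0 ?gt_eqF.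
Qed.

End almost_sure.

(** * The local time *)

Section geometric_limits.
Variable R : realType.
Implicit Types (u : nat -> R) (K th : R).

Lemma geometric_dist u K th k0 k n : 0 <= K -> 0 < th < 1 ->
  (forall k, (k0 <= k)%N -> `|u k.+1 - u k| <= K * th ^+ k) ->
  (k0 <= k)%N -> (k <= n)%N -> `|u n - u k| <= K / (1 - th) * th ^+ k.
Proof.
move=> K0 /andP[th0 th1] H kk; elim: n => [|n IH].
  rewrite leqn0 => /eqP->; rewrite subrr normr0 mulr_ge0 ?exprn_ge0 ?(ltW th0)//.
  by rewrite divr_ge0// subr_ge0 ltW.
have main j : (k <= j)%N -> `|u j - u k| <= K / (1 - th) * (th ^+ k - th ^+ j).
  elim: j {IH} => [|j IHj]; first by rewrite leqn0 => /eqP->; rewrite !subrr normr0 mulr0.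
  rewrite leq_eqVlt => /orP[/eqP->|]; first by rewrite !subrr normr0 mulr0.
  rewrite ltnS => kj; rewrite (_ : u j.+1 - u k = (u j.+1 - u j) + (u j - u k)); last by ring.
  apply: (le_trans (ler_normD _ _)).
  apply: (le_trans (lerD (H _ (leq_trans kk kj)) (IHj kj))).
  rewrite le_eqVlt exprS; apply/orP; left; apply/eqP; field.
  by rewrite subr_eq0 gt_eqF.
move=> kn; apply: (le_trans (main _ kn)).
rewrite ler_wpM2l ?divr_ge0 ?subr_ge0 ?(ltW th1)//.
by rewrite gerBl exprn_ge0// ltW.
Qed.

Lemma geometric_small K th (e : R) : 0 < th < 1 -> 0 < e ->
  \forall k \near \oo, K * th ^+ k < e.
Proof.
move=> /andP[th0 th1] e0.
have th1' : `|th| < 1 by rewrite gtr0_norm.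
have /cvgrPdist_lt/(_ e e0) := cvg_geometric K th1'.
apply: filterS => k; rewrite /geometric/= sub0r normrN => h.
exact: le_lt_trans (ler_norm _) h.
Qed.

Lemma geometric_cvg u K th k0 : 0 <= K -> 0 < th < 1 ->
  (forall k, (k0 <= k)%N -> `|u k.+1 - u k| <= K * th ^+ k) ->
  cvgn u /\ forall k, (k0 <= k)%N -> `|limn u - u k| <= K / (1 - th) * th ^+ k.
Proof.
move=> K0 th01 H.
have cu : cvgn u.
  apply: cauchy_cvg; apply/cauchy_ballP => e e0.
  have [n0 _ Hn] := geometric_small (K / (1 - th)) th01 (divr_gt0 e0 (ltr0Sn R 1)).
  pose n1 := maxn k0 n0.
  have h1 n : (n1 <= n)%N -> `|u n - u n1| < e / 2.
    move=> nn; apply: le_lt_trans (geometric_dist K0 th01 H (leq_maxl _ _) nn) _.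
    by apply: Hn; rewrite /= leq_maxr.
  exists ([set x | `|x - u n1| < e / 2], [set x | `|x - u n1| < e / 2]) => /=.
    by split; exists n1 => // n; exact: h1.
  move=> [x y] [/= xe ye]; rewrite /ball/= (_ : x - y = (x - u n1) - (y - u n1)); last by ring.
  by apply: le_lt_trans (ler_normB _ _) _; lra.
split=> // k kk.
have c1 : (fun n => `|u n - u k|) @ \oo --> `|limn u - u k|.
  by apply: cvg_norm; apply: cvgB => //; exact: cvg_cst.
rewrite -(cvg_lim _ c1)//; apply: limr_le; first by apply/cvg_ex; exists `|limn u - u k|.
by exists k => // n kn; exact: geometric_dist th01 H kk kn.
Qed.

End geometric_limits.

Section local_time.
Context (R : realType) (dO : measure_display) (Omega : measurableType dO).
Variables (N d : nat).
Variable X : 'I_d -> Omega -> N.-tuple R -> R.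
Hypothesis mXj : forall k, measurable_fun [set: Omega * N.-tuple R] (fun p => X k p.1 p.2).
Variables (eps T : R).
Hypotheses (eps0 : 0 < eps) (epsT : eps < T).
Local Notation I := (rect (cst_pt N eps) (cst_pt N T)).
Local Notation rc t := (rect (cst_pt N eps) t).
Implicit Types (s t : N.-tuple R) (x : 'I_d -> R).
Variable w : Omega.
Local Notation Lk k x t := (approxL X eps (2 ^+ k) w x t).

Variables (K th : R).
Hypotheses (K0 : 0 < K) (th01 : 0 < th < 1).
Hypothesis HG : forall k x t, (forall i, `|x i| <= 2 ^+ k) -> I t -> T - eps <= 2 ^+ k ->
  `|avg X x (2 ^+ k) (rc t) w| <= K * th ^+ k.

Definition ltime x t : R := limn (fun k => Lk k x t).

Let V := (1 + T) ^+ N.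
Let T0 : 0 < T. Proof. exact: lt_trans epsT. Qed.
Let V0 : 0 <= V. Proof. by rewrite exprn_ge0// addr_ge0// ltW. Qed.

(** The geometric bound holds once 2^k exceeds both A and T - eps, so the starting index depends on
    x only through A. *)
Lemma uniform_cvg (A : R) : exists k0, forall x t, (forall i, `|x i| <= A) -> I t ->
  cvgn (fun k => Lk k x t) /\
  forall k, (k0 <= k)%N -> `|ltime x t - Lk k x t| <= K / (1 - th) * th ^+ k.
Proof.
pose B := Num.max 0 (Num.max A (T - eps)).
have B0 : 0 <= B by rewrite le_max lexx.
exists (Num.bound B) => x t xA It; apply: geometric_cvg; [exact: ltW|exact: th01|].
move=> k kB.
have Bk : B <= 2 ^+ k.
  apply: (@le_trans _ _ (Num.bound B)%:R); first by rewrite ltW// archi_boundP.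
  by rewrite -natrX ler_nat (leq_trans kB)// ltnW// ltn_expl.
have [A1 A2] : A <= B /\ T - eps <= B by rewrite /B !le_max !lexx !orbT.
have q2 : 0 <= 2 ^+ k :> R by rewrite exprn_ge0.
rewrite exprS (approxL_step mXj eps0 w x q2 It).
apply: HG => //; last exact: le_trans Bk.
by move=> i; apply: (le_trans (xA i)); exact: le_trans Bk.
Qed.

Lemma cvg_approxL x t : I t -> Lk k x t @[k --> \oo] --> ltime x t.
Proof.
move=> It; have [k0 /(_ x t _ It)[]//] := uniform_cvg (\sum_i `|x i|).
by move=> i; rewrite (bigD1 i)//= lerDl sumr_ge0.
Qed.

Lemma ltime_ge0 x t : I t -> 0 <= ltime x t.
Proof.
move=> It; apply: limr_ge; first by apply/cvg_ex; exists (ltime x t); exact: cvg_approxL.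
by apply: nearW => k; apply: approxL_ge0; rewrite exprn_ge0.
Qed.

Lemma approxL_bounded (A : R) : exists C, forall k x t, (forall i, `|x i| <= A) -> I t ->
  0 <= Lk k x t <= C.
Proof.
have [k0 H] := uniform_cvg A.
pose C1 := K / (1 - th).
have C10 : 0 <= C1.
  by have /andP[_ t1] := th01; rewrite divr_ge0 ?subr_ge0 ?(ltW K0) ?(ltW t1).
exists (V * 2 ^+ k0 ^+ d + C1 + C1) => k x t xA It.
rewrite approxL_ge0 ?exprn_ge0//=.
have q1 (n : nat) : 0 <= 2 ^+ n :> R by rewrite exprn_ge0.
have thn n : C1 * th ^+ n <= C1.
  have /andP[t0 t1] := th01; rewrite ler_piMr// exprn_ile1//; exact: ltW.
have [kk|kk] := leqP k k0.
  apply: le_trans (approxL_le mXj eps0 w x (q1 k) It) _.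
  apply: (@le_trans _ _ (V * 2 ^+ k0 ^+ d)); last by rewrite -addrA lerDl addr_ge0.
  rewrite ler_wpM2l// lerXn2r ?nnegrE//.
  by rewrite ler_weXn2l// ler1n.
have [_ H2] := H x t xA It.
have h1 := le_trans (H2 k (ltnW kk)) (thn k).
have h2 := le_trans (H2 k0 (leqnn _)) (thn k0).
have h3 := approxL_le mXj eps0 w x (q1 k0) It.
rewrite -/V in h3; move: h1 h2; rewrite !ler_norml => /andP[h1 h1'] /andP[h2 h2']; lra.
Qed.

Lemma ltime_continuous (L := fun p : 'rV[R]_d * 'rV[R]_N =>
    ltime (fun k => p.1 ord0 k) [tuple p.2 ord0 l | l < N]) :
  {within [set p | (@tup2row R N @` I) p.2], continuous L}.
Proof.
apply/subspace_continuousP => -[x t] [t0 It0 /= tE].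
pose tt (v : 'rV[R]_N) : N.-tuple R := [tuple v ord0 l | l < N].
pose xx (v : 'rV[R]_d) : 'I_d -> R := fun k => v ord0 k.
have ttE u : tt (tup2row u) = u.
  by apply/eq_from_tnth => l; rewrite tnth_mktuple mxE.
have It : I (tt t) by rewrite -tE ttE.
apply/cvgrPdist_lt => e e0.
(* The extra 1 keeps all x' within distance [de] <= 1 in the range where the convergence is
   uniform. *)
pose A := \sum_i `|xx x i| + 1.
have [k0 H] := uniform_cvg A.
have e4 : 0 < e / 4 by rewrite divr_gt0.
have [n0 _ Hn] := geometric_small (K / (1 - th)) th01 e4.
pose k := maxn k0 n0.
have kk : (k0 <= k)%N by exact: leq_maxl.
have smallk : K / (1 - th) * th ^+ k < e / 4 by apply: Hn; rewrite /= leq_maxr.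
pose La := V * 2 ^+ k ^+ d.+1 * (d + N)%:R + 1.
have Ck0 : 0 <= V * 2 ^+ k ^+ d.+1 by rewrite mulr_ge0// !exprn_ge0.
have La0 : 0 < La by rewrite ltr_wpDl// mulr_ge0.
pose de := Num.min 1 (e / 4 / La).
have de0 : 0 < de by rewrite lt_min ltr01 divr_gt0.
have de1 : de <= 1 by rewrite /de ge_min lexx.
apply/nbhs_ballP; exists de => // -[x' t'] [/= bx bt] [t0' It0' /= tE'].
have It' : I (tt t') by rewrite -tE' ttE.
have dx i : `|xx x i - xx x' i| <= de by have := bx.2 ord0 i; rewrite /ball/= => /ltW.
have dt l : `|tnth (tt t) l - tnth (tt t') l| <= de.
  by rewrite !tnth_mktuple; have := bt.2 ord0 l; rewrite /ball/= => /ltW.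
have xA i : `|xx x i| <= \sum_i `|xx x i| by rewrite (bigD1 i)//= lerDl sumr_ge0.
have h1 : `|L (x, t) - Lk k (xx x) (tt t)| < e / 4.
  have [|_ /(_ k kk)] := H (xx x) (tt t) _ It.
    by move=> i; rewrite (le_trans (xA i))// /A lerDl.
  by move=> /le_lt_trans; apply.
have h2 : `|L (x', t') - Lk k (xx x') (tt t')| < e / 4.
  have [|_ /(_ k kk)] := H (xx x') (tt t') _ It'.
    move=> i; rewrite (_ : xx x' i = xx x i - (xx x i - xx x' i)); last by ring.
    by apply: (le_trans (ler_normB _ _)); apply: lerD => //; exact: le_trans de1.
  by move=> /le_lt_trans; apply.
have q1 : 1 <= 2 ^+ k :> R by rewrite exprn_ege1// ler1n.
have h3 : `|Lk k (xx x) (tt t) - Lk k (xx x') (tt t')| <= e / 4.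
  apply: le_trans (approxL_lipschitz mXj eps0 epsT w _ _ q1 It It') _.
  apply: (@le_trans _ _ (V * 2 ^+ k ^+ d.+1 * ((d + N)%:R * de))).
    rewrite (ler_wpM2l Ck0)//.
    rewrite natrD mulrDl; apply: lerD; rewrite mulr_natl -[X in _ *+ X]card_ord -sumr_const; exact: ler_sum.
  rewrite mulrA; apply: (@le_trans _ _ (La * de)).
    by rewrite ler_wpM2r ?(ltW de0)// /La lerDl.
  rewrite mulrC -ler_pdivlMr//; by rewrite /de ge_min lexx orbT.
change (`|L (x, t) - L (x', t')| < e).
rewrite (_ : L (x, t) - L (x', t') = (L (x, t) - Lk k (xx x) (tt t)) -
   (L (x', t') - Lk k (xx x') (tt t')) + (Lk k (xx x) (tt t) - Lk k (xx x') (tt t'))); last by ring.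
apply: le_lt_trans (ler_normD _ _) _.
have := ler_normB (L (x, t) - Lk k (xx x) (tt t)) (L (x', t') - Lk k (xx x') (tt t')).
lra.
Qed.

End local_time.

(** * Half-open boxes as a generating class stable under intersection *)

Section boxes.
Variables (R : realType) (d : nat).
Implicit Types (a b x : d.-tuple R).

Definition box a b : set (d.-tuple R) := [set x | forall i, tnth a i < tnth x i <= tnth b i].

Definition boxes : set (set (d.-tuple R)) := [set box p.1 p.2 | p in [set: d.-tuple R * d.-tuple R]].

Lemma measurable_box a b : measurable (box a b).
Proof.
rewrite (_ : box a b = \bigcap_(l in setT)
   ((fun v : d.-tuple R => tnth v l) @^-1` `]tnth a l, tnth b l])).
  apply: fin_bigcap_measurable => // l _.
  rewrite -[X in measurable X]setTI; apply: measurable_tnth => //; exact: measurable_itv.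
apply/seteqP; split => [y H l _|y H l] /=; first by rewrite in_itv/= H.
by have := H l I; rewrite /= in_itv.
Qed.

Lemma boxes_setI : setI_closed boxes.
Proof.
move=> _ _ [[a b] _ <-] [[a' b'] _ <-] /=.
exists ([tuple Num.max (tnth a i) (tnth a' i) | i < d], [tuple Num.min (tnth b i) (tnth b' i) | i < d]) => //=.
apply/seteqP; split => [x H|x [H1 H2]].
  split => i; have := H i; rewrite !tnth_mktuple gt_max le_min;
    by move=> /andP[/andP[h1 h2] /andP[h3 h4]]; rewrite ?h1 ?h2 ?h3 ?h4.
by move=> i; rewrite !tnth_mktuple gt_max le_min; have /andP[-> ->] := H1 i; have /andP[-> ->] := H2 i.
Qed.

Lemma bigcup_box : \bigcup_n box (cst_pt d (- n%:R)) (cst_pt d n%:R) = setT.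
Proof.
rewrite -subTset => x _; pose A := \sum_i `|tnth x i|.
have A0 : 0 <= A by exact: sumr_ge0.
exists (Num.bound A) => // i; rewrite !tnth_nseq.
have xA : `|tnth x i| < (Num.bound A)%:R.
  by apply: le_lt_trans (archi_boundP A0); rewrite /A (bigD1 i)//= lerDl sumr_ge0.
by move: xA; rewrite ltr_norml => /andP[-> /ltW].
Qed.

Lemma measurable_boxes : @measurable _ (d.-tuple R) = <<s boxes >>.
Proof.
apply/seteqP; split; last first.
  apply: smallest_sub; first exact: sigma_algebra_measurable.
  by move=> _ [[a b] _ <-]; exact: measurable_box.
apply: smallest_sub; first exact: smallest_sigma_algebra.
move=> A; rewrite -bigcup_seq => -[i _ [B mB <-]].
pose f : g_sigma_algebraType boxes -> measurableTypeR R := fun x => tnth (x : d.-tuple R) i.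
suff mf : measurable_fun setT f by exact: mf.
apply: (@measurability _ _ _ _ _ _ (@ocitv R)) => //.
move=> _ [_ [[u v] _ <-] <-]; rewrite setTI.
have -> : f @^-1` `]u, v]%classic = \bigcup_n box
    [tuple if k == i then u else - n%:R | k < d] [tuple if k == i then v else n%:R | k < d].
  apply/seteqP; split => [x /=|x [n _ H] /=]; last first.
    by have := H i; rewrite !tnth_mktuple eqxx in_itv.
  rewrite in_itv/= => xi; have : (\bigcup_n box (cst_pt d (- n%:R)) (cst_pt d n%:R)) x by rewrite bigcup_box.
  move=> [n _ H]; exists n => // k; rewrite !tnth_mktuple; case: eqP => [->//|_].
  by have := H k; rewrite !tnth_nseq.
apply: bigcupT_measurable => n; apply: sub_gen_smallest.
by exists ([tuple if k == i then u else - n%:R | k < d], [tuple if k == i then v else n%:R | k < d]).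
Qed.

End boxes.

Section weighted_pushforward.
Context d1 d2 (S : measurableType d1) (T : measurableType d2) (R : realType).
Variables (mu : {measure set S -> \bar R}) (phi : S -> T) (f : S -> R).
Hypotheses (mphi : measurable_fun setT phi) (mf : measurable_fun setT f) (f0 : forall s, 0 <= f s).

(** Image under [phi] of the measure with density [f]. Both sides of the occupation formula have
    this form, so that uniqueness of measures applies to them. *)
Definition wpush (A : set T) : \bar R := (\int[mu]_s (\1_A (phi s) * f s)%:E)%E.

Let w0 : wpush set0 = 0%E.
Proof. by rewrite /wpush integral0_eq// => s _; rewrite indic0 mul0r. Qed.

Let w_ge0 A : (0 <= wpush A)%E.
Proof. by apply: integral_ge0 => s _; rewrite lee_fin mulr_ge0. Qed.

Let w_sigma_additive : semi_sigma_additive wpush.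
Proof.
move=> F mF tF mUF.
have mI A : measurable A -> measurable_fun setT (fun s => (\1_A (phi s) * f s)%:E).
  move=> mA; apply/measurable_EFinP; apply: measurable_funM => //.
  exact: (measurableT_comp (measurable_indic mA) mphi).
have -> : wpush (\bigcup_n F n) = (\sum_(0 <= n <oo) wpush (F n))%E.
  rewrite -integral_nneseries//; last 2 first.
  - by move=> n; exact: mI.
  - by move=> n s _; rewrite lee_fin mulr_ge0.
  apply: eq_integral => s _.
  have [[n _ Fn]|no] := pselect ((\bigcup_n F n) (phi s)); last first.
    rewrite indicE memNset// mul0r eseries0// => n _ _; rewrite indicE memNset ?mul0r// => Fn.
    by apply: no; exists n.
  rewrite indicE mem_set ?mul1r; last by exists n.
  rewrite (nneseriesD1 (n := n))//; last by move=> k _; rewrite lee_fin mulr_ge0.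
  rewrite eseries0 ?adde0 ?indicE ?mem_set ?mul1r// => k _ /andP[_ kn].
  rewrite indicE memNset ?mul0r// => Fk; move/trivIsetP : tF => /(_ _ _ I I kn).
  by move/seteqP => [+ _] => /(_ (phi s)); apply.
apply: is_cvg_nneseries => n _ _; exact: w_ge0.
Qed.

HB.instance Definition _ := isMeasure.Build _ _ _ wpush w0 w_ge0 w_sigma_additive.

Definition wpush_measure : {measure set T -> \bar R} := wpush.

End weighted_pushforward.

Section atan_limits.
Variable R : realType.

Lemma pow2_infty : (2 ^+ j : R) @[j --> \oo] --> +oo.
Proof.
apply/cvgryPge => A; pose n := Num.bound `|A|; exists n => // j /= nj.
apply: (@le_trans _ _ n%:R).
  by apply: (le_trans (ler_norm A)); rewrite ltW// archi_boundP.
by rewrite -natrX ler_nat (leq_trans nj)// ltnW// ltn_expl.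
Qed.

Lemma sh_cvg0 : (2 ^+ j : R)^-1 @[j --> \oo] --> (0 : R).
Proof.
apply/cvgrPdist_lt => e e0; have [n _ Hn] := (cvgryPge _).1 pow2_infty (2 / e).
exists n => // j /Hn; rewrite sub0r normrN => h.
rewrite gtr0_norm ?invr_gt0 ?exprn_gt0//.
rewrite -[ltRHS]invrK ltf_pV2 ?posrE ?exprn_gt0 ?invr_gt0//.
apply: lt_le_trans h; rewrite ltr_pdivlMr// mulVf ?gt_eqF//; lra.
Qed.

(** The shift 2^(-j) times 4^j tends to infinity, so the limit is the same at y = b as for y < b:
    the closed end is included. *)
Lemma atan_up (b y : R) : y <= b -> atan (2 ^+ (2 * j) * (b + (2 ^+ j)^-1 - y)) @[j --> \oo] --> pi / 2.
Proof.
move=> yb; apply: (@cvg_comp _ _ _ (fun j => 2 ^+ (2 * j) * (b + (2 ^+ j)^-1 - y)) atan _ _ _ _ (@cvgy_atan R)).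
apply/cvgryPge => A; have [n _ Hn] := (cvgryPge _).1 pow2_infty A.
exists n => // j /Hn/le_trans; apply.
have p0 : 0 < 2 ^+ j :> R by rewrite exprn_gt0.
rewrite -addrAC mulrDr (_ : 2 ^+ (2 * j) = 2 ^+ j * 2 ^+ j); last by rewrite -exprD addnn mul2n.
by rewrite -[X in _ + X]mulrA divff ?gt_eqF// mulr1 lerDr mulr_ge0 ?subr_ge0// mulr_ge0 ?ltW.
Qed.

Lemma atan_down (b y : R) : b < y -> atan (2 ^+ (2 * j) * (b + (2 ^+ j)^-1 - y)) @[j --> \oo] --> - (pi / 2).
Proof.
move=> by_; rewrite (_ : (fun j => _) = (fun j => - atan (2 ^+ (2 * j) * (y - b - (2 ^+ j)^-1)))); last first.
  by apply/funext => j; rewrite -atanN; congr atan; ring.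
apply: cvgN.
apply: (@cvg_comp _ _ _ (fun j => 2 ^+ (2 * j) * (y - b - (2 ^+ j)^-1)) atan _ _ _ _ (@cvgy_atan R)).
apply/cvgryPge => A; have [n _ Hn] := (cvgryPge _).1 pow2_infty (Num.max A (2 / (y - b))).
exists n => // j /Hn; rewrite ge_max => /andP[h1 h2]; apply: (le_trans h1).
have p0 : 0 < 2 ^+ j :> R by rewrite exprn_gt0.
have yb : 0 < y - b by rewrite subr_gt0.
rewrite ler_pdivrMr// in h2.
rewrite (_ : 2 ^+ (2 * j) * _ = 2 ^+ j * (2 ^+ j * (y - b) - 1)).
  by rewrite ler_peMr ?(ltW p0)//; lra.
by rewrite mul2n -addnn exprD; field; rewrite gt_eqF.
Qed.

Lemma atan_indic (a b y : R) : a < b ->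
  (atan (2 ^+ (2 * j) * (b + (2 ^+ j)^-1 - y)) - atan (2 ^+ (2 * j) * (a + (2 ^+ j)^-1 - y))) / pi
    @[j --> \oo] --> ((a < y <= b)%R%:R : R).
Proof.
move=> ab; have p0 := pi_gt0 R.
have [ya|ay] := leP y a.
  rewrite [X in _ --> X](_ : _ = (pi / 2 - pi / 2) / pi); last by rewrite subrr mul0r.
  apply: cvgM; last exact: cvg_cst.
  by apply: cvgB; apply: atan_up => //; rewrite (le_trans ya)// ltW.
have [yb|by_] := leP y b.
  rewrite [X in _ --> X](_ : _ = (pi / 2 - - (pi / 2)) / pi); last first.
    by rewrite opprK -splitr divff// gt_eqF.
  apply: cvgM; last exact: cvg_cst.
  by apply: cvgB; [exact: atan_up|exact: atan_down].
rewrite [X in _ --> X](_ : _ = (- (pi / 2) - - (pi / 2)) / pi); last by rewrite subrr mul0r.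
apply: cvgM; last exact: cvg_cst.
by apply: cvgB; exact: atan_down.
Qed.

End atan_limits.

Lemma integrable_rect (R : realType) n (a b : n.-tuple R) (C : R) :
  (forall l, tnth a l <= tnth b l) ->
  (lebT R n).-integrable setT (fun x => (\1_(rect a b) x * C)%:E).
Proof.
move=> ab; have mr := measurable_rect a b.
suff i1 : (lebT R n).-integrable setT (EFin \o \1_(rect a b)).
  rewrite (_ : (fun x => _) = (fun x => C%:E * (EFin \o \1_(rect a b)) x)%E).
    exact: integrableZl.
  by apply/funext => y; rewrite /= -EFinM mulrC.
apply/integrableP; split; first by apply/measurable_EFinP; exact: measurable_indic.
under eq_integral do rewrite gee0_abs ?lee_fin//.
by rewrite integral_indic// setIT [X in (X < _)%E](lebT_rect ab) ltry.
Qed.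

Lemma pk_oppr (R : realType) (q y : R) : pk q (- y) = pk q y.
Proof. by rewrite /pk mulrN sqrrN. Qed.

Lemma cvg_prod_ord (R : realType) n (f : nat -> 'I_n -> R) (l : 'I_n -> R) :
  (forall i, f j i @[j --> \oo] --> l i) ->
  \prod_(i < n) f j i @[j --> \oo] --> \prod_(i < n) l i.
Proof.
elim: n f l => [|n IH] f l fl.
  by rewrite big_ord0; under eq_fun do rewrite big_ord0; exact: cvg_cst.
rewrite big_ord_recl; under eq_fun do rewrite big_ord_recl.
by apply: cvgM; [exact: fl|apply: (IH (fun j i => f j (lift ord0 i))) => i; exact: fl].
Qed.

Section occupation.
Context (R : realType) (dO : measure_display) (Omega : measurableType dO).
Variables (N d : nat).
Variable X : 'I_d -> Omega -> N.-tuple R -> R.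
Hypothesis mXj : forall k, measurable_fun [set: Omega * N.-tuple R] (fun p => X k p.1 p.2).
Variables (eps T : R).
Hypotheses (eps0 : 0 < eps) (epsT : eps < T).
Local Notation leb := (@lebesgue_measure R).
Local Notation I := (rect (cst_pt N eps) (cst_pt N T)).
Local Notation rc t := (rect (cst_pt N eps) t).
Implicit Types (s : N.-tuple R) (x a b : d.-tuple R).
Variable w : Omega.
Variables (K th : R).
Hypotheses (K0 : 0 < K) (th01 : 0 < th < 1).
Hypothesis HG : forall k (y : 'I_d -> R) t, (forall i, `|y i| <= 2 ^+ k) -> I t -> T - eps <= 2 ^+ k ->
  `|avg X y (2 ^+ k) (rc t) w| <= K * th ^+ k.
Variable t : N.-tuple R.
Hypothesis It : I t.
Local Notation L x := (ltime X eps w (tnth x) t).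
Local Notation aL q x := (approxL X eps q w (tnth x) t).

Definition path_value s : d.-tuple R := [tuple X k w s | k < d].

Lemma measurable_path_value : measurable_fun setT path_value.
Proof.
apply/measurable_fun_tnthP => i; rewrite (_ : _ \o _ = X i w); last first.
  by apply/funext => s /=; rewrite tnth_mktuple.
exact: (measurableT_comp (mXj i) (@measurable_pair1 _ _ Omega _ w)).
Qed.

Let mrc : measurable (rc t). Proof. exact: measurable_rect. Qed.

Lemma measurable_joint_pkd q :
  measurable_fun [set: d.-tuple R * N.-tuple R]
    (fun p => \1_(rc t) p.2 * pkd q (incr X (tnth p.1) w p.2)).
Proof.
apply: measurable_funM.
  exact: (measurableT_comp (measurable_indic mrc)).
apply: measurable_pkd => k; apply: measurable_funB.
  apply: (measurableT_comp (measurableT_comp (mXj k) (@measurable_pair1 _ _ Omega _ w))).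
  exact: measurable_snd.
exact: (measurableT_comp (measurable_tnth k)).
Qed.

Lemma approxL_EFin q x : 0 <= q ->
  (aL q x)%:E = (\int[lebT R N]_s (\1_(rc t) s * pkd q (incr X (tnth x) w s))%:E)%E.
Proof.
move=> q0; rewrite fineK//; apply: (integrable_fin_num measurableT).
by apply: (integrable_approxL mXj eps0) => //; exact: sub_rect.
Qed.

Lemma measurable_approxL q : 0 <= q -> measurable_fun setT (fun x => aL q x).
Proof.
move=> q0.
pose F (p : d.-tuple R * N.-tuple R) : \bar R :=
  (\1_(rc t) p.2 * pkd q (incr X (tnth p.1) w p.2))%:E.
have mF : measurable_fun setT F by apply/measurable_EFinP; exact: measurable_joint_pkd.
have F0 p : (0 <= F p)%E by rewrite lee_fin mulr_ge0 ?pkd_ge0.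
have mI := @measurable_fun_fubini_tonelli_F _ _ _ _ R (lebT R N) F mF F0.
exact: (measurableT_comp (fine_measurable measurableT) mI).
Qed.

Lemma cvg_aL x : aL (2 ^+ k) x @[k --> \oo] --> L x.
Proof. exact: (cvg_approxL mXj eps0 K0 th01 HG). Qed.

Lemma measurable_ltime : measurable_fun setT (fun x => L x).
Proof.
have q0 k : 0 <= 2 ^+ k :> R by rewrite exprn_ge0.
exact: (@measurable_fun_cvg _ (d.-tuple R) R setT (fun k x => aL (2 ^+ k) x) _
  (fun k => measurable_approxL (q0 k)) (fun x _ => @cvg_aL x)).
Qed.

(** The exact integral over x in the rectangle from a to b of the product kernel centred at X(s);
    each coordinate contributes a difference of arctangents. *)
Definition half q a b s : R :=
  \prod_(i < d) ((atan (q * (tnth b i - X i w s)) - atan (q * (tnth a i - X i w s))) / pi).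

Lemma integral_rect_approxL q a b : 0 < q -> (forall i, tnth a i < tnth b i) ->
  (\int[lebT R d]_x (\1_(rect a b) x * aL q x)%:E =
   \int[lebT R N]_s (\1_(rc t) s * half q a b s)%:E)%E.
Proof.
move=> q0 ab; have mr := measurable_rect a b.
pose F (p : d.-tuple R * N.-tuple R) : \bar R :=
  (\1_(rect a b) p.1 * (\1_(rc t) p.2 * pkd q (incr X (tnth p.1) w p.2)))%:E.
have mF : measurable_fun setT F.
  apply/measurable_EFinP; apply: measurable_funM; last exact: measurable_joint_pkd.
  exact: (measurableT_comp (measurable_indic mr)).
have F0 p : (0 <= F p)%E by rewrite lee_fin !mulr_ge0 ?pkd_ge0 ?(ltW q0).
transitivity (\int[lebT R d]_x \int[lebT R N]_s F (x, s))%E.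
  apply: eq_integral => x _; rewrite EFinM approxL_EFin ?(ltW q0)//.
  rewrite -ge0_integralZl_EFin//.
  - by move=> s _; rewrite lee_fin mulr_ge0 ?pkd_ge0 ?(ltW q0).
  - apply/measurable_EFinP; apply: measurable_funM; first exact: measurable_indic.
    exact: measurable_pkd_section.
rewrite fubini_tonelli//; apply: eq_integral => s _.
pose g i r : \bar R := (\1_(`[tnth a i, tnth b i]%classic : set R) r * pk q (X i w s - r))%:E.
have mg i : measurable_fun setT (g i).
  apply/measurable_EFinP; apply: measurable_funM.
    by apply: measurable_indic; exact: measurable_itv.
  by apply: (measurableT_comp (measurable_pk q)); exact: measurable_funB.
have g0 i r : (0 <= g i r)%E by rewrite lee_fin mulr_ge0 ?pk_ge0 ?(ltW q0).
transitivity ((\1_(rc t) s)%:E * \int[lebT R d]_x \big[*%E/1%E]_(i < d) g i (tnth x i))%E.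
  rewrite -ge0_integralZl_EFin//.
  - apply: eq_integral => x _; rewrite prodEFin -EFinM; congr (_%:E).
    rewrite mulrCA big_split/=; congr (_ * (_ * _)).
    rewrite indicE; case: (boolP (x \in _)) => [|].
      by rewrite inE => H; rewrite big1// => l _; rewrite indicE mem_set//= in_itv/= H.
    rewrite notin_setE => /existsNP[l]Hl; rewrite (bigD1 l)//= indicE memNset ?mul0r//.
  - by move=> x _; apply: prode_ge0 => i _; exact: g0.
  - apply: measurable_prode => i; apply: (measurableT_comp (mg i)); exact: measurable_tnth.
rewrite (integral_lebT_prod mg g0) EFinM; congr (_ * _)%E.
rewrite /half -prodEFin; apply: eq_bigr => i _.
transitivity (\int[leb]_(r in `[tnth a i, tnth b i]) (pk q (r - X i w s))%:E)%E.
  rewrite [RHS]integral_mkcond; apply: eq_integral => r _; rewrite patchE /g indicE.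
  by case: ifP => _; rewrite ?mul1r ?mul0r// -opprB pk_oppr.
exact: integral_pk_segment.
Qed.

Let sh (j : nat) : R := (2 ^+ j)^-1.
Let shift j a : d.-tuple R := [tuple tnth a i + sh j | i < d].

Let sh_gt0 j : 0 < sh j. Proof. by rewrite invr_gt0 exprn_gt0. Qed.
Let sh_le1 j : sh j <= 1. Proof. by rewrite invf_le1 ?exprn_gt0// exprn_ege1// ler1n. Qed.

(* Boxes shifted by 2^-j are paired with the kernel of width 4^-j: the limits of
   the arctangents in [half] are then exactly indicators of half-open intervals. *)
Lemma shifted_rect a b x :
  \forall j \near \oo, \1_(rect (shift j a) (shift j b)) x = \1_(box a b) x :> R.
Proof.
have H : \forall j \near \oo, forall i : 'I_d,
    (tnth a i + sh j <= tnth x i <= tnth b i + sh j) = (tnth a i < tnth x i <= tnth b i).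
  apply: filter_forall => i; move: (tnth a i) (tnth b i) (tnth x i) => u v y.
  have small (e : R) : 0 < e -> \forall j \near \oo, sh j < e.
    move=> e0; have /cvgrPdist_lt/(_ e e0) := @sh_cvg0 R.
    by apply: filterS => j; rewrite sub0r normrN gtr0_norm.
  have [yu|uy] := leP y u.
    by apply: nearW => j; have := sh_gt0 j => s0; rewrite leNgt (_ : y < u + sh j)//; lra.
  have h1 := small (y - u) ltac:(by rewrite subr_gt0).
  have [yv|vy] := leP y v.
    apply: filterS h1 => j h; have := sh_gt0 j => s0; apply/andP; split; lra.
  have h2 := small (y - v) ltac:(by rewrite subr_gt0).
  apply: filterS2 h1 h2 => j h h'; apply/negbTE; rewrite negb_and -!ltNge; apply/orP; right; lra.
apply: filterS H => j Hj; rewrite !indicE; congr (nat_of_bool _)%:R.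
apply/idP/idP; rewrite !inE => H i; have := H i; rewrite !tnth_mktuple Hj//.
Qed.

(** Dominated convergence on both sides of [integral_rect_approxL] with q = 4^j: in x the averages
    are bounded on a fixed cube containing all shifted rectangles, in s the factor [half] has
    modulus at most 1. *)
Lemma occupation_box a b : (forall i, tnth a i < tnth b i) ->
  (\int[lebT R d]_x (\1_(box a b) x * L x)%:E =
   \int[lebT R N]_s (\1_(box a b) (path_value s) * \1_(rc t) s)%:E)%E.
Proof.
move=> ab.
pose q j : R := 2 ^+ (2 * j).
have q0 j : 0 < q j by rewrite exprn_gt0.
pose fj j x : \bar R := (\1_(rect (shift j a) (shift j b)) x * aL (q j) x)%:E.
pose gj j s : \bar R := (\1_(rc t) s * half (q j) (shift j a) (shift j b) s)%:E.
have fg j : (\int[lebT R d]_x fj j x = \int[lebT R N]_s gj j s)%E.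
  by apply: integral_rect_approxL => // i; rewrite !tnth_mktuple ltrD2r.
pose A := \sum_i (`|tnth a i| + `|tnth b i|) + 1.
have aA i : `|tnth a i| + `|tnth b i| <= A - 1.
  by rewrite /A addrK (bigD1 i)//= lerDl sumr_ge0// => k _; rewrite addr_ge0.
have A0 : 0 <= A by rewrite addr_ge0// sumr_ge0// => k _; rewrite addr_ge0.
have [C HC] := approxL_bounded mXj eps0 epsT K0 th01 HG A.
have rectA j x : rect (shift j a) (shift j b) x -> forall i, `|tnth x i| <= A.
  move=> H i; have /andP[] := H i; rewrite !tnth_mktuple => h1 h2.
  have := aA i; have := sh_gt0 j; have := sh_le1 j; move: (ler_norm (tnth b i)) (ler_norm (- tnth a i)).
  rewrite normrN ler_norml => *; apply/andP; split; have := normr_ge0 (tnth a i); have := normr_ge0 (tnth b i); lra.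
have cf : (\int[lebT R d]_x fj j x)%E @[j --> \oo] --> (\int[lebT R d]_x (\1_(box a b) x * L x)%:E)%E.
  apply: (@dominated_cvg _ _ _ _ _ measurableT fj _
    (fun x => (\1_(rect (cst_pt d (- A)) (cst_pt d A)) x * C)%:E)).
  - move=> j; apply/measurable_EFinP; apply: measurable_funM.
      by apply: measurable_indic; exact: measurable_rect.
    exact: (measurable_approxL (ltW (q0 j))).
  - move=> x _; apply: cvg_EFin; first exact: nearW.
    apply: cvgM; first by apply: cvg_near_cst; exact: shifted_rect.
    apply/cvgrPdist_lt => e e0; have /cvgrPdist_lt/(_ e e0)[n _ Hn] := @cvg_aL x.
    by exists n => // j /= nj; apply: Hn => /=; rewrite (leq_trans nj)// mul2n -addnn leq_addr.
  - by [].
  - by apply: integrable_rect => i; rewrite !tnth_nseq; lra.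
  - move=> j x _; rewrite /fj lee_fin indicE; case: (boolP (x \in _)); last first.
      move=> _; rewrite mul0r normr0 mulr_ge0//.
      by have /andP[] := HC 0%N (fun=> 0) t (fun i => ltac:(by rewrite normr0)) It; exact: le_trans.
    rewrite inE => /rectA xA; rewrite mul1r indicE mem_set ?mul1r; last first.
      by move=> i; rewrite !tnth_nseq -ler_norml.
    by have /andP[h1 h2] := HC (2 * j)%N (tnth x) t xA It; rewrite ger0_norm.
have cg : (\int[lebT R N]_s gj j s)%E @[j --> \oo] -->
    (\int[lebT R N]_s (\1_(box a b) (path_value s) * \1_(rc t) s)%:E)%E.
  have hle j s : `|half (q j) (shift j a) (shift j b) s| <= 1.
    rewrite /half normr_prod; apply: prodr_ile1 => i _; rewrite normr_ge0/=.
    rewrite normrM [X in _ * X]gtr0_norm ?invr_gt0 ?pi_gt0// ler_pdivrMr ?pi_gt0// mul1r.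
    have := atan_gtNpi2 (q j * (tnth (shift j a) i - X i w s)); have := atan_ltpi2 (q j * (tnth (shift j a) i - X i w s)).
    have := atan_gtNpi2 (q j * (tnth (shift j b) i - X i w s)); have := atan_ltpi2 (q j * (tnth (shift j b) i - X i w s)).
    by move=> *; rewrite ler_norml; apply/andP; split; lra.
  apply: (@dominated_cvg _ _ _ _ _ measurableT gj _ (fun s => (\1_(rc t) s * 1)%:E)).
  - move=> j; apply/measurable_EFinP; apply: measurable_funM; first exact: measurable_indic.
    have mX i : measurable_fun setT (X i w).
      exact: (measurableT_comp (mXj i) (@measurable_pair1 _ _ Omega _ w)).
    apply: measurable_prod => i _; apply: measurable_funM => //; apply: measurable_funB;
      apply: (measurableT_comp (continuous_measurable_fun (@continuous_atan R)));
      by apply: measurable_funM => //; apply: measurable_funB.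
  - move=> s _; apply: cvg_EFin; first exact: nearW.
    rewrite mulrC; apply: cvgM; first exact: cvg_cst.
    rewrite [X in _ --> X](_ : _ = \prod_(i < d) (tnth a i < X i w s <= tnth b i)%R%:R); last first.
      rewrite indicE; case: (boolP (_ \in _)) => [|].
        rewrite inE => H; rewrite big1// => i _; have := H i.
        by rewrite tnth_mktuple => ->.
      rewrite notin_setE => /existsNP[i]Hi; rewrite (bigD1 i)//=.
      by move: Hi; rewrite tnth_mktuple => /negP/negbTE->; rewrite mul0r.
    apply: cvg_prod_ord => i; under eq_fun do rewrite !tnth_mktuple.
    exact: atan_indic.
  - by [].
  - by apply: integrable_rect => i; have /andP[] := It i.
  - move=> j s _; rewrite /gj lee_fin normrM ger0_norm// ler_wpM2l//.
rewrite -(cvg_lim _ cf)// -(cvg_lim _ cg)//; congr (limn _).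
by apply/funext => j; exact: fg.
Qed.

(** As functions of B both sides are measures; they agree on half-open boxes and are finite on an
    exhausting sequence of them. *)
Lemma occupation_measure (B : set (d.-tuple R)) : measurable B ->
  (\int[lebT R N]_s (\1_B (path_value s) * \1_(rc t) s)%:E =
   \int[lebT R d]_x (\1_B x * L x)%:E)%E.
Proof.
move=> mB.
have mL := measurable_ltime.
have L0 x : 0 <= L x by exact: (ltime_ge0 mXj eps0 K0 th01 HG).
have mi : measurable_fun setT (\1_(rc t) : N.-tuple R -> R) by exact: measurable_indic.
have i0 s : 0 <= \1_(rc t) s :> R by [].
pose m1 := wpush_measure (lebT R N) measurable_path_value mi i0.
pose m2 := wpush_measure (lebT R d) (@measurable_id _ (d.-tuple R) setT) mL L0.
apply: (@measure_unique _ R _ _ (fun n => box (cst_pt d (- n%:R)) (cst_pt d n%:R))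
  (@measurable_boxes R d) (@boxes_setI R d) _ (@bigcup_box R d) m1 m2) => //.
- by move=> n; exists (cst_pt d (- n%:R), cst_pt d n%:R).
- move=> _ [[a b] _ <-] /=.
  have [ab|/existsNP[i /negP]] := pselect (forall i, tnth a i < tnth b i).
    by apply/esym; exact: occupation_box.
  rewrite -leNgt => ba; have -> : box a b = set0.
    rewrite -subset0 => x /(_ i)/andP[h1 h2]; move: ba; rewrite leNgt => /negP; apply.
    exact: lt_le_trans h2.
  exact: (etrans (measure0 m1) (esym (measure0 m2))).
- move=> n; apply: (@le_lt_trans _ _ (lebT R N (rc t))).
    rewrite -[leRHS]mul1e -[in leRHS](setIT (rc t)) -integral_indic// mul1e.
    apply: ge0_le_integralT => s _; first by rewrite lee_fin mulr_ge0.
    by rewrite lee_fin ler_piMl// indicE lern1 leq_b1.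
  rewrite [X in (X < _)%E]lebT_rect ?ltry// => l; by have /andP[] := It l.
Qed.

Lemma occupation_density (B : set (d.-tuple R)) : measurable B ->
  lebN_set [set s | rc t s /\ B [tuple X k w s | k < d]] =
  lebN (fun x => (\1_B x * L x)%:E).
Proof.
move=> mB; rewrite /lebN_set.
have L0 x : 0 <= L x by exact: (ltime_ge0 mXj eps0 K0 th01 HG).
rewrite (lebN_integral (f := fun x => (\1_B x * L x)%:E)); last 2 first.
- apply/measurable_EFinP; apply: measurable_funM; last exact: measurable_ltime.
  exact: measurable_indic.
- by move=> x; rewrite lee_fin mulr_ge0.
rewrite -occupation_measure//.
have -> : (fun s => (\1_[set s | rc t s /\ B [tuple X k w s | k < d]] s)%:E) =
    (fun s => (\1_B (path_value s) * \1_(rc t) s)%:E) :> (_ -> \bar R).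
  apply/funext => s; rewrite !indicE -natrM mulnb; congr ((nat_of_bool _)%:R%:E).
  by apply/idP/andP; rewrite !inE /= => -[].
apply: lebN_integral => [|s]; last by rewrite lee_fin mulr_ge0.
apply/measurable_EFinP; apply: measurable_funM; last exact: measurable_indic.
exact: (measurableT_comp (measurable_indic mB) measurable_path_value).
Qed.

End occupation.

Theorem theorem3p1 (R : realType) (dO : measure_display) (Omega : measurableType dO)
    (P : probability Omega R) (N d : nat) (alpha : R)
    (h : 'I_N -> N.-tuple R -> R) (c : R)
    (X : 'I_d -> Omega -> N.-tuple R -> R) (eps T : R) :
  0 < alpha -> alpha <= 2 ->
  hurst_assumptions h ->
  0 < c ->
  lebN (fun v => (powR `|c * lmss_kernel alpha h (cst_pt N 1) v| alpha)%:E) = 1%E ->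
  (forall k, measurable_fun [set: Omega * N.-tuple R] (fun p => X k p.1 p.2)) ->
  is_LMSS P alpha h c X ->
  0 < eps -> eps < T ->
  let I := rect (cst_pt N eps) (cst_pt N T) in
  d%:R < inf [set \sum_(l < N) (h l v)^-1 | v in I] ->
  {ae P, forall w, exists L : 'rV[R]_d * 'rV[R]_N -> R,
     {within [set p | (@tup2row R N @` I) p.2], continuous L} /\
     forall t : N.-tuple R, I t ->
       forall B : set (d.-tuple R), measurable B ->
         lebN_set [set s | rect (cst_pt N eps) t s /\
                           B [tuple X k w s | k < d]] =
         lebN (fun x : d.-tuple R =>
                 (\1_B x * L (tup2row x, tup2row t))%:E)}.
Proof.
move=> al0 al2 hh c0 _ mXj HX eps0 epsT I dinf.
(* One event of full probability serves all x, t and B at once; from here on w is fixed and the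
   argument is deterministic. *)
apply: filterS (ae_geometric al0 al2 c0 mXj HX eps0 epsT hh dinf) => w [K [th [K0 th01 HG]]].
exists (fun p : 'rV[R]_d * 'rV[R]_N => ltime X eps w (fun k => p.1 ord0 k) [tuple p.2 ord0 l | l < N]).
split; first exact: (ltime_continuous mXj eps0 epsT K0 th01 HG).
move=> t It B mB; rewrite (occupation_density mXj eps0 epsT K0 th01 HG It mB).
have Ex (x : d.-tuple R) : (fun k => tup2row x ord0 k) = tnth x.
  by apply/funext => k; rewrite mxE.
have Et : [tuple tup2row t ord0 l | l < N] = t.
  by apply/eq_from_tnth => l; rewrite tnth_mktuple mxE.
by apply: (f_equal (@lebN R d)); apply/funext => x; rewrite /= Ex Et.
Qed.
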